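(* Consider either (a) a linear system $\Delta=0$ with $\Delta_i(z)=\sum_{k=p+1}^N a^i_k(z_1,\dots,z_p)z_k+a^i_0(z_1,\dots,z_p)$, $1\le i\le s$, or (b) a semilinear system $\Delta=0$ with $\Delta_i(z)=\sum_{k=p+1}^N a^i_k(z_1,\dots,z_p)z_k+a^i_0(z_1,\dots,z_p,z_{p+1},\dots,z_{p+q})$, $1\le i\le s$, with smooth coefficients. Let $G=\{g_\eta\}$ be a one-parameter symmetry group of the system acting linearly in the dependent variables, $g_\eta(x,u)=(\Xi_\eta(x),\Phi_\eta(x)\cdot u+\Psi_\eta(x))$, and suppose that there exist $p<k_1<\dots<k_s\le N$ such that $J_{k_1,\dots,k_s}(\Delta)=\left(\frac{\partial\Delta_i}{\partial z_{k_j}}\right)_{i,j=1,\dots,s}$ is globally nonsingular, where in case (b) it is additionally required that $k_1,\dots,k_s$ correspond to indices of highest order derivatives of the dependent variables. Then, for every integer $k>0$, $G$ is an $\mathcal{AS}^k_\Delta$-symmetry group of the system.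
   Context: $\mathcal M\subseteq\mathbb R^p\times\mathbb R^q$ is open, with points $(x,u)$. $\mathcal M^{(n)}=\mathcal M\times\mathcal U_1\times\dots\times\mathcal U_n$ is the $n$-jet space, where $\mathcal U_k$ has coordinates $u^\alpha_J$ ($1\le\alpha\le q$, $J$ the derivative multi-indices of order $k$ in $p$ variables). $N=\dim\mathcal M^{(n)}$, $z=(z_1,\dots,z_N)=(x,u^{(n)})$ with $(z_1,\dots,z_p)=x$, $(z_{p+1},\dots,z_{p+q})=u$; highest order derivatives are the coordinates $u^\alpha_J$ with $|J|=n$. $\mathrm{pr}^{(n)}u$ consists of $u$ and its partial derivatives up to order $n$. Standing assumptions: the system is nondegenerate (locally solvable and of maximal rank), and $u^{(n)}\mapsto\Delta(x,u^{(n)})$ is slowly increasing uniformly for $x$ in compact sets, i.e. for every compact $K$ and multi-index $\alpha$ there is $r>0$ with $\sup_{x\in K,\,u^{(n)}}(1+|u^{(n)}|)^{-r}|\partial^\alpha\Delta(x,u^{(n)})|<\infty$. A symmetry group is a local transformation group on $\mathcal M$ mapping smooth solutions to smooth solutions whenever the action is defined. Colombeau algebra: $\mathcal G(\Omega)=\mathcal E_M(\Omega)/\mathcal N(\Omega)$, with $\mathcal E_M(\Omega)$ the nets $(u_\varepsilon)_{\varepsilon\in(0,1]}$ in $C^\infty(\Omega)$ such that for all compact $K\subset\Omega$ and all $\alpha$ there is $m$ with $\sup_K|\partial^\alpha u_\varepsilon|=O(\varepsilon^{-m})$, and $\mathcal N(\Omega)$ those with $\sup_K|\partial^\alpha u_\varepsilon|=O(\varepsilon^m)$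 for all $K,\alpha,m$. Action: $g_\eta U=\mathrm{cl}[(\Phi_\eta u_\varepsilon+\Psi_\eta)\circ\Xi_\eta^{-1}]\in\mathcal G(\Xi_\eta(\Omega))^q$ for $U=\mathrm{cl}[u_\varepsilon]\in\mathcal G(\Omega)^q$. $u\in\mathcal G(\Omega)^q$ is an associated solution ($u\in\mathcal A_\Delta$) if it has a representative with $\int\Delta_i(x,\mathrm{pr}^{(n)}u_\varepsilon(x))\varphi(x)\,dx\to0$ as $\varepsilon\to0$ for all $\varphi\in C_c^\infty(\Omega)$, $1\le i\le s$. For $k\in\mathbb N_0$, $u\in\mathcal A_\Delta$ belongs to $\mathcal{AS}^k_\Delta$ ($k$-strongly associated solution) if it has a representative such that for every $B\subseteq C_c^\infty(\Omega)$ bounded in $C_c^k(\Omega)$ (all $\varphi\in B$ supported in a common compact set and $\sup_{\varphi\in B}\sup_x|\partial^\alpha\varphi(x)|<\infty$ for $|\alpha|\le k$) one has $\lim_{\varepsilon\to0}\sup_{\varphi\in B}\int\Delta_i(x,\mathrm{pr}^{(n)}u_\varepsilon(x))\varphi(x)\,dx=0$, $1\le i\le s$. A symmetry group of the system is an $\mathcal{AS}^k_\Delta$-symmetry group if $g_\eta U\in\mathcal{AS}^k_\Delta$ whenever $U\in\mathcal{AS}^k_\Delta$ and $g_\eta U$ is defined. *)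

(* Defs.v *)
From mathcomp Require Import all_boot all_order all_algebra.
From mathcomp Require Import all_classical all_reals all_analysis.

Set Implicit Arguments.
Unset Strict Implicit.
Unset Printing Implicit Defensive.

Import Order.TTheory GRing.Theory Num.Theory.
Import numFieldNormedType.Exports.

Local Open Scope classical_set_scope.
Local Open Scope ring_scope.

Section smooth.
Context {R : realType}.

Definition iter_derive {V W : normedModType R} (vs : seq V) (f : V -> W) :
  V -> W := foldr (fun v h x => 'D_v h x) f vs.

(* Functions on an open set A are total functions of which only the restriction
   to A matters.  For a finite-dimensional V and an open A, the following is
   C^oo on A: all iterated directional derivatives exist and are continuous. *)
Definition smooth_on {V W : normedModType R} (A : set V) (f : V -> W) : Prop :=
  forall (vs : seq V) (x : V), A x ->
    {for x, continuous (iter_derive vs f)} /\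
    (forall v, derivable (iter_derive vs f) x v).

Definition partial {m : nat} (i : 'I_m) (f : 'rV[R]_m -> R) : 'rV[R]_m -> R :=
  fun x => 'D_(delta_mx 0 i) f x.

Definition partials {m : nat} (al : 'I_m -> nat) (f : 'rV[R]_m -> R) :
  'rV[R]_m -> R :=
  foldr (fun i h => iter (al i) (partial i) h) f (enum 'I_m).

Definition order_mi {m : nat} (al : 'I_m -> nat) : nat := (\sum_(i < m) al i)%N.

End smooth.

Section lebesgue.
Context (R : realType).

Fixpoint lebesgue_tuple (p : nat) :
    set (p.-tuple (measurableTypeR R)) -> \bar R :=
  match p with
  | 0%N => dirac [tuple]
  | p'.+1 => pushforward (lebesgue_measure \x @lebesgue_tuple p')%E
               (fun xt : measurableTypeR R * p'.-tuple (measurableTypeR R) =>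
                  [tuple of xt.1 :: xt.2])
  end.

Definition row_of_tuple {p : nat} (t : p.-tuple (measurableTypeR R)) : 'rV[R]_p :=
  \row_(i < p) tnth t i.

Definition integral_rV {p : nat} (Om : set 'rV[R]_p) (f : 'rV[R]_p -> R) :
  \bar R :=
  (\int[@lebesgue_tuple p]_(t in row_of_tuple @^-1` Om)
     (f (row_of_tuple t))%:E)%E.

End lebesgue.

(* (a, J) indexes the coordinate u^a_J, of order |J| <= n. *)
Notation jet_index p q n :=
  {aJ : 'I_q * {ffun 'I_p -> 'I_n.+1} | (\sum_(i < p) aJ.2 i <= n)%N}.

Definition jet_dim (p q n : nat) : nat := #|{: jet_index p q n}|.

Section jets.
Context {R : realType} {p q n : nat}.

Definition jet_dep (k : 'I_(jet_dim p q n)) : 'I_q := (val (enum_val k)).1.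

Definition jet_mi (k : 'I_(jet_dim p q n)) : 'I_p -> nat :=
  fun i => (val (enum_val k)).2 i.

Fact jet_index0_subproof (a : 'I_q) :
  (\sum_(i < p) ((a, [ffun=> ord0]) : 'I_q * {ffun 'I_p -> 'I_n.+1}).2 i <= n)%N.
Proof. by rewrite big1// => i _; rewrite ffunE. Qed.

Definition jet_index0 (a : 'I_q) : jet_index p q n :=
  exist _ (a, [ffun=> ord0]) (jet_index0_subproof a).

(* R^N with N = p + jet_dim: the points z = (x, u^(n)). *)
Notation jet := 'rV[R]_(p + jet_dim p q n).

Definition jet_x (z : jet) : 'rV[R]_p := lsubmx z.

Definition jet_un (z : jet) : 'rV[R]_(jet_dim p q n) := rsubmx z.

Definition jet_u (z : jet) : 'rV[R]_q :=
  \row_(a < q) jet_un z 0 (enum_rank (jet_index0 a)).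

Definition jet_space (M : set ('rV[R]_p * 'rV[R]_q)) : set jet :=
  [set z | M (jet_x z, jet_u z)].

(* (x, pr^(n) f (x)) *)
Definition prolong (f : 'rV[R]_p -> 'rV[R]_q) (x : 'rV[R]_p) : jet :=
  row_mx x (\row_k partials (jet_mi k) (fun y => f y 0 (jet_dep k)) x).

End jets.

Section systems.
Context {R : realType} {p q n s : nat}.
Notation X := 'rV[R]_p.
Notation U := 'rV[R]_q.
Notation jet := 'rV[R]_(p + jet_dim p q n).

Context (M : set (X * U)) (Delta : 'I_s -> jet -> R).

Definition smooth_solution (Om : set X) (f : X -> U) : Prop :=
  [/\ open Om, smooth_on Om f &
      forall x, Om x -> M (x, f x) /\ forall i, Delta i (prolong f x) = 0].

Definition solution_variety : set jet :=
  [set z | jet_space M z /\ forall i, Delta i z = 0].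

Definition locally_solvable : Prop :=
  forall z, solution_variety z ->
    exists (Om : set X) (f : X -> U),
      [/\ smooth_solution Om f, Om (jet_x z) & prolong f (jet_x z) = z].

Definition maximal_rank : Prop :=
  forall z, solution_variety z ->
    \rank (\matrix_(i < s, j < p + jet_dim p q n) partial j (Delta i) z) = s.

Definition nondegenerate_system : Prop := locally_solvable /\ maximal_rank.

Definition slowly_increasing : Prop :=
  forall (K : set X), compact K -> K `<=` fst @` M ->
  forall (al : 'I_(p + jet_dim p q n) -> nat), exists2 r : R, 0 < r &
    exists C : R, forall i z, jet_space M z -> K (jet_x z) ->
      (1 + `|jet_un z|) `^ (- r) * `|partials al (Delta i) z| <= C.

(* The coefficients live on fst @` M, the projection of M to x-space. *)
Definition linear_system : Prop :=
  exists (a : 'I_s -> 'I_(jet_dim p q n) -> X -> R) (a0 : 'I_s -> X -> R),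
    [/\ forall i k, smooth_on (fst @` M) (a i k),
        forall i, smooth_on (fst @` M) (a0 i) &
        forall i z, jet_space M z ->
          Delta i z =
            \sum_k a i k (jet_x z) * jet_un z 0 k + a0 i (jet_x z)].

Definition semilinear_system : Prop :=
  exists (a : 'I_s -> 'I_(jet_dim p q n) -> X -> R) (a0 : 'I_s -> X * U -> R),
    [/\ forall i k, smooth_on (fst @` M) (a i k),
        forall i, smooth_on M (a0 i) &
        forall i z, jet_space M z ->
          Delta i z =
            \sum_k a i k (jet_x z) * jet_un z 0 k + a0 i (jet_x z, jet_u z)].

(* u^a_J with |J| = n; it is a derivative, so n > 0. *)
Definition highest_order (k : 'I_(jet_dim p q n)) : Prop :=
  (0 < n)%N /\ order_mi (jet_mi k) = n.

Definition jacobian_minor (k : 'I_s -> 'I_(jet_dim p q n)) (z : jet) : 'M[R]_s :=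
  \matrix_(i, j) partial (rshift p (k j)) (Delta i) z.

Definition globally_nonsingular (k : 'I_s -> 'I_(jet_dim p q n)) : Prop :=
  forall z, jet_space M z -> jacobian_minor k z \in unitmx.

(* A local action of the additive group R on M: W is the domain of
   (eta, z) |-> g_eta z. *)
Definition local_transformation_group
    (W : set (R * (X * U))) (g : R -> X * U -> X * U) : Prop :=
  [/\ [/\ open W, (forall eta z, W (eta, z) -> M z /\ M (g eta z)) &
          smooth_on W (fun ez => g ez.1 ez.2)],
      (forall z, M z -> W (0, z) /\ g 0 z = z),
      (forall eta th z, W (th, z) -> W (eta, g th z) -> W (eta + th, z) ->
         g eta (g th z) = g (eta + th) z) &
      (forall eta z, W (eta, z) ->
         W (- eta, g eta z) /\ g (- eta) (g eta z) = z)].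

Definition graph_over (Om : set X) (f : X -> U) : set (X * U) :=
  [set (x, f x) | x in Om].

(* g_eta . f is defined when g_eta is defined on the graph of f and maps it onto
   the graph of a smooth function h on an open set. *)
Definition symmetry_group
    (W : set (R * (X * U))) (g : R -> X * U -> X * U) : Prop :=
  local_transformation_group W g /\
  forall (eta : R) (Om Om' : set X) (f h : X -> U),
    smooth_solution Om f ->
    (forall x, Om x -> W (eta, (x, f x))) ->
    open Om' -> smooth_on Om' h ->
    g eta @` graph_over Om f = graph_over Om' h ->
    smooth_solution Om' h.

(* g_eta (x, u) = (Xi_eta(x), Phi_eta(x) . u + Psi_eta(x)), with u a row *)
Definition acts_linearly
    (W : set (R * (X * U))) (g : R -> X * U -> X * U)
    (Xi : R -> X -> X) (Phi : R -> X -> 'M[R]_q) (Psi : R -> X -> U) : Prop :=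
  forall eta x u, W (eta, (x, u)) ->
    g eta (x, u) = (Xi eta x, u *m (Phi eta x)^T + Psi eta x).

End systems.

Section colombeau.
Context {R : realType} {p q : nat}.
Notation X := 'rV[R]_p.
Notation U := 'rV[R]_q.

(* Nets are indexed by R; only the indices in ]0, 1] matter. *)
Definition moderate (Om : set X) (u : R -> X -> R) : Prop :=
  (forall e, 0 < e <= 1 -> smooth_on Om (u e)) /\
  forall (K : set X), compact K -> K `<=` Om ->
  forall al : 'I_p -> nat, exists (m : nat) (C : R),
    \forall e \near 0^'+, forall x, K x -> `|partials al (u e) x| <= C * e ^- m.

Definition negligible_net (Om : set X) (u : R -> X -> R) : Prop :=
  moderate Om u /\
  forall (K : set X), compact K -> K `<=` Om ->
  forall (al : 'I_p -> nat) (m : nat), exists C : R,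
    \forall e \near 0^'+, forall x, K x -> `|partials al (u e) x| <= C * e ^+ m.

Definition moderate_vec (Om : set X) (u : R -> X -> U) : Prop :=
  forall a : 'I_q, moderate Om (fun e x => u e x 0 a).

Definition negligible_vec (Om : set X) (u : R -> X -> U) : Prop :=
  forall a : 'I_q, negligible_net Om (fun e x => u e x 0 a).

(* Elements of G(Om)^q are represented as equivalence classes of moderate nets. *)
Definition gen_class (Om : set X) (u : R -> X -> U) : set (R -> X -> U) :=
  [set v | moderate_vec Om v /\ negligible_vec Om (fun e x => v e x - u e x)].

Definition colombeau (Om : set X) : set (set (R -> X -> U)) :=
  gen_class Om @` moderate_vec Om.

(* (Phi u + Psi) o Xi^-1, where Xi^-1 : Xi(Om) -> Om *)
Definition act_fun (Xi : X -> X) (Phi : X -> 'M[R]_q) (Psi : X -> U)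
    (Om : set X) (u : X -> U) : X -> U :=
  (fun x => u x *m (Phi x)^T + Psi x) \o 'pinv_(fun=> 0) Om Xi.

Definition test_function (Om : set X) (phi : X -> R) : Prop :=
  smooth_on setT phi /\
  exists K : set X, [/\ compact K, K `<=` Om & forall x, ~ K x -> phi x = 0].

Definition bounded_test_set (Om : set X) (k : nat) (B : set (X -> R)) : Prop :=
  [/\ B `<=` test_function Om,
      exists K : set X, [/\ compact K, K `<=` Om &
        forall phi, B phi -> forall x, ~ K x -> phi x = 0] &
      forall al : 'I_p -> nat, (order_mi al <= k)%N ->
        exists C : R, forall phi, B phi -> forall x, `|partials al phi x| <= C].

End colombeau.

Section associated.
Context {R : realType} {p q n s : nat}.
Notation X := 'rV[R]_p.
Notation U := 'rV[R]_q.
Notation jet := 'rV[R]_(p + jet_dim p q n).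

Context (M : set (X * U)) (Delta : 'I_s -> jet -> R).

Definition test_integral (Om : set X) (u : X -> U) (i : 'I_s) (phi : X -> R) :
  \bar R := integral_rV Om (fun x => Delta i (prolong u x) * phi x).

(* Since a class in G(Om)^q has representatives with arbitrary values at any
   given index e, composing Delta with its representatives requires
   Om x R^q to be contained in M. *)
Definition associated_solution (Om : set X) (V : set (R -> X -> U)) : Prop :=
  [/\ open Om, Om `*` setT `<=` M, colombeau Om V &
      exists2 u, V u & forall phi, test_function Om phi -> forall i,
        test_integral Om (u e) i phi @[e --> 0^'+] --> 0%E].

(* B is nonempty because the supremum of the empty set in \bar R is -oo. *)
Definition strongly_associated_solution (k : nat) (Om : set X)
    (V : set (R -> X -> U)) : Prop :=
  associated_solution Om V /\
  exists2 u, V u & forall B, B !=set0 -> bounded_test_set Om k B -> forall i,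
    ereal_sup [set test_integral Om (u e) i phi | phi in B]
      @[e --> 0^'+] --> 0%E.

(* g_eta U is defined for U in G(Om)^q when g_eta is defined on Om x R^q, so that
   it can be applied to every representative of U. *)
Definition AS_symmetry_group (k : nat)
    (W : set (R * (X * U))) (g : R -> X * U -> X * U)
    (Xi : R -> X -> X) (Phi : R -> X -> 'M[R]_q) (Psi : R -> X -> U) : Prop :=
  symmetry_group M Delta W g /\
  forall (eta : R) (Om : set X) (V : set (R -> X -> U)),
    strongly_associated_solution k Om V ->
    (forall x u, Om x -> W (eta, (x, u))) ->
    forall u, V u ->
      strongly_associated_solution k (Xi eta @` Om)
        (gen_class (Xi eta @` Om)
           (fun e => act_fun (Xi eta) (Phi eta) (Psi eta) Om (u e))).

End associated.

(* Main.v *)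
Require Import Defs.
From HB Require Import structures.
From mathcomp Require Import all_boot all_order all_algebra.
From mathcomp Require Import all_classical all_reals all_analysis.
From mathcomp Require Import measurable_realfun ring lra.

Set Implicit Arguments.
Unset Strict Implicit.
Unset Printing Implicit Defensive.

Import Order.TTheory GRing.Theory Num.Theory.
Import numFieldNormedType.Exports.

Local Open Scope classical_set_scope.
Local Open Scope ring_scope.

(** At every base point the transformed equations are linear combinations of the
    original ones, with smooth coefficients that depend on the base point only
    ([symmetry_factorization]).  To see this, take an arbitrary function [u] and
    a point [x].  The equations are affine in the jet coordinates selected by the
    nonsingular minor, so the jet of [u] at [x] can be corrected in these
    coordinates to a point of the solution variety ([shift_to_variety]).  By local
    solvability this point is the jet of a local solution, which the symmetry
    transforms into a solution ([transformed_solution]).  The prolonged action is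
    affine in the jet ([prolong_affine]); hence the equations evaluated at the
    transform of [u] are linear in the correction, and the correction is linear in
    the equations evaluated at [u].  In the semilinear case the corrected
    coordinates are derivatives of highest order, so that the correction leaves
    [u], and with it the nonlinear term, untouched.

    Integrate this identity against a test function [phi] on the image domain and
    change variables by the base map ([change_of_variables]).  The test integral of
    a transformed net against [phi] becomes a sum of test integrals of the original
    net against the functions [psi_j], where [psi_j] is the coefficient [Q_ij] times
    the pullback of [phi] times the Jacobian determinant, extended by zero
    ([test_integral_transfer]).  The [psi_j] are test functions, and they stay in a
    bounded subset of C_c^k when [phi] does ([bounded_test_set_transport]), because
    a derivative of a pullback only involves derivatives of no larger order
    ([pullback_partials]).  Convergence to zero, pointwise in the test function or
    uniformly on bounded sets, is therefore inherited by the transformed net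
    ([test_integral_small]).  The formula for derivatives of a pullback also shows
    that the action maps moderate nets to moderate ones and negligible differences
    to negligible ones ([act_gen_class]), so any representative may be used.

    The change of variables formula is proved for continuous functions with compact
    support: for linear maps by induction on the dimension ([det_change_unit]), for
    diffeomorphisms by mollification, which reduces it to the linear case at every
    point. *)

(** * Smooth functions *)

Section smooth_general.
Context {R : realType} {V W : normedModType R}.
Implicit Types (A B : set V) (f g : V -> W).

Lemma near_open A x : open A -> A x -> \forall y \near x, A y.
Proof. by move=> oA Ax; exact: open_nbhs_nbhs. Qed.

Lemma derive_eq_on A f g v x : open A -> A x -> (forall y, A y -> f y = g y) ->
  'D_v f x = 'D_v g x.
Proof.
move=> oA Ax fg; apply: near_eq_derive.
by apply: filterS (near_open oA Ax) => y /fg.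
Qed.

Lemma derivable_eq_on A f g v x : open A -> A x ->
  (forall y, A y -> f y = g y) -> derivable f x v -> derivable g x v.
Proof.
move=> oA Ax fg; apply: near_eq_derivable.
by apply: filterS (near_open oA Ax) => y /fg.
Qed.

Lemma continuous_eq_on A f g x : open A -> A x ->
  (forall y, A y -> f y = g y) -> {for x, continuous f} -> {for x, continuous g}.
Proof.
move=> oA Ax fg; rewrite /prop_for /continuous_at (fg _ Ax).
move=> cf; apply: cvg_trans cf; apply: near_eq_cvg.
by apply: filterS (near_open oA Ax) => y /fg.
Qed.

Lemma iter_derive_eq_on A f g vs : open A -> (forall y, A y -> f y = g y) ->
  forall x, A x -> iter_derive vs f x = iter_derive vs g x.
Proof.
move=> oA fg; elim: vs => [|v vs ih] x Ax //=; first exact: fg.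
exact: (derive_eq_on v oA Ax ih).
Qed.

Lemma smooth_on_eq A f g : open A -> (forall y, A y -> f y = g y) ->
  smooth_on A f -> smooth_on A g.
Proof.
move=> oA fg sf vs x Ax; have E := iter_derive_eq_on vs oA fg.
have [cf df] := sf vs x Ax; split.
  exact: continuous_eq_on oA Ax E cf.
by move=> v; exact: derivable_eq_on oA Ax E (df v).
Qed.

Lemma smooth_onS A B f : A `<=` B -> smooth_on B f -> smooth_on A f.
Proof. by move=> AB sf vs x /AB Bx; exact: sf. Qed.

Lemma smooth_on_local A f :
  (forall x, A x -> exists B g, [/\ open B, B x, smooth_on B g &
     forall y, B y -> g y = f y]) -> smooth_on A f.
Proof.
move=> H vs x Ax; have [B [g [oB Bx sg gf]]] := H _ Ax.
exact: (smooth_on_eq oB gf sg).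
Qed.

Lemma smooth_cont A f x : smooth_on A f -> A x -> {for x, continuous f}.
Proof. by move=> sf Ax; have [] := sf [::] x Ax. Qed.

Lemma smooth_derivable A f x : smooth_on A f -> A x ->
  forall v, derivable f x v.
Proof. by move=> sf Ax; have [_] := sf [::] x Ax. Qed.

Lemma smooth_derive A f v : smooth_on A f -> smooth_on A ('D_v f).
Proof.
move=> sf vs x Ax.
by have := sf (rcons vs v) x Ax; rewrite /iter_derive foldr_rcons.
Qed.

(** Smoothness by coinduction: a class of functions that is stable, on [A], under
    directional derivatives contains all the iterated derivatives at issue. *)
Lemma smooth_coind A (C : (V -> W) -> Prop) : open A ->
  (forall f, C f -> forall x, A x ->
     {for x, continuous f} /\ (forall v, derivable f x v)) ->
  (forall f v, C f -> exists2 g, C g & forall x, A x -> 'D_v f x = g x) ->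
  forall f, C f -> smooth_on A f.
Proof.
move=> oA C1 C2 f Cf vs.
suff [g Cg gE] : exists2 g, C g & forall x, A x -> g x = iter_derive vs f x.
  move=> x Ax; have [cg dg] := C1 _ Cg _ Ax; split.
    exact: continuous_eq_on oA Ax gE cg.
  by move=> v; exact: derivable_eq_on oA Ax gE (dg v).
elim: vs => [|v vs [g Cg gE]]; first by exists f.
have [h Ch hE] := C2 _ v Cg; exists h => // x Ax /=.
by rewrite -hE//; exact: (derive_eq_on v oA Ax gE).
Qed.

Lemma deriveD_fun f g x v : derivable f x v -> derivable g x v ->
  'D_v (fun y => f y + g y) x = 'D_v f x + 'D_v g x.
Proof. by move=> df dg; have H := deriveD df dg; exact: H. Qed.

Inductive sum_closure (C : (V -> W) -> Prop) : (V -> W) -> Prop :=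
| sum_closure_base f : C f -> sum_closure C f
| sum_closure_add f g : sum_closure C f -> sum_closure C g ->
    sum_closure C (fun x => f x + g x).

(** The coinduction principle in the form in which the Leibniz rule feeds it:
    derivatives of generators are sums of generators. *)
Lemma smooth_coind_sum A (C : (V -> W) -> Prop) : open A ->
  (forall f, C f -> forall x, A x ->
     {for x, continuous f} /\ (forall v, derivable f x v)) ->
  (forall f v, C f -> exists2 g, sum_closure C g &
     forall x, A x -> 'D_v f x = g x) ->
  forall f, C f -> smooth_on A f.
Proof.
move=> oA C1 C2 f Cf.
have C1' h : sum_closure C h -> forall x, A x ->
    {for x, continuous h} /\ (forall v, derivable h x v).
  elim=> [k /C1//|k l _ ihk _ ihl x Ax].
  have [ck dk] := ihk x Ax; have [cl dl] := ihl x Ax.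
  by split=> [|v]; [exact: continuousD|exact: derivableD].
apply: (smooth_coind oA C1'); last exact: sum_closure_base.
move=> h v; elim=> [k /C2//|k l Ck [k' Ck' kE] Cl [l' Cl' lE]].
exists (fun x => k' x + l' x); first exact: sum_closure_add.
move=> x Ax; have [_ dk] := C1' _ Ck x Ax; have [_ dl] := C1' _ Cl x Ax.
by rewrite deriveD_fun ?kE ?lE.
Qed.

End smooth_general.

Arguments smooth_derivable {R V W A f x} _ _ v.
Arguments smooth_cont {R V W A f x} _ _.

Local Opaque smooth_on derive derivable.

Section smooth_algebra.
Context {R : realType} {V : normedModType R}.
Implicit Types (A B : set V) (f g : V -> R).

Lemma continuousM_fun f g x : {for x, continuous f} -> {for x, continuous g} ->
  {for x, continuous (fun y => f y * g y)}.
Proof. by move=> cf cg; have H := continuousM cf cg; exact: H. Qed.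

Lemma derivableM_fun f g x v : derivable f x v -> derivable g x v ->
  derivable (fun y => f y * g y) x v.
Proof. by move=> df dg; have H := derivableM df dg; exact: H. Qed.

Lemma deriveM_fun f g x v : derivable f x v -> derivable g x v ->
  'D_v (fun y => f y * g y) x = f x * 'D_v g x + g x * 'D_v f x.
Proof. by move=> df dg; have H := deriveM df dg; exact: H. Qed.

Lemma smooth_cst {W : normedModType R} A (c : W) : open A -> smooth_on A (fun _ : V => c).
Proof.
move=> oA; apply: (smooth_coind (C := fun f : V -> W => exists c : W, f = cst c)) => //.
- move=> f [d ->] x _; split; first exact: cst_continuous.
  by move=> v; exact: derivable_cst.
- move=> f v [d ->]; exists (cst 0); first by exists 0.
  by move=> x _; rewrite derive_cst.
- by exists c.
Qed.

Lemma smooth_add {W : normedModType R} A (f g : V -> W) : open A ->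
  smooth_on A f -> smooth_on A g -> smooth_on A (fun x => f x + g x).
Proof.
move=> oA sf sg; apply: (smooth_coind (C := fun h : V -> W => exists2 fg : (V -> W) * (V -> W),
  h = (fun x => fg.1 x + fg.2 x) & smooth_on A fg.1 /\ smooth_on A fg.2)) => //; last first.
  by exists (f, g).
- move=> h v [[{}f {}g] /= -> [{}sf {}sg]].
  exists (fun x => 'D_v f x + 'D_v g x).
    by exists ('D_v f, 'D_v g) => /=; [reflexivity|split; exact: smooth_derive].
  by move=> x Ax; rewrite deriveD_fun//; exact: (smooth_derivable _ Ax).
- move=> h [[{}f {}g] /= -> [{}sf {}sg]] x Ax; split.
    by apply: continuousD; exact: (smooth_cont _ Ax).
  by move=> v; apply: derivableD; exact: (smooth_derivable _ Ax).
Qed.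

Lemma smooth_sum {W : normedModType R} A (I : Type) (r : seq I) (P : pred I)
    (F : I -> V -> W) : open A ->
  (forall i, smooth_on A (F i)) -> smooth_on A (fun x => \sum_(i <- r | P i) F i x).
Proof.
move=> oA sF; elim: r => [|i r ih].
  by under eq_fun do rewrite big_nil; exact: smooth_cst.
under eq_fun do rewrite big_cons.
by case: (P i) => //; exact: smooth_add.
Qed.

Lemma smooth_mul A f g : open A ->
  smooth_on A f -> smooth_on A g -> smooth_on A (fun x => f x * g x).
Proof.
move=> oA sf sg; apply: (smooth_coind_sum (C := fun h : V -> R =>
  exists2 fg : (V -> R) * (V -> R),
    h = (fun x => fg.1 x * fg.2 x) & smooth_on A fg.1 /\ smooth_on A fg.2)) => //; last first.
  by exists (f, g) => /=; [reflexivity|split].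
- move=> h v [[{}f {}g] /= -> [{}sf {}sg]].
  exists (fun x => f x * 'D_v g x + g x * 'D_v f x).
    apply: (sum_closure_add (f := fun x => f x * 'D_v g x)
      (g := fun x => g x * 'D_v f x)); apply: sum_closure_base.
      by exists (f, 'D_v g) => /=; [reflexivity|split; [assumption|apply: smooth_derive; assumption]].
    by exists (g, 'D_v f) => /=; [reflexivity|split; [assumption|apply: smooth_derive; assumption]].
  by move=> x Ax; rewrite deriveM_fun//; exact: (smooth_derivable _ Ax).
- move=> h [[{}f {}g] /= -> [{}sf {}sg]] x Ax.
  split.
    by apply: continuousM_fun; exact: (smooth_cont _ Ax).
  by move=> v; apply: derivableM_fun; exact: (smooth_derivable _ Ax).
Qed.

Lemma smooth_prod A (I : Type) (r : seq I) (P : pred I) (F : I -> V -> R) :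
  open A -> (forall i, smooth_on A (F i)) ->
  smooth_on A (fun x => \prod_(i <- r | P i) F i x).
Proof.
move=> oA sF; elim: r => [|i r ih].
  by under eq_fun do rewrite big_nil; exact: smooth_cst.
under eq_fun do rewrite big_cons.
case: (P i); last exact: ih.
by apply: smooth_mul; [exact: oA|exact: sF|exact: ih].
Qed.

Lemma smooth_opp A f : open A -> smooth_on A f -> smooth_on A (fun x => - f x).
Proof.
move=> oA sf; under eq_fun do rewrite -mulN1r.
by apply: smooth_mul; [exact: oA|exact: smooth_cst|exact: sf].
Qed.

(** The functions [c * f^-1 ^+ n] with [c] smooth form a class to which the
    coinduction principle applies: deriving the power yields a multiple of
    [f^-1 ^+ n.+1]. *)
Lemma smooth_inv A f : open A -> (forall x, A x -> f x != 0) ->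
  smooth_on A f -> smooth_on A (fun x => (f x)^-1).
Proof.
move=> oA f0 sf.
have cV x : A x -> {for x, continuous (fun y => (f y)^-1)}.
  by move=> Ax; apply: continuousV; [exact: f0|exact: (smooth_cont _ Ax)].
have dV x v : A x -> derivable (fun y => (f y)^-1) x v.
  move=> Ax; have H := derivableV (f0 x Ax) (smooth_derivable sf Ax v); exact: H.
pose C (h : V -> R) := exists (c : V -> R) n,
  smooth_on A c /\ h = (fun x => c x * (f x)^-1 ^+ n).
suff H : forall h, C h -> smooth_on A h.
  apply: H; exists (cst 1), 1%N; split; first exact: smooth_cst.
  by apply/funext => x; rewrite expr1 mul1r.
have cX n x : A x -> {for x, continuous (fun y => (f y)^-1 ^+ n)}.
  move=> Ax; elim: n => [|n ih]; first exact: cst_continuous.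
  rewrite (_ : (fun y => _) = (fun y => (f y)^-1 * (f y)^-1 ^+ n)).
    by apply: continuousM_fun; [exact: cV|exact: ih].
  by apply/funext => y; rewrite exprS.
have PX n x v : A x -> derivable (fun y => (f y)^-1 ^+ n) x v /\
    'D_v (fun y => (f y)^-1 ^+ n) x = - ('D_v f x * (f x)^-1 ^+ n.+1 *+ n).
  move=> Ax; elim: n => [|n [ihd ihD]].
    by rewrite mulr0n oppr0; split; [exact: derivable_cst|exact: derive_cst].
  rewrite (_ : (fun y => _) = (fun y => (f y)^-1 * (f y)^-1 ^+ n)); last first.
    by apply/funext => y; rewrite exprS.
  split; first by apply: derivableM_fun; [exact: dV|exact: ihd].
  rewrite deriveM_fun; [|exact: dV|exact: ihd].
  rewrite ihD deriveV; [|exact: f0|exact: (smooth_derivable sf Ax)].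
  rewrite mulrS -mulr_natl /GRing.scale /= -exprVn !exprS expr0.
  by ring.
have dX n x v Ax := (PX n x v Ax).1.
have DX n x v Ax := (PX n x v Ax).2.
apply: (smooth_coind_sum (C := C) oA); last first.
- move=> h v [c [n [sc ->]]].
  exists (fun x => 'D_v c x * (f x)^-1 ^+ n +
     - (c x * 'D_v f x *+ n) * (f x)^-1 ^+ n.+1).
    apply: (sum_closure_add (f := fun x => 'D_v c x * (f x)^-1 ^+ n)
     (g := fun x => - (c x * 'D_v f x *+ n) * (f x)^-1 ^+ n.+1));
      apply: sum_closure_base.
      by exists ('D_v c), n; split; [exact: smooth_derive|reflexivity].
    exists (fun x => - (c x * 'D_v f x *+ n)), n.+1; split; last reflexivity.
    apply: smooth_opp; first exact: oA.
    under eq_fun do rewrite -mulr_natr.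
    apply: smooth_mul; [exact: oA| |exact: smooth_cst].
    by apply: smooth_mul; [exact: oA|exact: sc|exact: smooth_derive].
  move=> x Ax; rewrite deriveM_fun; [|exact: (smooth_derivable _ Ax)|exact: dX].
  rewrite DX; last exact: Ax.
  move: ('D_v f x) ('D_v c x) (c x) ((f x)^-1) => a b d e.
  by rewrite !mulrN mulNr mulrnAr mulrnAl mulrA addrC [e ^+ n * b]mulrC.
- move=> h [c [n [sc ->]]] x Ax; split.
    by apply: continuousM_fun; [exact: (smooth_cont _ Ax)|exact: cX].
  move=> v; apply: derivableM_fun; last exact: dX.
  exact: (smooth_derivable _ Ax).
Qed.

End smooth_algebra.

(** * Mean value theorem and chain rule *)

Section mean_value.
Context {R : realType} {V : normedModType R}.

Lemma line_is_derive {W : normedModType R} (f : V -> W) (x v : V) (c : R) :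
  derivable f (x + c *: v) v ->
  is_derive c 1 (fun t : R => f (x + t *: v)) ('D_v f (x + c *: v)).
Proof.
move=> df.
have E : (fun h : R => h^-1 *: ((f \o shift (x + c *: v)) (h *: v) - f (x + c *: v))) =
  (fun h : R => h^-1 *: (((fun t : R => f (x + t *: v)) \o shift c) (h *: 1) -
     f (x + c *: v))).
  apply/funext => h /=; congr (_ *: (f _ - _)).
  by rewrite [h%:A]mulr1 scalerDl addrCA.
Transparent derive derivable.
by apply: DeriveDef; rewrite /derivable /derive -E.
Qed.
Local Opaque derive derivable.

(** One-dimensional on the line through [x] in the direction [v].  The sign of [h]
    is arbitrary, hence a bound on [`|c|] instead of an interval. *)
Lemma mean_value_line (f : V -> R) (x v : V) (h : R) :
  (forall c : R, `|c| <= `|h| -> derivable f (x + c *: v) v) ->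
  exists2 c : R, `|c| <= `|h| & f (x + h *: v) - f x = h * 'D_v f (x + c *: v).
Proof.
move=> df; pose g (t : R) := f (x + t *: v).
have dg (t : R) : `|t| <= `|h| -> is_derive t 1 g ('D_v f (x + t *: v)).
  by move=> /df /line_is_derive.
have MV (a b : R) : a < b -> (forall t : R, t \in `[a, b] -> `|t| <= `|h|) ->
    exists2 c : R, `|c| <= `|h| & g b - g a = 'D_v f (x + c *: v) * (b - a).
  move=> ab abh.
  have gab (t : R) : t \in `[a, b] -> is_derive t 1 g ('D_v f (x + t *: v)).
    by move=> /abh/dg.
  have cg : {within `[a, b], continuous g}.
    by apply: derivable_within_continuous => t /gab [].
  have goo (t : R) : t \in `]a, b[ -> is_derive t 1 g ('D_v f (x + t *: v)).
    by move=> tab; apply: gab; exact: subset_itv_oo_cc.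
  have [t tab E] := MVT ab goo cg.
  by exists t; [apply: abh; exact: subset_itv_oo_cc|exact: E].
have g0 : g 0 = f x by rewrite /g scale0r addr0.
have [h0|h0|->] := ltgtP h 0.
- have [|c ch E] := MV h 0 h0.
    move=> t; rewrite in_itv/= => /andP[ht t0].
    by rewrite !ler0_norm ?lerN2// ltW.
  by exists c => //; rewrite -g0 -opprB E sub0r mulrN opprK mulrC.
- have [|c ch E] := MV 0 h h0.
    move=> t; rewrite in_itv/= => /andP[ht t0].
    by rewrite !ger0_norm// ltW.
  by exists c => //; rewrite -g0 E subr0 mulrC.
- by exists 0; rewrite ?normr0// scale0r addr0 subrr mul0r.
Qed.

End mean_value.

Section row_calculus.
Context {R : realType}.

Lemma cvg_fsum {T : Type} {F : set_system T} {FF : Filter F}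
    {W : normedModType R} {I : Type} (r : seq I) (f : I -> T -> W) (l : I -> W) :
  (forall i, f i x @[x --> F] --> l i) ->
  \sum_(i <- r) f i x @[x --> F] --> \sum_(i <- r) l i.
Proof.
move=> fl; elim: r => [|i r ih].
  by rewrite big_nil; under eq_fun do rewrite big_nil; exact: cvg_cst.
rewrite big_cons; under eq_fun do rewrite big_cons.
by apply: cvgD; [exact: fl|exact: ih].
Qed.

Lemma normr_coord {m} (v : 'rV[R]_m) j : `|v 0 j| <= `|v|.
Proof.
rewrite [leRHS]/Num.Def.normr /= mx_normrE.
exact: (le_bigmax _ (fun ij : 'I_1 * 'I_m => `|v ij.1 ij.2|) (0, j)).
Qed.

Lemma normr_row_le {m} (v : 'rV[R]_m) a : 0 <= a ->
  (forall j, `|v 0 j| <= a) -> `|v| <= a.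
Proof.
move=> a0 va; rewrite [leLHS]/Num.Def.normr /= mx_normrE.
by apply: bigmax_le => // -[i j] _ /=; rewrite ord1.
Qed.

(** The segment from [x] to [x + k] is replaced by a path along the coordinate
    axes, with the mean value theorem on each edge. *)
Lemma increment_coord {m} (f : 'rV[R]_m -> R) x k :
  (forall y, `|y - x| <= `|k| -> forall j, derivable f y (delta_mx 0 j)) ->
  exists2 y : 'I_m -> 'rV[R]_m, (forall j, `|y j - x| <= `|k|) &
    f (x + k) - f x = \sum_j k 0 j * 'D_(delta_mx 0 j) f (y j).
Proof.
move=> df.
(* The vertices of the path: [P i] keeps the first [i] coordinates of [k]. *)
pose P i : 'rV[R]_m := \row_j (if (j < i)%N then k 0 j else 0).
have PS (i : 'I_m) : P i.+1 = P i + k 0 i *: delta_mx 0 i.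
  apply/rowP => j; rewrite !mxE/= ltnS leq_eqVlt.
  have [->|ji] := eqVneq j i; first by rewrite eqxx ltnn add0r mulr1.
  by rewrite -val_eqE/= in ji; rewrite (negbTE ji)/= mulr0 addr0.
have Pk (i : 'I_m) c : `|c| <= `|k 0 i| -> `|P i + c *: delta_mx 0 i| <= `|k|.
  move=> ck; apply: normr_row_le => // j; rewrite !mxE.
  have [->|ji] := eqVneq j i.
    by rewrite ltnn add0r eqxx mulr1 (le_trans ck)// normr_coord.
  by rewrite andbF mulr0 addr0; case: ifP => _; rewrite ?normr0// normr_coord.
have H (i : 'I_m) : exists y, `|y - x| <= `|k| /\
    f (x + P i.+1) - f (x + P i) = k 0 i * 'D_(delta_mx 0 i) f y.
  have [|c ck E] := @mean_value_line R _ f (x + P i) (delta_mx 0 i) (k 0 i).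
    by move=> c ck; apply: df; rewrite addrC addrA addKr Pk.
  exists (x + P i + c *: delta_mx 0 i); split.
    by rewrite addrC addrA addKr Pk.
  by rewrite -E PS addrA.
have [y yP] := choice H; exists y; first by move=> j; have [] := yP j.
rewrite (_ : x + k = x + P m); last first.
  by congr (_ + _); apply/rowP => j; rewrite !mxE ltn_ord.
rewrite (_ : f x = f (x + P 0%N)); last first.
  congr f; rewrite [X in _ + X](_ : _ = 0) ?addr0//.
  by apply/rowP => j; rewrite !mxE.
under eq_bigr => i _ do rewrite -(yP i).2.
rewrite -(big_mkord xpredT (fun i => f (x + P i.+1) - f (x + P i))).
by rewrite telescope_sumr.
Qed.

(** The partial derivatives of [f] in [increment_coord] are taken at points that
    tend to [Xi x], where they are continuous. *)
Lemma chain_rule {V : normedModType R} {m} (B : set 'rV[R]_m) (f : 'rV[R]_m -> R)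
    (Xi : V -> 'rV[R]_m) x w :
  open B -> smooth_on B f -> B (Xi x) -> derivable Xi x w ->
  is_derive x w (fun y => f (Xi y))
    (\sum_j ('D_w Xi x) 0 j * 'D_(delta_mx 0 j) f (Xi x)).
Proof.
move=> oB sf BX dX.
have /nbhs_ballP[r /= r0 rB] : nbhs (Xi x) B by exact: open_nbhs_nbhs.
pose k (h : R) : 'rV[R]_m := Xi (h *: w + x) - Xi x.
have H h : exists y : 'I_m -> 'rV[R]_m, `|k h| < r ->
    (forall j, `|y j - Xi x| <= `|k h|) /\
    f (Xi (h *: w + x)) - f (Xi x) = \sum_j k h 0 j * 'D_(delta_mx 0 j) f (y j).
  have [kr|_] := ltP `|k h| r; last by exists (fun=> 0).
  have [|y y1 y2] := @increment_coord m f (Xi x) (k h).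
    move=> y yk j; apply: (smooth_derivable sf); apply: rB.
    by rewrite -ball_normE/= distrC (le_lt_trans yk).
  by exists y => _; split => //; rewrite -y2 /k [Xi x + _]addrC subrK.
have [y yP] := choice H.
have ck : h^-1 *: k h @[h --> 0^'] --> 'D_w Xi x by exact: dX.
have k0 : k h @[h --> 0^'] --> (0 : 'rV[R]_m).
  have : h *: (h^-1 *: k h) @[h --> 0^'] --> (0 : R) *: 'D_w Xi x.
    apply: cvgZ => //; apply: cvg_within_filter; exact: cvg_id.
  rewrite scale0r; apply: cvg_trans; apply: near_eq_cvg.
  near=> h; rewrite scalerA mulfV ?scale1r//.
  by near: h; exact: nbhs_dnbhs_neq.
have kr : \forall h \near 0^', `|k h| < r.
  move/cvgrPdist_lt : k0 => /(_ r r0); apply: filterS => h.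
  by rewrite sub0r normrN.
have yc j : y h j @[h --> 0^'] --> Xi x.
  apply/cvgrPdist_lt => e e0.
  have ke : \forall h \near 0^', `|k h| < e.
    move/cvgrPdist_lt : k0 => /(_ e e0); apply: filterS => h.
    by rewrite sub0r normrN.
  near=> h; rewrite distrC.
  have [|/(_ j) yj _] := yP h; first by near: h.
  by apply: (le_lt_trans yj); near: h.
have main : h^-1 *: (f (Xi (h *: w + x)) - f (Xi x)) @[h --> 0^'] -->
    \sum_j ('D_w Xi x) 0 j * 'D_(delta_mx 0 j) f (Xi x).
  have : \sum_j (h^-1 *: k h) 0 j * 'D_(delta_mx 0 j) f (y h j) @[h --> 0^'] -->
      \sum_j ('D_w Xi x) 0 j * 'D_(delta_mx 0 j) f (Xi x).
    apply: cvg_fsum => j; apply: cvgM.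
      exact: (@cvg_comp _ _ _ (fun h => h^-1 *: k h) (fun v : 'rV[R]_m => v 0 j)
        _ _ _ ck (@coord_continuous _ _ _ 0 j _)).
    exact: (@cvg_comp _ _ _ (fun h => y h j) ('D_(delta_mx 0 j) f)
      _ _ _ (yc j) (smooth_cont (smooth_derive _ sf) BX)).
  apply: cvg_trans; apply: near_eq_cvg; near=> h.
  have [|_ ->] := yP h; first by near: h.
  rewrite scaler_sumr; apply: eq_bigr => j _.
  by rewrite mxE [RHS]mulrA.
by apply: DeriveDef; [apply/cvg_ex; eexists; exact: main|exact: cvg_lim main].
Unshelve. all: by end_near. Qed.

End row_calculus.

(** * Composition and symmetry of second derivatives *)

Section affine.
Context {R : realType} {V V' W : normedModType R}.

Lemma is_derive_affine (a a' : V' -> V) (f : V -> W) x w :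
  (forall h : R, a (h *: w + x) = h *: a' w + a x) ->
  derivable f (a x) (a' w) ->
  is_derive x w (fun y => f (a y)) ('D_(a' w) f (a x)).
Proof.
move=> aE df.
have E : (fun h : R => h^-1 *: ((f \o shift (a x)) (h *: a' w) - f (a x))) =
   (fun h : R => h^-1 *: (((fun y => f (a y)) \o shift x) (h *: w) - f (a x))).
  by apply/funext => h /=; rewrite aE.
Transparent derive derivable.
by apply: DeriveDef; rewrite /derivable /derive -E.
Qed.
Local Opaque derive derivable.

(** Freezing some variables of a smooth function: this gives the smoothness of the
    group action for a fixed parameter and a fixed value of [u]. *)
Lemma smooth_affine (A : set V) (B : set V') (a a' : V' -> V) (f : V -> W) :
  open B -> (forall x, B x -> A (a x)) -> continuous a ->
  (forall x w (h : R), a (h *: w + x) = h *: a' w + a x) ->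
  smooth_on A f -> smooth_on B (fun y => f (a y)).
Proof.
move=> oB BA ca aE sf.
apply: (smooth_coind (C := fun h : V' -> W => exists2 f, h = f \o a & smooth_on A f)) oB _ _ _ _.
- move=> _ [g -> sg] x Bx; split.
    by apply: (@continuous_comp _ _ _ a g); [exact: ca|exact: (smooth_cont sg (BA _ Bx))].
  move=> v.
  by have [] := is_derive_affine (aE x v) (smooth_derivable sg (BA _ Bx) (a' v)).
- move=> _ v [g -> sg]; exists (('D_(a' v) g) \o a).
    by exists ('D_(a' v) g); [reflexivity|exact: smooth_derive].
  move=> x Bx.
  by have [] := is_derive_affine (aE x v) (smooth_derivable sg (BA _ Bx) (a' v)).
- by exists f; [reflexivity|exact: sf].
Qed.

End affine.

Section linear_post.
Context {R : realType} {V W W' : normedModType R}.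

Lemma is_derive_linear_post (L : W -> W') (f : V -> W) x w :
  continuous L -> (forall y z, L (y - z) = L y - L z) ->
  (forall (h : R) y, L (h *: y) = h *: L y) ->
  derivable f x w -> is_derive x w (fun y => L (f y)) (L ('D_w f x)).
Proof.
move=> cL LB LZ df.
have main : h^-1 *: (L (f (h *: w + x)) - L (f x)) @[h --> 0^'] --> L ('D_w f x).
  have H : h^-1 *: (f (h *: w + x) - f x) @[h --> 0^'] --> 'D_w f x by exact: df.
  have := @cvg_comp _ _ _ (fun h => h^-1 *: (f (h *: w + x) - f x)) L _ _ _ H (cL _).
  rewrite (_ : L \o _ = (fun h => h^-1 *: (L (f (h *: w + x)) - L (f x)))) //.
  by apply/funext => h /=; rewrite LZ LB.
by apply: DeriveDef; [apply/cvg_ex; eexists; exact: main|exact: cvg_lim main].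
Qed.

Lemma smooth_linear_post A (L : W -> W') (f : V -> W) : open A ->
  continuous L -> (forall y z, L (y - z) = L y - L z) ->
  (forall (h : R) y, L (h *: y) = h *: L y) ->
  smooth_on A f -> smooth_on A (fun y => L (f y)).
Proof.
move=> oA cL LB LZ sf.
apply: (smooth_coind (C := fun h : V -> W' => exists2 f, h = L \o f & smooth_on A f) oA).
- move=> _ [g -> sg] x Ax; split.
    by apply: (@continuous_comp _ _ _ g L); [exact: (smooth_cont sg Ax)|exact: cL].
  move=> v.
  by have [] := is_derive_linear_post cL LB LZ (smooth_derivable sg Ax v).
- move=> _ v [g -> sg]; exists (L \o 'D_v g).
    by exists ('D_v g); [reflexivity|exact: smooth_derive].
  move=> x Ax.
  by have [] := is_derive_linear_post cL LB LZ (smooth_derivable sg Ax v).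
- by exists f; [reflexivity|exact: sf].
Qed.

End linear_post.

Section rows.
Context {R : realType} {V : normedModType R}.

Lemma continuous_row {T : topologicalType} {m} (f : T -> 'rV[R]_m) x :
  (forall j, {for x, continuous (fun y => f y 0 j)}) -> {for x, continuous f}.
Proof.
move=> cf; apply/cvgrPdist_le => e e0.
have : \forall y \near x, forall j, `|f x 0 j - f y 0 j| <= e.
  apply: filter_forall => j.
  by have /cvgrPdist_le/(_ e e0) := cf j.
apply: filterS => y H; apply: normr_row_le => [|j]; first exact: ltW.
by rewrite !mxE; exact: H.
Qed.

Lemma smooth_coord {m n} A (f : V -> 'M[R]_(m, n)) i j : open A -> smooth_on A f ->
  smooth_on A (fun x => f x i j).
Proof.
move=> oA; apply: (@smooth_linear_post _ _ _ _ _ (fun M : 'M[R]_(m, n) => M i j)).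
- exact: oA.
- exact: coord_continuous.
- by move=> y z; rewrite !mxE.
- by move=> h y; rewrite !mxE.
Qed.

Lemma smooth_row {m} A (f : V -> 'rV[R]_m) : open A ->
  (forall j, smooth_on A (fun x => f x 0 j)) -> smooth_on A f.
Proof.
move=> oA sf.
have D (g : V -> 'rV[R]_m) x v : A x -> (forall j, smooth_on A (fun x => g x 0 j)) ->
    derivable g x v.
  move=> Ax sg; apply/derivable_mxP => i j; rewrite ord1.
  exact: (smooth_derivable (sg j) Ax v).
apply: (smooth_coind (C := fun h : V -> 'rV[R]_m =>
  forall j, smooth_on A (fun x => h x 0 j)) oA); last exact: sf.
- move=> g sg x Ax; split; last by move=> v; exact: D.
  by apply: continuous_row => j; exact: (smooth_cont (sg j) Ax).
- move=> g v sg; exists (fun x => \row_j 'D_v (fun x => g x 0 j) x).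
    move=> j; under eq_fun do rewrite mxE.
    exact: smooth_derive.
  move=> x Ax; rewrite derive_mx; last exact: D.
  by apply/rowP => j; rewrite !mxE.
Qed.

(** By the chain rule, derivatives of functions [c * (g \o Xi)], with [c] and [g]
    smooth, are sums of functions of the same kind. *)
Lemma smooth_comp {m} (A : set V) (B : set 'rV[R]_m) (f : 'rV[R]_m -> R)
    (Xi : V -> 'rV[R]_m) :
  open A -> open B -> (forall x, A x -> B (Xi x)) ->
  smooth_on A Xi -> smooth_on B f -> smooth_on A (fun x => f (Xi x)).
Proof.
move=> oA oB AB sX sf.
pose C (h : V -> R) := exists (c : V -> R) (g : 'rV[R]_m -> R), [/\ smooth_on A c, smooth_on B g &
  h = (fun x => c x * g (Xi x))].
have D (g : 'rV[R]_m -> R) x w : A x -> smooth_on B g ->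
    is_derive x w (fun y => g (Xi y))
    (\sum_j 'D_w (fun y => Xi y 0 j) x * 'D_(delta_mx 0 j) g (Xi x)).
  move=> Ax sg; have dX := smooth_derivable sX Ax w.
  have := chain_rule oB sg (AB _ Ax) dX.
  rewrite derive_mx//.
  by under eq_bigr do rewrite mxE.
suff : forall h, C h -> smooth_on A h.
  apply; exists (fun=> 1), f; split; [exact: smooth_cst|exact: sf|].
  by apply/funext => x; rewrite mul1r.
apply: (smooth_coind_sum (C := C) oA).
- move=> _ [c [g [sc sg ->]]] x Ax; split.
    apply: continuousM_fun; first exact: (smooth_cont sc Ax).
    apply: (@continuous_comp _ _ _ Xi g); first exact: (smooth_cont sX Ax).
    exact: (smooth_cont sg (AB _ Ax)).
  move=> v; apply: derivableM_fun; first exact: (smooth_derivable sc Ax).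
  by have [] := D _ _ v Ax sg.
- move=> _ v [c [g [sc sg ->]]].
  pose G x := \sum_(j <- enum 'I_m) (c x * 'D_v (fun y => Xi y 0 j) x) *
     'D_(delta_mx 0 j) g (Xi x) + 'D_v c x * g (Xi x).
  exists G.
    rewrite /G; elim: (enum 'I_m) => [|j r ih].
      under eq_fun do rewrite big_nil add0r.
      apply: sum_closure_base; exists ('D_v c), g; split; [|exact: sg|reflexivity].
      exact: smooth_derive.
    under eq_fun do rewrite big_cons -addrA.
    apply: (sum_closure_add (f := fun x => c x * 'D_v (fun y => Xi y 0 j) x *
      'D_(delta_mx 0 j) g (Xi x))); last exact: ih.
    apply: sum_closure_base.
    exists (fun x => c x * 'D_v (fun y => Xi y 0 j) x), ('D_(delta_mx 0 j) g).
    split; [|exact: smooth_derive|reflexivity].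
    apply: smooth_mul; [exact: oA|exact: sc|apply: smooth_derive].
    exact: smooth_coord.
  move=> x Ax; have [dg Dg] := D _ _ v Ax sg.
  rewrite deriveM_fun; [|exact: (smooth_derivable sc Ax)|exact: dg].
  rewrite Dg /G big_enum/= mulr_sumr [g (Xi x) * _]mulrC; congr (_ + _).
  by apply: eq_bigr => j _; rewrite mulrA.
Qed.

(** The second difference of [f] along [u] and [v] is symmetric, and the mean value
    theorem, used twice, expresses it by either of the two mixed derivatives at
    some point near [x]. *)
Lemma derive_comm (A : set V) (f : V -> R) x u v : open A -> smooth_on A f -> A x ->
  'D_u ('D_v f) x = 'D_v ('D_u f) x.
Proof.
move=> oA sf Ax.
have /nbhs_ballP[r /= r0 rA] : nbhs x A by exact: open_nbhs_nbhs.
pose D2 (h : R) (u v : V) := f (x + h *: v + h *: u) - f (x + h *: v) -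
  (f (x + h *: u) - f x).
have D2C h a b : D2 h a b = D2 h b a.
  rewrite /D2 [x + h *: b + _]addrAC; ring.
have inA y (d : R) : d < r -> `|y - x| <= d -> A y.
  by move=> dr yd; apply: rA; rewrite -ball_normE/= distrC (le_lt_trans yd).
have bnd (h c d : R) a b : `|c| <= `|h| -> `|d| <= `|h| ->
    `|x + c *: b + d *: a - x| <= `|h| * (`|a| + `|b|).
  move=> ch dh; rewrite addrC -[x + _ + _]addrA addKr (le_trans (ler_normD _ _))// !normrZ.
  by rewrite mulrDr addrC lerD// ler_wpM2r.
have H (h : R) a b : `|h| * (`|a| + `|b|) < r ->
    exists2 y, `|y - x| <= `|h| * (`|a| + `|b|) &
      D2 h a b = h * (h * 'D_a ('D_b f) y).
  move=> hr.
  pose phi y := f (y + h *: a) - f y.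
  have dphi (c : R) : `|c| <= `|h| -> is_derive (x + c *: b) b phi
     ('D_b f (x + c *: b + h *: a) - 'D_b f (x + c *: b)).
    move=> ch.
    have A1 : A (x + c *: b + h *: a) by apply: (inA _ _ hr); exact: bnd.
    have A2 : A (x + c *: b).
      apply: (inA _ _ hr); have := @bnd h c 0 a b ch.
      by rewrite normr0 scale0r addr0; apply.
    have [d1 e1] : is_derive (x + c *: b) b (fun y => f (y + h *: a))
        ('D_b f (x + c *: b + h *: a)).
      apply: (@is_derive_affine _ _ _ _ (fun y => y + h *: a) id).
        by move=> k /=; rewrite -!addrA.
      exact: (smooth_derivable sf A1).
    have d2 := smooth_derivable sf A2 b.
    apply: DeriveDef; first exact: (derivableB d1 d2).
    by have E := deriveB d1 d2; rewrite e1 in E; exact: E.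
  have [|c ch E1] := @mean_value_line R V phi x b h.
    by move=> c /dphi[].
  have [|d dh E2] := @mean_value_line R V ('D_b f) (x + c *: b) a h.
    move=> d dh; apply: (smooth_derivable (smooth_derive b sf)).
    by apply: (inA _ _ hr); exact: bnd.
  exists (x + c *: b + d *: a); first exact: bnd.
  rewrite -E2; have [_ E3] := dphi _ ch; rewrite E3 in E1.
  exact: E1.
apply/eqP; rewrite -subr_eq0 -normr_le0.
apply/ler_addgt0Pr => e e0; rewrite add0r.
have near_cont a b : \forall y \near x, `|'D_a ('D_b f) x - 'D_a ('D_b f) y| < e / 2.
  have /cvgrPdist_lt := smooth_cont (smooth_derive a (smooth_derive b sf)) Ax.
  by apply; rewrite divr_gt0.
have /nbhs_ballP[d /= d0 dP] : \forall y \near x,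
    `|'D_u ('D_v f) x - 'D_u ('D_v f) y| < e / 2 /\
    `|'D_v ('D_u f) x - 'D_v ('D_u f) y| < e / 2.
  by apply: filterI; exact: near_cont.
pose K := `|u| + `|v| + 1.
have K0 : 0 < K by rewrite ltr_wpDl// addr_ge0.
pose h := Num.min r d / 2 / K.
have md0 : 0 < Num.min r d by rewrite lt_min r0.
have h0 : 0 < h by rewrite !divr_gt0.
have hK : `|h| * (`|u| + `|v|) < Num.min r d.
  rewrite gtr0_norm// (@le_lt_trans _ _ (h * K))//.
    by rewrite ler_wpM2l ?lerDl// ltW.
  by rewrite /h divfK ?gt_eqF// ltr_pdivrMr// ltr_pMr// ltr1n.
have [hr hd] : `|h| * (`|u| + `|v|) < r /\ `|h| * (`|u| + `|v|) < d.
  by move: hK; rewrite lt_min => /andP[].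
have [y y1 y2] := H h u v hr.
have [z z1 z2] : exists2 z, `|z - x| <= `|h| * (`|v| + `|u|) &
      D2 h v u = h * (h * 'D_v ('D_u f) z) by apply: H; rewrite [_ + `|u|]addrC.
have E : 'D_u ('D_v f) y = 'D_v ('D_u f) z.
  have h1 : h != 0 by rewrite gt_eqF.
  by have := D2C h u v; rewrite y2 z2 => /(mulfI h1)/(mulfI h1).
have [|yP _] := dP y; first by rewrite -ball_normE/= distrC (le_lt_trans y1).
have [|_ zP] := dP z.
  by rewrite -ball_normE/= distrC (le_lt_trans z1)// [_ + `|u|]addrC.
rewrite -E in zP.
move: yP zP; move: ('D_u ('D_v f) x) ('D_v ('D_u f) x) ('D_u ('D_v f) y).
move=> a b c ac bc; rewrite -(subrKA c) (le_trans (ler_normD _ _))// (splitr e).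
by apply: lerD; [|rewrite distrC]; exact: ltW.
Qed.

End rows.

(** * Partial derivatives of pulled back functions *)

Section words.
Context {R : realType} {m : nat}.
Implicit Types (A B : set 'rV[R]_m) (f g : 'rV[R]_m -> R) (w : seq 'I_m).

(** Words remember the order of derivation, which inductions need; a multi-index
    corresponds to its sorted word. *)
Definition iter_partial w f := iter_derive [seq delta_mx 0 i | i <- w] f.

Definition mi_word (al : 'I_m -> nat) : seq 'I_m :=
  flatten [seq nseq (al i) i | i <- enum 'I_m].

Lemma iter_partial_cat w1 w2 f :
  iter_partial (w1 ++ w2) f = iter_partial w1 (iter_partial w2 f).
Proof. by rewrite /iter_partial /iter_derive map_cat foldr_cat. Qed.

Lemma partials_word al f : partials al f = iter_partial (mi_word al) f.
Proof.
rewrite /partials /mi_word; elim: (enum 'I_m) => [//|i r ih] /=.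
rewrite iter_partial_cat -ih; set h := foldr _ _ _.
by elim: (al i) => [//|k ihk] /=; rewrite ihk.
Qed.

Lemma smooth_iter_partial A w f : smooth_on A f -> smooth_on A (iter_partial w f).
Proof. by move=> sf; elim: w => [//|i w ih]; exact: smooth_derive. Qed.

Lemma smooth_partials A al f : smooth_on A f -> smooth_on A (partials al f).
Proof. by move=> sf; rewrite partials_word; exact: smooth_iter_partial. Qed.

Lemma iter_partial_eq_on A w f g : open A -> (forall x, A x -> f x = g x) ->
  forall x, A x -> iter_partial w f x = iter_partial w g x.
Proof. exact: iter_derive_eq_on. Qed.

Lemma partials_eq_on A al f g : open A -> (forall x, A x -> f x = g x) ->
  forall x, A x -> partials al f x = partials al g x.
Proof. by rewrite !partials_word; exact: iter_partial_eq_on. Qed.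

Lemma iter_partial_move A w1 i w2 f : open A -> smooth_on A f ->
  forall x, A x -> iter_partial (w1 ++ i :: w2) f x = iter_partial (i :: w1 ++ w2) f x.
Proof.
move=> oA sf; elim: w1 => [//|j w1 ih] x Ax.
transitivity ('D_(delta_mx 0 j) (iter_partial (i :: w1 ++ w2) f) x).
  exact: (derive_eq_on (delta_mx 0 j) oA Ax ih).
by apply: (derive_comm _ _ oA); [exact: smooth_iter_partial|exact: Ax].
Qed.

Lemma iter_partial_perm A w1 w2 f : open A -> smooth_on A f -> perm_eq w1 w2 ->
  forall x, A x -> iter_partial w1 f x = iter_partial w2 f x.
Proof.
move=> oA sf; elim: w1 w2 => [|i w1 ih] w2.
  by rewrite perm_sym => /perm_nilP ->.
move=> w12; have : i \in w2 by rewrite -(perm_mem w12) mem_head.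
move: w12 => /[swap] /splitPr[a b].
rewrite perm_sym (perm_catCA a [:: i] b) perm_cons perm_sym => /ih ihab x Ax.
rewrite (iter_partial_move a i b oA sf Ax).
exact: (derive_eq_on (delta_mx 0 i) oA Ax ihab).
Qed.

Lemma count_mi_word al j : count_mem j (mi_word al) = al j.
Proof.
rewrite /mi_word count_flatten -map_comp sumnE big_map big_enum/=.
rewrite (bigD1 j)//= count_nseq/= eqxx mul1n big1 ?addn0// => i ij.
by rewrite count_nseq/= (negbTE ij).
Qed.

Lemma order_count w : order_mi (fun i => count_mem i w) = size w.
Proof.
rewrite /order_mi; elim: w => [|j w ih]; first by rewrite big1.
by rewrite big_split/= ih (bigD1 j)//= eqxx big1 ?addn0// => i /negbTE; rewrite eq_sym => ->.
Qed.

Lemma size_mi_word al : size (mi_word al) = order_mi al.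
Proof.
rewrite -order_count /order_mi; apply: eq_bigr => i _.
by rewrite count_mi_word.
Qed.

Lemma iter_partial_partials A w f : open A -> smooth_on A f ->
  forall x, A x -> iter_partial w f x = partials (fun i => count_mem i w) f x.
Proof.
move=> oA sf x Ax; rewrite partials_word; apply: (iter_partial_perm oA sf _ Ax).
by apply/allP => j _ /=; rewrite count_mi_word.
Qed.

Lemma iter_partial_add A w f g : open A -> smooth_on A f -> smooth_on A g ->
  forall x, A x ->
  iter_partial w (fun y => f y + g y) x = iter_partial w f x + iter_partial w g x.
Proof.
move=> oA sf sg; elim: w => [//|i w ih] x Ax.
rewrite [LHS](derive_eq_on (delta_mx 0 i) oA Ax ih).
have df := smooth_derivable (smooth_iter_partial w sf) Ax (delta_mx 0 i).
have dg := smooth_derivable (smooth_iter_partial w sg) Ax (delta_mx 0 i).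
exact: deriveD_fun df dg.
Qed.

Lemma partials_add A al f g : open A -> smooth_on A f -> smooth_on A g ->
  forall x, A x -> partials al (fun y => f y + g y) x = partials al f x + partials al g x.
Proof. by rewrite !partials_word; exact: iter_partial_add. Qed.

Lemma partials_cst0 A al : open A -> forall x, A x -> partials al (fun=> 0) x = 0 :> R.
Proof.
move=> oA; rewrite partials_word; elim: (mi_word al) => [//|i w ih] x Ax.
by rewrite [LHS](derive_eq_on (delta_mx 0 i) oA Ax ih) derive_cst.
Qed.

Lemma partials_sum A al (I : Type) (r : seq I) (F : I -> 'rV[R]_m -> R) :
  open A -> (forall i, smooth_on A (F i)) ->
  forall x, A x ->
  partials al (fun y => \sum_(i <- r) F i y) x = \sum_(i <- r) partials al (F i) x.
Proof.
move=> oA sF x Ax; elim: r => [|i r ih].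
  by rewrite big_nil; under eq_fun do rewrite big_nil; exact: (partials_cst0 al oA Ax).
rewrite big_cons -ih; under eq_fun do rewrite big_cons.
by apply: (partials_add al oA) => //; exact: smooth_sum.
Qed.

End words.

Section pullback.
Context {R : realType} {p r : nat}.
Implicit Types (A : set 'rV[R]_p) (B : set 'rV[R]_r).

(** Lists of functions have no decidable membership, hence a recursive predicate. *)
Definition Forallp {T : Type} (P : T -> Prop) :=
  fix F (s : seq T) : Prop := if s is x :: s' then P x /\ F s' else True.

Lemma Forallp_cat {T} (P : T -> Prop) s1 s2 :
  Forallp P s1 -> Forallp P s2 -> Forallp P (s1 ++ s2).
Proof. by elim: s1 => [//|x s ih] /= [Px /ih H] /H. Qed.

Lemma Forallp_map {S T} (P : T -> Prop) (h : S -> T) (s : seq S) :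
  (forall x, P (h x)) -> Forallp P (map h s).
Proof. by move=> Ph; elim: s => [//|x s ih] /=. Qed.

Lemma Forallp_sub {T} (P Q : T -> Prop) (s : seq T) :
  (forall x, P x -> Q x) -> Forallp P s -> Forallp Q s.
Proof. by move=> PQ; elim: s => [//|x s ih] /= [/PQ Px /ih]. Qed.

Lemma open_preimage_on A B (Th : 'rV[R]_p -> 'rV[R]_r) : open A -> open B ->
  smooth_on A Th -> open (A `&` Th @^-1` B).
Proof.
move=> oA oB sT; rewrite openE => x [Ax BTx]; apply: filterI.
  exact: open_nbhs_nbhs.
have := smooth_cont sT Ax; apply.
exact: open_nbhs_nbhs.
Qed.

(** By the Leibniz and chain rules, a further derivative either falls on a
    coefficient or multiplies it by a derivative of [Th]; so the coefficients never
    depend on the function.  The prolongation formula, the stability of growth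
    conditions and the bounds on transported test functions are all read off from
    this. *)
Lemma pullback_word A (Th : 'rV[R]_p -> 'rV[R]_r) (c0 : 'rV[R]_p -> R) (w : seq 'I_p) :
  open A -> smooth_on A Th -> smooth_on A c0 ->
  exists2 L : seq (('rV[R]_p -> R) * seq 'I_r),
    Forallp (fun l => smooth_on A l.1 /\ (size l.2 <= size w)%N) L &
    forall B (v : 'rV[R]_r -> R), open B -> smooth_on B v -> forall y, A y -> B (Th y) ->
      iter_partial w (fun y => c0 y * v (Th y)) y =
      \sum_(l <- L) l.1 y * iter_partial l.2 v (Th y).
Proof.
move=> oA sT sc0; elim: w => [|i w [L LA LE]].
  exists [:: (c0, [::])] => /=; first by [].
  by move=> B v _ _ y _ _; rewrite big_seq1.
pose d : 'rV[R]_p := delta_mx 0 i.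
pose step (l : ('rV[R]_p -> R) * seq 'I_r) : seq (('rV[R]_p -> R) * seq 'I_r) :=
  ('D_d l.1, l.2) ::
  [seq ((fun y => l.1 y * 'D_d (fun y => Th y 0 j) y), j :: l.2) | j <- enum 'I_r].
exists (flatten (map step L)).
  elim: L LA {LE} => [//|l L ih] [[sl ll] /ih LA].
  rewrite [map step (l :: L)]/= [flatten _]/=; split.
    by split; [exact: smooth_derive|rewrite (leq_trans ll)].
  apply: Forallp_cat; last exact: LA.
  apply: Forallp_map => j; split; last exact: ll.
  apply: smooth_mul; [exact: oA|exact: sl|apply: smooth_derive].
  exact: smooth_coord.
move=> B v oB sv y Ay By.
have oAB := open_preimage_on oA oB sT.
have E : forall y, (A `&` Th @^-1` B) y ->
    iter_partial w (fun y => c0 y * v (Th y)) y =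
    \sum_(l <- L) l.1 y * iter_partial l.2 v (Th y).
  by move=> z [Az Bz]; exact: (LE B v oB sv).
rewrite [LHS](derive_eq_on d oAB (conj Ay By) E).
suff [] : derivable (fun y => \sum_(l <- L) l.1 y * iter_partial l.2 v (Th y)) y d /\
  'D_d (fun y => \sum_(l <- L) l.1 y * iter_partial l.2 v (Th y)) y =
  \sum_(l <- flatten [seq step i | i <- L]) l.1 y * iter_partial l.2 v (Th y) by [].
elim: L LA {LE E} => [_|l L ih [[sl _] /ih [ihd ihD]]].
  rewrite big_nil; under eq_fun do rewrite big_nil.
  by split; [exact: derivable_cst|exact: derive_cst].
rewrite [map step (l :: L)]/= [flatten _]/= big_cons big_cat/=.
under eq_fun do rewrite big_cons.
have sv2 := smooth_iter_partial l.2 sv.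
have dT := smooth_derivable sT Ay d.
have [d1 D1] := chain_rule oB sv2 By dT.
have d0 := smooth_derivable sl Ay d.
have dM := derivableM_fun d0 d1.
split; first by have H := derivableD dM ihd; exact: H.
rewrite deriveD_fun; [|exact: dM|exact: ihd].
rewrite deriveM_fun; [|exact: d0|exact: d1].
rewrite ihD addrA; congr (_ + _); rewrite addrC.
congr (_ + _); last exact: mulrC.
rewrite D1 big_map big_enum/= mulr_sumr; apply: eq_bigr => j _.
by rewrite derive_mx// mxE mulrA.
Qed.

Lemma pullback_partials A (Th : 'rV[R]_p -> 'rV[R]_r) (c0 : 'rV[R]_p -> R) (al : 'I_p -> nat) :
  open A -> smooth_on A Th -> smooth_on A c0 ->
  exists2 L : seq (('rV[R]_p -> R) * ('I_r -> nat)),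
    Forallp (fun l => smooth_on A l.1 /\ (order_mi l.2 <= order_mi al)%N) L &
    forall B (v : 'rV[R]_r -> R), open B -> smooth_on B v -> forall y, A y -> B (Th y) ->
      partials al (fun y => c0 y * v (Th y)) y =
      \sum_(l <- L) l.1 y * partials l.2 v (Th y).
Proof.
move=> oA sT sc0; have [L LA LE] := pullback_word (mi_word al) oA sT sc0.
exists [seq (l.1, fun i => count_mem i l.2) | l <- L].
  elim: L LA {LE} => [//|l L ih] [[sl ll] /ih LA]; split; last exact: LA.
  by split; [exact: sl|rewrite order_count -size_mi_word].
move=> B v oB sv y Ay By; rewrite partials_word (LE B v oB sv)// big_map.
by apply: eq_bigr => l _; rewrite (iter_partial_partials l.2 oB sv By).
Qed.

End pullback.

Section smooth_matrix.
Context {R : realType} {V : normedModType R}.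
Implicit Types (A : set V).

Lemma smooth_det {n} A (F : V -> 'M[R]_n) : open A ->
  (forall i j, smooth_on A (fun x => F x i j)) -> smooth_on A (fun x => \det (F x)).
Proof.
move=> oA sF; rewrite /determinant.
apply: smooth_sum => // s; apply: smooth_mul => //; first exact: smooth_cst.
by apply: smooth_prod.
Qed.

(** By Cramer's rule. *)
Lemma smooth_invmx {n} A (F : V -> 'M[R]_n) : open A ->
  (forall i j, smooth_on A (fun x => F x i j)) ->
  (forall x, A x -> F x \in unitmx) ->
  forall i j, smooth_on A (fun x => invmx (F x) i j).
Proof.
move=> oA sF uF i j.
apply: (@smooth_on_eq _ _ _ A (fun x => (\det (F x))^-1 * cofactor (F x) j i)) => //.
  by move=> x Ax; rewrite /invmx uF// !mxE.
apply: smooth_mul => //.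
  apply: smooth_inv => //; last exact: smooth_det.
  by move=> x /uF; rewrite unitmxE unitfE.
rewrite /cofactor; apply: smooth_mul => //; first exact: smooth_cst.
apply: smooth_det => // a b.
by rewrite (_ : (fun x => _) = (fun x => F x (lift j a) (lift i b)))//;
  apply/funext => x; rewrite !mxE.
Qed.

(** The sign of [f] is locally constant. *)
Lemma smooth_normr A (f : V -> R) : open A -> (forall x, A x -> f x != 0) ->
  smooth_on A f -> smooth_on A (fun x => `|f x|).
Proof.
move=> oA f0 sf; apply: smooth_on_local => x Ax.
have cf := smooth_cont sf Ax.
pose s := Num.sg (f x).
have : \forall y \near x, A y /\ 0 < s * f y.
  apply: filterI; first exact: open_nbhs_nbhs.
  have H : s * f y @[y --> x] --> s * f x by apply: cvgM => //; exact: cvg_cst.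
  have /cvgrPdist_lt := H; move/(_ `|f x|).
  rewrite normr_gt0 f0// => /(_ isT); apply: filterS => y.
  rewrite /s -normrEsg; set a := _ * f y => h.
  by have := le_lt_trans (ler_norm _) h; rewrite ltrBlDr -ltrBlDl subrr.
rewrite /prop_near1 nbhsE => -[B [oB Bx] BP].
exists B, (fun y => s * f y); split => //.
  apply: smooth_mul => //; first exact: smooth_cst.
  by apply: smooth_onS sf => y /BP[].
move=> y /BP[Ay fy]; rewrite -[LHS]gtr0_norm// normrM normr_sg f0// mul1r//.
Qed.

End smooth_matrix.

(** * Lebesgue measure on tuples *)

Section tuple_measure.
Context {R : realType}.
Notation RT := (measurableTypeR R).

Definition cons_tuple p (xt : RT * p.-tuple RT) : p.+1.-tuple RT :=
  [tuple of xt.1 :: xt.2].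

Lemma measurable_cons_tuple p : measurable_fun setT (@cons_tuple p).
Proof.
exact: (@measurable_cons _ _ (RT * p.-tuple RT)%type RT fst p snd).
Qed.

Definition box p (r : R) : set (p.-tuple RT) := [set t | forall i, `|tnth t i| <= r].

Lemma box_cons p r : @cons_tuple p @^-1` box r = `[- r, r]%classic `*` box r.
Proof.
apply/seteqP; split => [[x t] /= H|[x t] /= [xr tr] i].
  split=> [|i]; last by have := H (lift ord0 i); rewrite tnthS.
  by have := H ord0; rewrite tnth0/= in_itv/= -ler_norml.
case: (unliftP ord0 i) => [j|] ->; last by rewrite tnth0 /= ler_norml.
by rewrite tnthS.
Qed.

Lemma measurable_box p r : measurable (@box p r).
Proof.
rewrite (_ : box r = \bigcap_(i in [set: 'I_p]) ((@tnth _ RT ^~ i) @^-1` `[- r, r]%classic)).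
  apply: fin_bigcap_measurable => [|i _]; first exact: finite_finset.
  rewrite -[X in measurable X]setTI; exact: measurable_tnth.
apply/seteqP; split => [t H i _ /=|t H i]; first by rewrite in_itv/= -ler_norml.
by have := H i I; rewrite /= in_itv/= -ler_norml.
Qed.

Lemma bigcup_box p : \bigcup_n @box p n%:R = setT.
Proof.
apply/seteqP; split => // t _.
exists (Num.bound (\sum_i `|tnth t i|)) => // i.
have S0 : 0 <= \sum_i `|tnth t i| by apply: sumr_ge0.
apply: le_trans (ltW (archi_boundP S0)).
by rewrite (bigD1 i)//= lerDl sumr_ge0.
Qed.

(** A proposition, so that it can be proved by induction on the dimension before
    [lebesgue_tuple] carries a measure structure. *)
Definition is_sfmeasure {d} {T : measurableType d} (f : set T -> \bar R) :=
  [/\ f set0 = 0%E, forall A, (0 <= f A)%E, semi_sigma_additive f &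
      sigma_finite setT f].

Lemma sfmeasure_pack {d} {T : measurableType d} (f : set T -> \bar R) :
  is_sfmeasure f ->
  exists nu : {sigma_finite_measure set T -> \bar R}, nu = f :> (set T -> \bar R).
Proof.
move=> [f0 fge0 fsa fsf].
pose m1 := isMeasure.Build _ _ _ f f0 fge0 fsa.
pose M : {measure set T -> \bar R} := HB.pack f m1.
pose m2 := Measure_isSigmaFinite.Build _ _ _ M fsf.
pose N : {sigma_finite_measure set T -> \bar R} := HB.pack f m1 m2.
by exists N.
Qed.

(** The volume of boxes belongs to the induction, as it yields sigma-finiteness. *)
Lemma lebesgue_tuple_sfmeasure p : is_sfmeasure (@lebesgue_tuple R p) /\
  forall r, 0 <= r -> lebesgue_tuple (@box p r) = ((r *+ 2) ^+ p)%:E.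
Proof.
elim: p => [|p [/sfmeasure_pack[nu nuE] IHb]].
  split; last first.
    by move=> r r0; rewrite /= diracE mem_set// => -[].
  split; first by rewrite /= measure0.
  - by move=> A /=.
  - exact: measure_semi_sigma_additive.
  - exact: sigma_finiteT.
pose m := [the {measure set _ -> \bar R} of (lebesgue_measure \x nu)%E].
have E : @lebesgue_tuple R p.+1 = pushforward m (@cons_tuple p).
  by rewrite [LHS]/= -nuE.
have B r : 0 <= r -> lebesgue_tuple (@box p.+1 r) = ((r *+ 2) ^+ p.+1)%:E.
  move=> r0; rewrite E /pushforward box_cons /m/= product_measure1E; [|exact: measurable_itv|exact: measurable_box].
  have L : lebesgue_measure (`[- r, r]%classic : set R) = (r *+ 2)%:E.
    rewrite lebesgue_measure_itv/=.
    have [->|rn0] := eqVneq r 0; first by rewrite oppr0 ltxx mul0rn.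
    have r_gt0 : 0 < r by rewrite lt_neqAle eq_sym rn0.
    by rewrite lte_fin gtrN// -EFinB opprK mulr2n.
  rewrite [X in (X * _)%E](_ : _ = (r *+ 2)%:E); last exact: L.
  by rewrite nuE IHb// -EFinM exprS.
split; last exact: B.
rewrite E; split.
- by rewrite /pushforward preimage_set0 measure0.
- by move=> A; rewrite /pushforward; exact: measure_ge0.
- move=> F mF tF mUF; rewrite /pushforward preimage_bigcup.
  have mc := @measurable_cons_tuple p.
  apply: measure_semi_sigma_additive.
  + by move=> n; rewrite -[X in measurable X]setTI; exact: mc.
  + apply/trivIsetP => /= i j _ _ ij; rewrite -preimage_setI.
    by move/trivIsetP : tF => /(_ _ _ _ _ ij) ->//; rewrite preimage_set0.
  + by rewrite -preimage_bigcup -[X in measurable X]setTI; exact: mc.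
- exists (fun n : nat => @box p.+1 n%:R); first by rewrite bigcup_box.
  by move=> n; split; [exact: measurable_box|rewrite -E B// ltry].
Qed.

Let lebesgue_tuple0 p : @lebesgue_tuple R p set0 = 0%E.
Proof. by have [[]] := lebesgue_tuple_sfmeasure p. Qed.

Let lebesgue_tuple_ge0 p A : (0 <= @lebesgue_tuple R p A)%E.
Proof. by have [[_ H _ _] _] := lebesgue_tuple_sfmeasure p; exact: H. Qed.

Let lebesgue_tuple_additive p : semi_sigma_additive (@lebesgue_tuple R p).
Proof. by have [[]] := lebesgue_tuple_sfmeasure p. Qed.

HB.instance Definition _ p := isMeasure.Build _ _ _ (@lebesgue_tuple R p)
  (@lebesgue_tuple0 p) (@lebesgue_tuple_ge0 p) (@lebesgue_tuple_additive p).

Let lebesgue_tuple_sigma_finite p : sigma_finite setT (@lebesgue_tuple R p).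
Proof. by have [[]] := lebesgue_tuple_sfmeasure p. Qed.

HB.instance Definition _ p := Measure_isSigmaFinite.Build _ _ _
  (@lebesgue_tuple R p) (@lebesgue_tuple_sigma_finite p).

Lemma lebesgue_tuple_box p r : 0 <= r ->
  lebesgue_tuple (@box p r) = ((r *+ 2) ^+ p)%:E.
Proof. by have [_] := lebesgue_tuple_sfmeasure p; exact. Qed.

End tuple_measure.

(** * Joint measurability of continuous functions *)

Lemma continuous_pair_at {T U V : topologicalType} (f : T -> U) (g : T -> V) x :
  {for x, continuous f} -> {for x, continuous g} ->
  {for x, continuous (fun y => (f y, g y))}.
Proof. by move=> cf cg; exact: (cvg_pair cf cg). Qed.

Section caratheodory.
Context {R : realType}.
Notation RT := (measurableTypeR R).

Definition grid (n : nat) (x : R) : R := (Num.floor (x * n.+1%:R))%:~R / n.+1%:R.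

Lemma grid_cvg x : grid n x @[n --> \oo] --> x.
Proof.
have H : (n.+1%:R^-1 : R) @[n --> \oo] --> 0 by exact: cvg_harmonic.
apply/cvgrPdist_le => e e0.
move/cvgrPdist_le : H => /(_ e e0); apply: filterS => n.
rewrite sub0r normrN ger0_norm; last by rewrite invr_ge0.
apply: le_trans; rewrite /grid.
have n0 : 0 < n.+1%:R :> R by rewrite ltr0n.
have /andP[f1 f2] := floor_itv (x * n.+1%:R).
rewrite -[X in `|X - _|](mulfK (lt0r_neq0 n0)) -mulrBl normrM normfV (gtr0_norm n0).
rewrite -[leRHS]mul1r ler_wpM2r ?invr_ge0 ?ltW//.
by rewrite ger0_norm ?subr_ge0// ltrBlDl; rewrite intrD in f2.
Qed.

(** Rounding the second variable to finer and finer grids approximates [F] by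
    functions that depend on it only through countably many strips.  Used one
    coordinate at a time, this makes continuous functions of several variables
    measurable for the product sigma-algebra. *)
Lemma measurable_fun_caratheodory d (T : measurableType d) (F : T -> R -> R) :
  (forall t, continuous (F t)) -> (forall x, measurable_fun setT (F ^~ x)) ->
  measurable_fun setT (fun z : T * RT => F z.1 z.2).
Proof.
move=> cF mF.
apply: (measurable_realfun.measurable_fun_cvg (h := fun n (z : T * RT) => F z.1 (grid n z.2))).
  move=> n _ Y mY; rewrite setTI.
  rewrite (_ : _ @^-1` Y = \bigcup_(k : int)
      (((F ^~ (k%:~R / n.+1%:R)) @^-1` Y) `*`
       [set x : RT | (k%:~R <= x * n.+1%:R < (k + 1)%:~R)])).
    apply: countable_bigcupT_measurable => [|k]; first exact: countableP.
    apply: measurableX.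
      by rewrite -[X in measurable X]setTI; exact: mF.
    rewrite (_ : mkset _ = `[k%:~R / n.+1%:R, (k + 1)%:~R / n.+1%:R[%classic).
      exact: measurable_itv.
    apply/seteqP; split => x /=.
      by rewrite in_itv/= ler_pdivrMr ?ltr0n// ltr_pdivlMr ?ltr0n.
    by rewrite in_itv/= ler_pdivrMr ?ltr0n// ltr_pdivlMr ?ltr0n.
  apply/seteqP; split => [[t x] /= H|[t x] [k _ [/= H1 H2]]].
    exists (Num.floor (x * n.+1%:R)) => //; split => //=.
    exact: floor_itv.
  by rewrite /grid (floor_def H2).
move=> [t x] _ /=.
have cx : F t y @[y --> (x : R)] --> F t x by exact: cF.
have H := @cvg_comp _ _ _ (fun n => grid n x) (F t) _ _ _ (@grid_cvg x) cx.
exact: H.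
Qed.

Definition cons_row {p} (x : R) (v : 'rV[R]_p) : 'rV[R]_p.+1 :=
  row_mx (x%:M : 'M[R]_1) v.

Lemma cons_row0 {p} x (v : 'rV[R]_p) : cons_row x v 0 ord0 = x.
Proof.
rewrite /cons_row; have -> : (ord0 : 'I_p.+1) = lshift p (ord0 : 'I_1) by exact/val_inj.
by rewrite (row_mxEl (x%:M : 'M[R]_1)) mxE.
Qed.

Lemma cons_rowS {p} x (v : 'rV[R]_p) i : cons_row x v 0 (lift ord0 i) = v 0 i.
Proof.
rewrite /cons_row; have -> : (lift ord0 i : 'I_p.+1) = rshift 1 i by exact/val_inj.
by rewrite (row_mxEr (x%:M : 'M[R]_1)).
Qed.

Lemma row_of_tuple_cons p x (t : p.-tuple RT) :
  row_of_tuple [tuple of x :: t] = cons_row x (row_of_tuple t).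
Proof.
apply/rowP => i; case: (unliftP ord0 i) => [j|] ->.
  by rewrite cons_rowS !mxE tnthS.
by rewrite cons_row0 mxE tnth0.
Qed.

Lemma continuous_cons_row {T : topologicalType} {p} (f : T -> R) (g : T -> 'rV[R]_p) :
  continuous f -> continuous g -> continuous (fun t => cons_row (f t) (g t)).
Proof.
move=> cf cg t; apply: continuous_row => i.
case: (unliftP ord0 i) => [j|] ->.
  rewrite (_ : (fun _ => _) = (fun t => g t 0 j)); last first.
    by apply/funext => s; rewrite cons_rowS.
  exact: (@continuous_comp _ _ _ g (fun v => v 0 j) t (cg t) (@coord_continuous _ _ _ 0 j _)).
rewrite (_ : (fun _ => _) = f); first exact: cf.
by apply/funext => s; rewrite cons_row0.
Qed.

Lemma measurable_fun_row p d (T : measurableType d) (F : T -> 'rV[R]_p -> R) :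
  (forall t, continuous (F t)) -> (forall v, measurable_fun setT (F ^~ v)) ->
  measurable_fun setT (fun z : T * p.-tuple RT => F z.1 (row_of_tuple z.2)).
Proof.
elim: p d T F => [|p ih] d T F cF mF.
  rewrite (_ : (fun _ => _) = (F ^~ 0) \o fst); last first.
    by apply/funext => -[t s] /=; congr F; apply/rowP => -[].
  by apply: measurableT_comp; [exact: mF|exact: measurable_fst].
pose G (z : T * RT) v := F z.1 (cons_row z.2 v).
have mG := ih _ (T * RT)%type G.
rewrite (_ : (fun _ => _) = (fun z : T * RT * p.-tuple RT => G z.1 (row_of_tuple z.2)) \o
  (fun z : T * p.+1.-tuple RT => ((z.1, thead z.2), [tuple of behead z.2]))); last first.
  apply/funext => -[t s] /=; rewrite /G /=; congr F.
  by rewrite -row_of_tuple_cons; congr row_of_tuple; exact: tuple_eta.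
apply: measurableT_comp.
  apply: mG => [[t x] /=|v].
    move=> v; apply: (@continuous_comp _ _ _ (cons_row x) (F t)); last exact: cF.
    apply: (@continuous_cons_row _ _ (fun=> x) id); first exact: cst_continuous.
    by move=> w; exact: cvg_id.
  apply: (@measurable_fun_caratheodory _ _ (fun t x => F t (cons_row x v))).
    move=> t x; apply: (@continuous_comp _ _ _ (fun x => cons_row x v) (F t)); last exact: cF.
    apply: (@continuous_cons_row _ _ id (fun=> v)); last exact: cst_continuous.
    by move=> y; exact: cvg_id.
  by move=> x; exact: mF.
apply: measurable_fun_pair; last first.
  by apply: (measurableT_comp (f := fun t : p.+1.-tuple RT => [tuple of behead t]));
    [exact: measurable_behead|exact: measurable_snd].
apply: measurable_fun_pair; first exact: measurable_fst.
by apply: (measurableT_comp (f := fun t : p.+1.-tuple RT => tnth t ord0));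
  [exact: measurable_tnth|exact: measurable_snd].
Qed.

Lemma measurable_continuous_row p (f : 'rV[R]_p -> R) : continuous f ->
  measurable_fun setT (fun t : p.-tuple RT => f (row_of_tuple t)).
Proof.
move=> cf.
have := @measurable_fun_row p _ unit (fun _ => f) (fun _ => cf).
move=> /(_ (fun v => measurable_cst _)) mf.
rewrite (_ : (fun _ => _) = (fun z : unit * p.-tuple RT => f (row_of_tuple z.2)) \o
  (fun t => (tt, t))); last by [].
by apply: (measurableT_comp mf); exact: measurable_fun_pair.
Qed.

Lemma measurable_continuous_rows p m (F : 'rV[R]_p -> 'rV[R]_m -> R) :
  continuous (fun z => F z.1 z.2) ->
  measurable_fun setT (fun z : p.-tuple RT * m.-tuple RT =>
    F (row_of_tuple z.1) (row_of_tuple z.2)).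
Proof.
move=> cF.
apply: (@measurable_fun_row m _ (p.-tuple RT) (fun t => F (row_of_tuple t))).
  move=> t v.
  have cv : {for v, continuous (fun v : 'rV[R]_m => (row_of_tuple t, v))}.
    apply: (@continuous_pair_at _ _ _ (fun=> row_of_tuple t) id); last exact: cvg_id.
    exact: cst_continuous.
  exact: (@continuous_comp _ _ _ (fun v : 'rV[R]_m => (row_of_tuple t, v))
    (fun z : 'rV[R]_p * 'rV[R]_m => F z.1 z.2) v cv (cF _)).
move=> v; apply: (@measurable_continuous_row p (fun x => F x v)) => x.
have cx : {for x, continuous (fun x : 'rV[R]_p => (x, v))}.
  apply: (@continuous_pair_at _ _ _ id (fun=> v)); first exact: cvg_id.
  exact: cst_continuous.
exact: (@continuous_comp _ _ _ (fun x : 'rV[R]_p => (x, v))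
  (fun z : 'rV[R]_p * 'rV[R]_m => F z.1 z.2) x cx (cF _)).
Qed.

End caratheodory.

(** * Integrals of continuous functions with bounded support *)

Section bounded_support.
Context {R : realType} {d : measure_display} {T : measurableType d}.
Variables (mu : {measure set T -> \bar R}) (B : set T).
Hypotheses (mB : measurable B) (muB : (mu B < +oo)%E).

(** Domination by a multiple of the indicator of a set of finite measure settles
    every question of integrability below. *)
Lemma bsupp_integrable (f : T -> R) (M : R) : measurable_fun setT f ->
  (forall t, `|f t| <= M) -> (forall t, ~ B t -> f t = 0) ->
  mu.-integrable setT (EFin \o f).
Proof.
move=> mf fM f0.
have : mu.-integrable B (EFin \o f).
  apply: measurable_bounded_integrable => //; first exact: measurable_funTS.
  exists M; split; rewrite ?num_real // => x Mx y _ /=.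
  by rewrite (le_trans (fM y))// ltW.
rewrite integrable_mkcond//; congr (_.-integrable _ _); apply/funext => t.
by rewrite patchE; case: ifPn => //; rewrite notin_setE => /f0 /= ->.
Qed.

Lemma bsupp_dom_integrable (M : R) :
  mu.-integrable setT (EFin \o (fun t => M * \1_B t)).
Proof.
apply: (@bsupp_integrable _ `|M|).
- by apply: measurable_funM => //; exact: measurable_indic.
- move=> t; rewrite normrM indicE.
  by case: (t \in B); rewrite ?normr0 ?mulr0 ?normr1 ?mulr1.
- by move=> t Bt; rewrite indicE memNset// mulr0.
Qed.

Lemma bsupp_le_dom (f : T -> R) (M : R) : 0 <= M ->
  (forall t, `|f t| <= M) -> (forall t, ~ B t -> f t = 0) ->
  forall t, `|f t| <= M * \1_B t.
Proof.
move=> M0 fM f0 t; rewrite indicE; have [Bt|Bt] := pselect (B t).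
  by rewrite mem_set// mulr1.
by rewrite memNset// mulr0 f0// normr0.
Qed.

Lemma bsupp_Rintegral_dom (M : R) : \int[mu]_t (M * \1_B t) = M * fine (mu B).
Proof.
rewrite RintegralZl//; last first.
  have := bsupp_dom_integrable 1.
  by congr (_.-integrable _ _); apply/funext => t; rewrite /= mul1r.
congr (_ * _); rewrite /Rintegral.
by rewrite integral_indic// setIT.
Qed.

Lemma bsupp_Rintegral_le (f : T -> R) (M : R) : measurable_fun setT f -> 0 <= M ->
  (forall t, `|f t| <= M) -> (forall t, ~ B t -> f t = 0) ->
  `|\int[mu]_t f t| <= M * fine (mu B).
Proof.
move=> mf M0 fM f0; have If := bsupp_integrable mf fM f0.
apply: (le_trans (le_normr_Rintegral measurableT If)).
rewrite -bsupp_Rintegral_dom; apply: le_Rintegral => //.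
- apply: (@bsupp_integrable (fun t => `|f t|) M).
  + exact: measurableT_comp.
  + by move=> t; rewrite normr_id.
  + by move=> t /f0 ->; rewrite normr0.
- exact: bsupp_dom_integrable.
- by move=> t _; exact: bsupp_le_dom.
Qed.

Lemma bsupp_dct (f_ : nat -> T -> R) (f : T -> R) (M : R) :
  (forall n, measurable_fun setT (f_ n)) ->
  (forall n t, `|f_ n t| <= M) -> (forall n t, ~ B t -> f_ n t = 0) ->
  (forall t, f_ n t @[n --> \oo] --> f t) ->
  \int[mu]_t f_ n t @[n --> \oo] --> \int[mu]_t f t.
Proof.
move=> mf fM f0 fc.
have [T0|] := pselect (exists t : T, True); last first.
  move=> T0; have E (h : T -> R) : \int[mu]_t h t = 0.
    rewrite /Rintegral (_ : [set: T] = set0) ?integral_set0//.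
    by apply/seteqP; split => // t _; apply: T0; exists t.
  by rewrite E; under eq_fun do rewrite E; exact: cvg_cst.
have M0 : 0 <= M by case: T0 => t _; exact: le_trans (fM 0%N t).
have mF : measurable_fun setT f.
  by apply: (measurable_fun_cvg mf) => t _; exact: fc.
have fMl t : `|f t| <= M.
  have H : `|f_ n t| @[n --> \oo] --> `|f t| by apply: cvg_norm; exact: fc.
  rewrite -(cvg_lim (@Rhausdorff R) H); apply: limr_le.
    by apply/cvg_ex; exists `|f t|; exact: H.
  by apply: nearW => n; exact: fM.
have fl0 t : ~ B t -> f t = 0.
  move=> Bt; have := fc t; under eq_fun do rewrite f0//.
  by move/(cvg_lim (@Rhausdorff R)) => <-; rewrite lim_cst.
apply: fine_cvg; rewrite fineK; last first.
  exact: (integrable_fin_num _ (bsupp_integrable mF fMl fl0)).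
apply: (@dominated_cvg _ _ _ mu _ measurableT (fun n t => (f_ n t)%:E) (fun t => (f t)%:E)
  (EFin \o (fun t => M * \1_B t))).
- by move=> n; exact/measurable_EFinP.
- by move=> t _; apply/fine_cvgP; split; [exact: nearW|exact: fc].
- by [].
- exact: bsupp_dom_integrable.
- by move=> n t _; rewrite abse_EFin lee_fin; exact: (bsupp_le_dom M0 (fM n) (f0 n)).
Qed.

End bounded_support.

Section bounded_support_fubini.
Context {R : realType} {d1 d2 : measure_display}
  {T1 : measurableType d1} {T2 : measurableType d2}.
Variables (m1 : {sigma_finite_measure set T1 -> \bar R})
  (m2 : {sigma_finite_measure set T2 -> \bar R}) (B1 : set T1) (B2 : set T2).
Hypotheses (mB1 : measurable B1) (mB2 : measurable B2)
  (m1B : (m1 B1 < +oo)%E) (m2B : (m2 B2 < +oo)%E).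
Variables (f : T1 * T2 -> R) (M : R).
Hypotheses (mf : measurable_fun setT f) (fM : forall z, `|f z| <= M)
  (f0 : forall z, ~ (B1 z.1 /\ B2 z.2) -> f z = 0).

Let prod := (m1 \x m2)%E.

Lemma bsupp_prod_integrable : prod.-integrable setT (EFin \o f).
Proof.
have pB : (prod (B1 `*` B2) < +oo)%E.
  rewrite (_ : prod (B1 `*` B2) = (m1 B1 * m2 B2)%E); last exact: product_measure1E.
  by rewrite lte_mul_pinfty// ge0_fin_numE.
apply: (bsupp_integrable (measurableX mB1 mB2) pB mf fM).
by move=> [x y] H; apply: f0.
Qed.

Lemma bsupp_section1 x : m2.-integrable setT (fun y => (f (x, y))%:E).
Proof.
apply: (@bsupp_integrable _ _ _ m2 B2 mB2 m2B (fun y => f (x, y)) M) => //.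
- by apply: measurableT_comp => //; exact: measurable_pair1.
- by move=> y By; apply: f0 => -[].
Qed.

Lemma bsupp_section2 y : m1.-integrable setT (fun x => (f (x, y))%:E).
Proof.
apply: (@bsupp_integrable _ _ _ m1 B1 mB1 m1B (fun x => f (x, y)) M) => //.
- by apply: measurableT_comp => //; exact: measurable_pair2.
- by move=> x Bx; apply: f0 => -[].
Qed.

Lemma bsupp_fubini1 :
  \int[prod]_z f z = \int[m1]_x (\int[m2]_y f (x, y)).
Proof.
rewrite /Rintegral; congr fine.
rewrite -[LHS](integral12_prod_meas1 bsupp_prod_integrable).
apply: eq_integral => x _; rewrite fineK//.
exact: (integrable_fin_num measurableT (bsupp_section1 x)).
Qed.

Lemma bsupp_fubini2 :
  \int[prod]_z f z = \int[m2]_y (\int[m1]_x f (x, y)).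
Proof.
rewrite /Rintegral; congr fine.
rewrite -[LHS](integral21_prod_meas1 bsupp_prod_integrable).
apply: eq_integral => y _; rewrite fineK//.
exact: (integrable_fin_num measurableT (bsupp_section2 y)).
Qed.

Lemma bsupp_fubini1_integrable :
  m1.-integrable setT (fun x => (\int[m2]_y f (x, y))%:E).
Proof.
have := integrable_fubini_F bsupp_prod_integrable.
congr (_.-integrable _ _); apply/funext => x; rewrite /Rintegral fineK//.
exact: (integrable_fin_num measurableT (bsupp_section1 x)).
Qed.

Lemma bsupp_fubini2_integrable :
  m2.-integrable setT (fun y => (\int[m1]_x f (x, y))%:E).
Proof.
have mG := measurable_fubini_G bsupp_prod_integrable.
have GE y : (\int[m1]_x f (x, y))%:E = (\int[m1]_x (f (x, y))%:E)%E.
  rewrite /Rintegral fineK//.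
  exact: (integrable_fin_num measurableT (bsupp_section2 y)).
apply: (@bsupp_integrable _ _ _ m2 B2 mB2 m2B (fun y => \int[m1]_x f (x, y))
  (`|M| * fine (m1 B1))).
- by apply/measurable_EFinP; congr (measurable_fun _ _) : mG; apply/funext => y; rewrite /= GE.
- move=> y; apply: (@bsupp_Rintegral_le _ _ _ m1 B1 mB1 m1B (fun x => f (x, y))) => //.
  + by apply: measurableT_comp => //; exact: measurable_pair2.
  + by move=> x; rewrite (le_trans (fM _))// ler_norm.
  + by move=> x Bx; apply: f0 => -[].
- move=> y By; rewrite /Rintegral (eq_integral (cst 0%E)) ?integral0// => x _.
  by rewrite f0// => -[].
Qed.

End bounded_support_fubini.

Section Cc.
Context {R : realType}.
Notation RT := (measurableTypeR R).

(** C_c: in finite dimension a bounded support amounts to a compact one. *)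
Definition Cc {V : normedModType R} (f : V -> R) : Prop :=
  continuous f /\ exists r, forall x, r < `|x| -> f x = 0.

Definition Cc2 {p m} (F : 'rV[R]_p -> 'rV[R]_m -> R) : Prop :=
  continuous (fun z : 'rV[R]_p * 'rV[R]_m => F z.1 z.2) /\
  exists r, forall x y, (r < `|x|) || (r < `|y|) -> F x y = 0.

(** Only meant for functions satisfying [Cc], for which linearity, Fubini and
    dominated convergence hold without further conditions. *)
Definition Int {p} (f : 'rV[R]_p -> R) : R :=
  \int[@lebesgue_tuple R p]_t f (row_of_tuple t).

Definition Int1 (g : R -> R) : R := \int[lebesgue_measure]_x g x.

Lemma boxE {p} r (t : p.-tuple RT) : 0 <= r -> box r t <-> `|row_of_tuple t| <= r.
Proof.
move=> r0; split=> [tr|tr i].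
  by apply: normr_row_le => // j; rewrite mxE; exact: tr.
by have := normr_coord (row_of_tuple t) i; rewrite mxE => /le_trans; apply.
Qed.

Lemma compact_normr_le {p} r : compact [set v : 'rV[R]_p | `|v| <= r].
Proof.
apply: bounded_closed_compact.
  by exists r; split; rewrite ?num_real// => x rx v /= /le_trans -> //; exact: ltW.
have := @closed_closed_ball_ R _ (0 : 'rV[R]_p) r.
congr closed; apply/seteqP; split => v /=; rewrite /closed_ball_/=; by rewrite sub0r normrN.
Qed.

Lemma compact_bound {T : topologicalType} (K : set T) (f : T -> R) :
  compact K -> {within K, continuous f} ->
  exists2 M, 0 <= M & forall x, K x -> `|f x| <= M.
Proof.
move=> cK cf.
have /compact_bounded[M [_ HM]] := continuous_compact cf cK.
exists (`|M| + 1); first by rewrite addr_ge0.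
move=> x Kx; apply: (HM (`|M| + 1)); last by exists x.
by rewrite ltr_pwDr// ler_norm.
Qed.

Lemma Cc_bound {p} (f : 'rV[R]_p -> R) : Cc f -> exists M r, [/\ 0 <= M, 0 <= r,
  forall x, `|f x| <= M & forall x, r < `|x| -> f x = 0].
Proof.
move=> [cf [r fr]].
have [M M0 HM] := compact_bound (@compact_normr_le p `|r|)
  (continuous_subspaceT cf).
exists M, `|r|; split => // x; last first.
  by move=> /(le_lt_trans (ler_norm _)); exact: fr.
have [xr|xr] := leP `|x| `|r|; first exact: HM.
by rewrite fr ?normr0// (le_lt_trans (ler_norm _)).
Qed.

Lemma Cc2_bound {p m} (F : 'rV[R]_p -> 'rV[R]_m -> R) : Cc2 F ->
  exists M r, [/\ 0 <= M, 0 <= r, forall x y, `|F x y| <= M &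
    forall x y, (r < `|x|) || (r < `|y|) -> F x y = 0].
Proof.
move=> [cF [r Fr]].
have cK := compact_setX (@compact_normr_le p `|r|) (@compact_normr_le m `|r|).
have [M M0 HM] := compact_bound cK (continuous_subspaceT cF).
have Fr' x y : (`|r| < `|x|) || (`|r| < `|y|) -> F x y = 0.
  by move=> /orP[|] /(le_lt_trans (ler_norm _)) h; apply: Fr; rewrite h ?orbT.
exists M, `|r|; split => // x y.
have [xr|xr] := leP `|x| `|r|; last by rewrite Fr' ?normr0// xr.
have [yr|yr] := leP `|y| `|r|; last by rewrite Fr' ?normr0// yr orbT.
exact: (HM (x, y)).
Qed.

Lemma Cc_ext_supp {p} (f : 'rV[R]_p -> R) r : 0 <= r -> (forall x, r < `|x| -> f x = 0) ->
  forall t, ~ box r t -> f (row_of_tuple t) = 0 :> R.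
Proof.
by move=> r0 fr t /(contra_not (iffRL (boxE t r0))) /negP; rewrite -ltNge; exact: fr.
Qed.

Lemma box_lty {p} r : 0 <= r -> (lebesgue_tuple (@box R p r) < +oo)%E.
Proof. by move=> r0; rewrite lebesgue_tuple_box// ltry. Qed.

Lemma Int_integrable {p} (f : 'rV[R]_p -> R) : Cc f ->
  (@lebesgue_tuple R p).-integrable setT (fun t => (f (row_of_tuple t))%:E).
Proof.
move=> Cf; have [cf _] := Cf; have [M [r [M0 r0 fM fr]]] := Cc_bound Cf.
apply: (@bsupp_integrable _ _ _ _ _ (measurable_box r) (box_lty r0)
  (fun t => f (row_of_tuple t)) M).
- exact: measurable_continuous_row.
- by move=> t; exact: fM.
- exact: Cc_ext_supp.
Qed.

Lemma Int_le {p} (f : 'rV[R]_p -> R) M r : continuous f -> 0 <= M -> 0 <= r ->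
  (forall x, `|f x| <= M) -> (forall x, r < `|x| -> f x = 0) ->
  `|Int f| <= M * (r *+ 2) ^+ p.
Proof.
move=> cf M0 r0 fM fr.
have -> : M * (r *+ 2) ^+ p = M * fine (lebesgue_tuple (@box R p r)).
  by rewrite lebesgue_tuple_box.
exact: (@bsupp_Rintegral_le _ _ _ _ _ (measurable_box r) (box_lty r0)
  (fun t => f (row_of_tuple t)) M (measurable_continuous_row cf) M0
  (fun t => fM (row_of_tuple t)) (Cc_ext_supp r0 fr)).
Qed.

Lemma Int_dct {p} (f_ : nat -> 'rV[R]_p -> R) (f : 'rV[R]_p -> R) M r :
  0 <= r -> (forall n, continuous (f_ n)) ->
  (forall n x, `|f_ n x| <= M) -> (forall n x, r < `|x| -> f_ n x = 0) ->
  (forall x, f_ n x @[n --> \oo] --> f x) ->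
  Int (f_ n) @[n --> \oo] --> Int f.
Proof.
move=> r0 cf fM fr fc.
apply: (@bsupp_dct _ _ _ _ _ (measurable_box r) (box_lty r0)
   (fun n t => f_ n (row_of_tuple t)) (fun t => f (row_of_tuple t)) M).
- by move=> n; exact: (measurable_continuous_row (cf n)).
- by move=> n t; exact: fM.
- by move=> n; exact: (Cc_ext_supp r0 (fr n)).
- by move=> t; exact: fc.
Qed.

Lemma IntD {p} (f g : 'rV[R]_p -> R) : Cc f -> Cc g ->
  Int (fun x => f x + g x) = Int f + Int g.
Proof.
by move=> Cf Cg; rewrite [LHS]RintegralD//; exact: Int_integrable.
Qed.

Lemma IntZ {p} (f : 'rV[R]_p -> R) c : Cc f -> Int (fun x => c * f x) = c * Int f.
Proof. by move=> Cf; rewrite [LHS]RintegralZl//; exact: Int_integrable. Qed.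

Lemma Int_swap {p m} (F : 'rV[R]_p -> 'rV[R]_m -> R) : Cc2 F ->
  Int (fun x => Int (F x)) = Int (fun y => Int (F^~ y)).
Proof.
move=> CF; have [cF _] := CF; have [M [r [M0 r0 FM Fr]]] := Cc2_bound CF.
pose f (z : p.-tuple RT * m.-tuple RT) := F (row_of_tuple z.1) (row_of_tuple z.2).
have mf : measurable_fun setT f by exact: measurable_continuous_rows.
have f0 z : ~ (box r z.1 /\ box r z.2) -> f z = 0.
  move=> H; apply: Fr; have [|h1] := leP `|row_of_tuple z.1| r; last by [].
  move=> /(boxE _ r0) h1; have [|h2] := leP `|row_of_tuple z.2| r; last by [].
  by move=> /(boxE _ r0) h2; case: H.
have FM' z : `|f z| <= M by exact: FM.
have E1 := bsupp_fubini1 (measurable_box r) (measurable_box r) (box_lty r0) (box_lty r0) mf FM' f0.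
have E2 := bsupp_fubini2 (measurable_box r) (measurable_box r) (box_lty r0) (box_lty r0) mf FM' f0.
by rewrite E1 in E2; exact: E2.
Qed.

(** The form of continuity that dominated convergence provides for parameter
    integrals. *)
Lemma continuous_seq {V : normedModType R} (f : V -> R) x :
  (forall u : nat -> V, u n @[n --> \oo] --> x -> f (u n) @[n --> \oo] --> f x) ->
  {for x, continuous f}.
Proof.
move=> H; apply/cvgrPdist_lt => e e0; apply: contrapT => nH.
have Q (n : nat) : exists y, `|x - y| < n.+1%:R^-1 /\ ~ (`|f x - f y| < e).
  apply: contrapT => nQ; apply: nH.
  apply/nbhs_ballP; exists n.+1%:R^-1 => /=; first by rewrite invr_gt0.
  move=> y; rewrite -ball_normE/= => xy; apply: contrapT => fxy; apply: nQ.
  by exists y.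
have [u uP] := choice Q.
have ux : u n @[n --> \oo] --> x.
  apply/cvgrPdist_lt => d d0.
  have : (n.+1%:R^-1 : R) @[n --> \oo] --> 0 by exact: cvg_harmonic.
  move=> /cvgrPdist_lt/(_ d d0); apply: filterS => n.
  rewrite sub0r normrN ger0_norm ?invr_ge0// => nd.
  by have [un _] := uP n; exact: lt_trans un nd.
have /cvgrPdist_lt/(_ e e0)[N _ HN] := H u ux.
by have [_ nf] := uP N; apply: nf; exact: (HN N (leqnn N)).
Qed.

Lemma Cc2_section {p m} (F : 'rV[R]_p -> 'rV[R]_m -> R) x : Cc2 F -> Cc (F x).
Proof.
move=> [cF [r Fr]]; split; last by exists r => y yr; rewrite Fr// yr orbT.
move=> v.
have cv : {for v, continuous (fun v : 'rV[R]_m => (x, v))}.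
  apply: (@continuous_pair_at _ _ _ (fun=> x) id); last exact: cvg_id.
  exact: cst_continuous.
exact: (@continuous_comp _ _ _ (fun v : 'rV[R]_m => (x, v))
    (fun z : 'rV[R]_p * 'rV[R]_m => F z.1 z.2) v cv (cF _)).
Qed.

Lemma Cc2_section_l {p m} (F : 'rV[R]_p -> 'rV[R]_m -> R) y : Cc2 F -> Cc (F^~ y).
Proof.
move=> [cF [r Fr]]; split; last by exists r => x xr; rewrite Fr// xr.
move=> x.
have cx : {for x, continuous (fun x : 'rV[R]_p => (x, y))}.
  apply: (@continuous_pair_at _ _ _ id (fun=> y)); first exact: cvg_id.
  exact: cst_continuous.
exact: (@continuous_comp _ _ _ (fun x : 'rV[R]_p => (x, y))
    (fun z : 'rV[R]_p * 'rV[R]_m => F z.1 z.2) x cx (cF _)).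
Qed.

Lemma Cc_Int {p m} (F : 'rV[R]_p -> 'rV[R]_m -> R) : Cc2 F ->
  Cc (fun x => Int (F x)).
Proof.
move=> CF; have [cF _] := CF; have [M [r [M0 r0 FM Fr]]] := Cc2_bound CF.
split.
  move=> x; apply: continuous_seq => u ux.
  apply: (@Int_dct _ (fun n => F (u n)) _ M r) => //.
  - by move=> n; have [] := Cc2_section (u n) CF.
  - by move=> n y yr; rewrite Fr// yr orbT.
  - move=> y.
    have [cFy _] := Cc2_section_l y CF.
    exact: (@cvg_comp _ _ _ u (F^~ y) _ _ _ ux (cFy x)).
exists r => x xr; rewrite /Int; under eq_Rintegral do rewrite Fr ?xr//.
by rewrite /Rintegral integral0.
Qed.

(** An integral over [Om] becomes one over the whole space by extending the
    integrand by zero. *)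
Lemma integral_rV_Int {p} (Om : set 'rV[R]_p) (h h' : 'rV[R]_p -> R) : Cc h' ->
  (forall x, Om x -> h' x = h x) -> (forall x, ~ Om x -> h' x = 0) ->
  integral_rV Om h = (Int h')%:E.
Proof.
move=> Ch hh h0; rewrite /Int /Rintegral fineK; last first.
  exact: (integrable_fin_num measurableT (Int_integrable Ch)).
rewrite /integral_rV [LHS]integral_mkcond; apply: eq_integral => t _.
rewrite patchE; case: ifPn => [|].
  by rewrite inE /= => /hh ->.
by rewrite notin_setE /= => /h0 ->.
Qed.

End Cc.

(** * Splitting off one variable *)

Section Int_cons.
Context {R : realType}.
Notation RT := (measurableTypeR R).

Lemma normr_cons_row {p} x (v : 'rV[R]_p) r :
  (`|cons_row x v| <= r) = (`|x| <= r) && (`|v| <= r).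
Proof.
apply/idP/andP => [H|[xr vr]].
  have r0 : 0 <= r by exact: le_trans H.
  split; first by have := normr_coord (cons_row x v) ord0; rewrite cons_row0 => /le_trans; apply.
  apply: normr_row_le => // j.
  by have := normr_coord (cons_row x v) (lift ord0 j); rewrite cons_rowS => /le_trans; apply.
apply: normr_row_le => [|i]; first exact: le_trans xr.
case: (unliftP ord0 i) => [j|] ->; last by rewrite cons_row0.
by rewrite cons_rowS (le_trans (normr_coord _ _)).
Qed.

Lemma measurable_itv_sym (r : R) : measurable (`[- r, r]%classic : set RT).
Proof. exact: measurable_itv. Qed.

Lemma itv_sym_lty (r : R) :
  (lebesgue_measure (`[(- r)%R, r]%classic : set RT) < +oo)%E.
Proof.
have E : lebesgue_measure (`[(- r)%R, r]%classic : set RT) = _ :=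
  @lebesgue_measure_itv R `[- r, r].
by rewrite [X in (X < _)%E]E/=; case: ifP => _; rewrite -?EFinB ltry.
Qed.

(** Fubini for the first coordinate against the others.  The integrability of the
    inner integrals serves to move scalars across the outer ones. *)
Lemma Int_cons_prod {p} (f : 'rV[R]_p.+1 -> R) : Cc f ->
  [/\ Int f = Int1 (fun x => Int (fun v => f (cons_row x v))),
      Int f = Int (fun v => Int1 (fun x => f (cons_row x v))),
      lebesgue_measure.-integrable setT
        (fun x => (Int (fun v => f (cons_row x v)))%:E) &
      (@lebesgue_tuple R p).-integrable setT
        (fun t => (Int1 (fun x => f (cons_row x (row_of_tuple t))))%:E)].
Proof.
move=> Cf; have [cf _] := Cf; have [M [r [M0 r0 fM fr]]] := Cc_bound Cf.
pose g (z : RT * p.-tuple RT) := f (cons_row z.1 (row_of_tuple z.2)).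
have gE z : g z = f (row_of_tuple (cons_tuple z)).
  by rewrite /g /cons_tuple row_of_tuple_cons.
have mg : measurable_fun setT g.
  rewrite (_ : g = (fun t => f (row_of_tuple t)) \o @cons_tuple R p); last first.
    by apply/funext => z; rewrite gE.
  apply: measurableT_comp; [exact: measurable_continuous_row|exact: measurable_cons_tuple].
have g0 z : ~ ((`[- r, r]%classic : set RT) z.1 /\ box r z.2) -> g z = 0.
  move=> H; apply: fr; rewrite ltNge normr_cons_row; apply/negP => /andP[h1 h2].
  by apply: H; split; [rewrite /= in_itv/= -ler_norml|apply/boxE].
have gM z : `|g z| <= M by exact: fM.
have E1 := bsupp_fubini1 (measurable_itv_sym r) (measurable_box r) (itv_sym_lty r)
  (box_lty r0) mg gM g0.
have E2 := bsupp_fubini2 (measurable_itv_sym r) (measurable_box r) (itv_sym_lty r)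
  (box_lty r0) mg gM g0.
have Ig := bsupp_prod_integrable (measurable_itv_sym r) (measurable_box r) (itv_sym_lty r)
  (box_lty r0) mg gM g0.
suff E : Int f = \int[(lebesgue_measure \x @lebesgue_tuple R p)%E]_z g z.
  split; [by rewrite E E1|by rewrite E E2| |].
    exact: (bsupp_fubini1_integrable (measurable_itv_sym r) (measurable_box r)
      (itv_sym_lty r) (box_lty r0) mg gM g0).
  exact: (bsupp_fubini2_integrable (measurable_itv_sym r) (measurable_box r)
    (itv_sym_lty r) (box_lty r0) mg gM g0).
rewrite /Int /Rintegral; congr fine.
have mF : measurable_fun setT (fun t : p.+1.-tuple RT => (f (row_of_tuple t))%:E).
  by apply/measurable_EFinP; exact: measurable_continuous_row.
have Ig' : (lebesgue_measure \x @lebesgue_tuple R p)%E.-integrable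
    (@cons_tuple R p @^-1` setT)
    ((fun t : p.+1.-tuple RT => (f (row_of_tuple t))%:E) \o @cons_tuple R p).
  rewrite preimage_setT; congr (_.-integrable _ _) : Ig.
  by apply/funext => z /=; rewrite gE.
rewrite [LHS](integral_pushforward (@measurable_cons_tuple R p) mF Ig' measurableT).
by rewrite preimage_setT; apply: eq_integral => z _ /=; rewrite gE.
Qed.

End Int_cons.

Section affine_1d.
Context {R : realType}.
Notation mu := (@lebesgue_measure R).

Lemma Int1_itv (g : R -> R) (a b : R) : (forall x, x \notin `[a, b] -> g x = 0) ->
  Int1 g = fine (\int[mu]_(x in `[a, b]) (g x)%:E).
Proof.
move=> g0; rewrite /Int1 /Rintegral; congr fine.
rewrite [RHS]integral_mkcond; apply: eq_integral => x _.
by rewrite patchE mem_setE; case: ifPn => // /g0 ->.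
Qed.

(** Integration by substitution on a segment outside of which both integrands
    vanish. *)
Lemma Int1_affine (g : R -> R) (a b r : R) : continuous g -> a != 0 ->
  (forall x, r < `|x| -> g x = 0) ->
  `|a| * Int1 (fun x => g (x * a + b)) = Int1 g.
Proof.
move=> cg a0 gr.
wlog r0 : r gr / 0 <= r.
  move=> H; apply: (H `|r|) => // x /(le_lt_trans (ler_norm _)); exact: gr.
have na : 0 < `|a| by rewrite normr_gt0.
(* [`|x| > s] forces [`|x * a + b| > r]. *)
pose s := (r + `|b|) / `|a|.
have s0 : 0 <= s by rewrite divr_ge0// addr_ge0.
have ss : - s <= s by rewrite (le_trans _ s0)// oppr_le0.
pose F x := x * a + b.
have dF (x : R) : is_derive x 1 F a.
  rewrite /F; apply: is_derive_eq; by rewrite addr0 [_ *: _]mulr0 add0r [_ *: _]mulr1.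
have F'E : derive1 F = cst a.
  by apply/funext => x; rewrite derive1E; have [_ ->] := dF x.
have cF : continuous F.
  move=> x; have [d _] := dF x.
  exact/differentiable_continuous/derivable1_diffP.
have LR : derivable_oo_LRcontinuous F (- s) s.
  split; first by move=> x _; have [] := dF x.
    by apply: cvg_at_right_filter; exact: cF.
  by apply: cvg_at_left_filter; exact: cF.
have gF0 x : x \notin `[- s, s] -> g (F x) = 0.
  rewrite in_itv/= -ler_norml -ltNge => xs; apply: gr.
  move: xs; rewrite /s ltr_pdivrMr// -normrM -ltrBrDr => /lt_le_trans; apply.
  have := ler_normD (F x) (- b); rewrite /F addrK normrN; lra.
have rs : r <= s * `|a| - `|b| by rewrite /s divfK ?gt_eqF// addrK.
have [lb1 lb2] : - `|b| <= b /\ b <= `|b|.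
  by split; [rewrite lerNl -normrN ler_norm|exact: ler_norm].
have Igf : `|a| * fine (\int[mu]_(x in `[- s, s]) (g (F x))%:E)
    = fine (\int[mu]_(x in `[- s, s]) (`|a| * g (F x))%:E).
  rewrite -[RHS]/(\int[mu]_(x in `[- s, s]) (`|a| * g (F x))) RintegralZl//.
  apply: continuous_compact_integrable; first exact: segment_compact.
  apply: continuous_subspaceT => x.
  by apply: (@continuous_comp _ _ _ F g); [exact: cF|exact: cg].
rewrite (Int1_itv gF0) Igf.
have [a_gt0|a_lt0|a_eq0] := ltgtP 0 a; last by rewrite -a_eq0 eqxx in a0.
- have gF : forall x, x \notin `[F (- s), F s] -> g x = 0.
    have F1 : F (- s) <= - r by rewrite gtr0_norm// in rs; rewrite /F; lra.
    have F2 : r <= F s by rewrite gtr0_norm// in rs; rewrite /F; lra.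
    move=> x; rewrite in_itv/= negb_and -!ltNge => H; apply: gr.
    rewrite ltNge ler_norml; apply/negP => /andP[x1 x2].
    by case/orP: H => H; lra.
  rewrite (Int1_itv gF); congr fine.
  rewrite (integration_by_substitution_increasing ss) => //.
  + apply: eq_integral => x _; rewrite F'E /= gtr0_norm//.
    by rewrite /GRing.mul/= mulrC.
  + by move=> x y _ _ xy; rewrite /F ltrD2r ltr_pM2r.
  + by rewrite F'E => x _; exact: cst_continuous.
  + by rewrite F'E; apply: is_cvg_cst.
  + by rewrite F'E; apply: is_cvg_cst.
  + exact: continuous_subspaceT.
- have gF : forall x, x \notin `[F s, F (- s)] -> g x = 0.
    have F1 : F s <= - r by rewrite ltr0_norm// in rs; rewrite /F; lra.
    have F2 : r <= F (- s) by rewrite ltr0_norm// in rs; rewrite /F; lra.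
    move=> x; rewrite in_itv/= negb_and -!ltNge => H; apply: gr.
    rewrite ltNge ler_norml; apply/negP => /andP[x1 x2].
    by case/orP: H => H; lra.
  rewrite (Int1_itv gF); congr fine.
  rewrite (integration_by_substitution_decreasing ss) => //.
  + apply: eq_integral => x _; rewrite F'E /= ltr0_norm//.
    by rewrite /GRing.mul/= mulrC.
  + by move=> x y _ _ xy; rewrite /F ltrD2r ltr_nM2r.
  + by rewrite F'E => x _; exact: cst_continuous.
  + by rewrite F'E; apply: is_cvg_cst.
  + by rewrite F'E; apply: is_cvg_cst.
  + exact: continuous_subspaceT.
Qed.

End affine_1d.

(** * Linear changes of variables *)

Section linear_change.
Context {R : realType}.

Lemma Cc_comp {V V' : normedModType R} (f : V -> R) (a : V' -> V) :
  continuous a -> (forall r, exists r', forall y, `|a y| <= r -> `|y| <= r') ->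
  Cc f -> Cc (fun y => f (a y)).
Proof.
move=> ca ha [cf [r fr]]; split.
  by move=> y; apply: (@continuous_comp _ _ _ a f); [exact: ca|exact: cf].
have [r' r'P] := ha r; exists r' => y yr; apply: fr.
by rewrite ltNge; apply/negP => /r'P; rewrite leNgt yr.
Qed.

Lemma continuous_add_at {V W : normedModType R} (f g : V -> W) x :
  {for x, continuous f} -> {for x, continuous g} ->
  {for x, continuous (fun y => f y + g y)}.
Proof. by move=> cf cg; exact: (continuousD cf cg). Qed.

Lemma mulmx_bound {p m} (A : 'M[R]_(p, m)) :
  exists2 C, 0 <= C & forall v : 'rV[R]_p, `|v *m A| <= C * `|v|.
Proof.
exists (\sum_i \sum_j `|A i j|); first by apply: sumr_ge0 => i _; apply: sumr_ge0.
move=> v; apply: normr_row_le => [|j].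
  by rewrite mulr_ge0//; apply: sumr_ge0 => i _; apply: sumr_ge0.
rewrite mxE (le_trans (ler_norm_sum _ _ _))// mulr_suml ler_sum// => i _.
rewrite normrM mulrC ler_pM// ?normr_coord//.
by rewrite (bigD1 j)//= lerDl sumr_ge0.
Qed.

Lemma continuous_mulmx {p m} (A : 'M[R]_(p, m)) :
  continuous (fun v : 'rV[R]_p => v *m A).
Proof.
move=> v; apply: (@continuous_row R 'rV[R]_p) => j.
have H : \sum_i w 0 i * A i j @[w --> v] --> \sum_i v 0 i * A i j.
  apply: (@cvg_fsum R _ (nbhs v)) => i; apply: cvgM; last exact: cvg_cst.
  exact: coord_continuous.
rewrite /prop_for /continuous_at mxE.
rewrite (_ : (fun y => _) = (fun w : 'rV[R]_p => \sum_i w 0 i * A i j)); first exact: H.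
by apply/funext => w; rewrite mxE.
Qed.

Lemma unit_proper {p} (A : 'M[R]_p) (b : 'rV[R]_p) : A \in unitmx ->
  forall r : R, exists r' : R, forall y : 'rV[R]_p, `|y *m A + b| <= r -> `|y| <= r'.
Proof.
move=> uA r; have [C C0 CA] := mulmx_bound (invmx A).
exists (C * (r + `|b|)) => y yr.
rewrite -[y](mulmxK uA) (le_trans (CA _))// ler_wpM2l//.
by rewrite -[y *m A](addrK b) (le_trans (ler_normB _ _))// lerD2r.
Qed.

Lemma Cc_affine {p} (f : 'rV[R]_p -> R) (A : 'M[R]_p) (b : 'rV[R]_p) :
  A \in unitmx -> Cc f -> Cc (fun y => f (y *m A + b)).
Proof.
move=> uA; apply: (@Cc_comp _ _ f (fun y => y *m A + b)); last exact: unit_proper.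
move=> y; apply: (@continuous_add_at 'rV[R]_p 'rV[R]_p (fun y => y *m A) (fun=> b)).
  exact: continuous_mulmx.
exact: cst_continuous.
Qed.

Lemma Cc_mulmx {p} (f : 'rV[R]_p -> R) (A : 'M[R]_p) :
  A \in unitmx -> Cc f -> Cc (fun y => f (y *m A)).
Proof.
move=> uA /(Cc_affine 0 uA); congr Cc; apply/funext => y.
by rewrite addr0.
Qed.

Lemma Cc_shift {p} (f : 'rV[R]_p -> R) b : Cc f -> Cc (fun y => f (y + b)).
Proof.
move=> /(Cc_affine b (unitmx1 R p)); congr Cc; apply/funext => y.
by rewrite mulmx1.
Qed.

Lemma Cc_cons_row {p} (f : 'rV[R]_p.+1 -> R) x : Cc f -> Cc (fun v => f (cons_row x v)).
Proof.
apply: Cc_comp.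
  by apply: (@continuous_cons_row _ _ _ (fun=> x) id); [exact: cst_continuous|move=> ?; exact: cvg_id].
by move=> r; exists r => y; rewrite normr_cons_row => /andP[].
Qed.

Lemma Cc_cons_row1 {p} (f : 'rV[R]_p.+1 -> R) v : Cc f ->
  Cc (fun x : R => f (cons_row x v)).
Proof.
apply: (@Cc_comp _ _ f (fun x : R => cons_row x v)).
  by apply: (@continuous_cons_row _ _ _ id (fun=> v)); [move=> ?; exact: cvg_id|exact: cst_continuous].
by move=> r; exists r => y; rewrite normr_cons_row => /andP[].
Qed.

Lemma Cc_int1_affine (g : R -> R) (a b : R) : Cc g -> a != 0 ->
  `|a| * Int1 (fun x => g (x * a + b)) = Int1 g.
Proof. by move=> [cg [r gr]] a0; exact: (Int1_affine b cg a0 gr). Qed.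

Lemma cons_row_add {p} x y (v w : 'rV[R]_p) :
  cons_row (x + y) (v + w) = cons_row x v + cons_row y w.
Proof.
apply/rowP => i; rewrite [in RHS]mxE; case: (unliftP ord0 i) => [j|] ->.
  by rewrite !cons_rowS mxE.
by rewrite !cons_row0.
Qed.

Lemma cons_row_eta {p} (v : 'rV[R]_p.+1) :
  v = cons_row (v 0 ord0) (\row_j v 0 (lift ord0 j)).
Proof.
apply/rowP => i; case: (unliftP ord0 i) => [j|] ->.
  by rewrite cons_rowS mxE.
by rewrite cons_row0.
Qed.

Lemma Int1_ext (g h : R -> R) : g =1 h -> Int1 g = Int1 h.
Proof. by move=> /funext ->. Qed.

Lemma Int_ext {p} (f g : 'rV[R]_p -> R) : f =1 g -> Int f = Int g.
Proof. by move=> /funext ->. Qed.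

Lemma Int_shift {p} (f : 'rV[R]_p -> R) b : Cc f -> Int (fun y => f (y + b)) = Int f.
Proof.
elim: p f b => [|p ih] f b Cf.
  by apply: Int_ext => y; congr f; apply/rowP => -[].
have [-> _ _ _] := Int_cons_prod (Cc_shift b Cf); rewrite (cons_row_eta b).
set b0 := b 0 ord0; set b' := \row_j _.
transitivity (Int1 (fun x => Int (fun v => f (cons_row (x + b0) v)))).
  apply: Int1_ext => x.
  rewrite -(ih (fun v => f (cons_row (x + b0) v)) b'); last exact: Cc_cons_row.
  by apply: Int_ext => v; rewrite cons_row_add.
have E x v : cons_row x v + cons_row b0 0 = cons_row (x + b0) v :> 'rV[R]_p.+1.
  by rewrite -cons_row_add addr0.
have [I1 I2 _ _] := Int_cons_prod (Cc_shift (cons_row b0 0) Cf).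
transitivity (Int (fun v : 'rV[R]_p => Int1 (fun x => f (cons_row (x + b0) v)))).
  transitivity (Int (fun y => f (y + cons_row b0 0))).
    by rewrite I1; apply: Int1_ext => x; apply: Int_ext => v; rewrite E.
  by rewrite I2; apply: Int_ext => v; apply: Int1_ext => x; rewrite E.
have [_ -> _ _] := Int_cons_prod Cf; apply: Int_ext => v.
have := Cc_int1_affine b0 (Cc_cons_row1 v Cf) (oner_neq0 R).
rewrite normr1 mul1r => <-; apply: Int1_ext => x.
by rewrite mulr1.
Qed.

Definition det_change {p} (A : 'M[R]_p) : Prop :=
  forall f : 'rV[R]_p -> R, Cc f -> `|\det A| * Int (fun t => f (t *m A)) = Int f.

Lemma det_change_mul {p} (A B : 'M[R]_p) : A \in unitmx -> B \in unitmx ->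
  det_change A -> det_change B -> det_change (A *m B).
Proof.
move=> uA uB dA dB f Cf.
rewrite -(dB f Cf) -(dA _ (Cc_mulmx uB Cf)) det_mulmx normrM mulrA.
by rewrite [X in X * _]mulrC; congr (_ * _); apply: Int_ext => t; rewrite mulmxA.
Qed.

(** Allows one to multiply by a shear before changing variables. *)
Lemma det_change_cancel {p} (A B : 'M[R]_p) : A \in unitmx -> B \in unitmx ->
  det_change A -> det_change (A *m B) -> det_change B.
Proof.
move=> uA uB dA dAB f Cf.
rewrite -(dAB f Cf) -(dA _ (Cc_mulmx uB Cf)) det_mulmx normrM mulrA.
by rewrite [X in X * _]mulrC; congr (_ * _); apply: Int_ext => t; rewrite mulmxA.
Qed.

Lemma cons_row_mul {p} x (v : 'rV[R]_p) (a : R) (b : 'rV[R]_p) (c : 'cV[R]_p)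
    (D : 'M[R]_p) :
  (cons_row x v : 'rV[R]_(1 + p)) *m block_mx (a%:M : 'M[R]_1) b c D =
  cons_row (x * a + (v *m c) 0 0) (x *: b + v *m D).
Proof.
rewrite /cons_row mul_row_block mul_scalar_mx scale_scalar_mx mul_scalar_mx.
by congr row_mx; rewrite [X in _ + X = _]mx11_scalar -raddfD.
Qed.

(** For each value of the first coordinate, the others undergo [D] and a
    translation. *)
Lemma det_change_upper {p} (b : 'rV[R]_p) (D : 'M[R]_p) : D \in unitmx ->
  det_change D -> det_change (block_mx (1%:M : 'M[R]_1) b 0 D).
Proof.
move=> uD dD f Cf.
have uT : block_mx (1%:M : 'M[R]_1) b 0 D \in unitmx.
  by rewrite unitmxE det_ublock det1 mul1r -unitmxE.
have uD' : block_mx (1%:M : 'M[R]_1) 0 0 D \in unitmx.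
  by rewrite unitmxE det_ublock det1 mul1r -unitmxE.
rewrite det_ublock det1 mul1r.
have [I1 _ _ _] := Int_cons_prod (Cc_mulmx uT Cf).
have [J1 _ _ _] := Int_cons_prod Cf.
have [_ _ K1 _] := Int_cons_prod (Cc_mulmx uD' Cf).
rewrite I1 J1.
have Z x (v : 'rV[R]_p) : (cons_row x v : 'rV[R]_(1 + p)) *m block_mx (1%:M : 'M[R]_1) b 0 D =
    cons_row x (x *: b + v *m D).
  by rewrite cons_row_mul mulr1 mulmx0 mxE addr0.
have Z' x (v : 'rV[R]_p) : (cons_row x v : 'rV[R]_(1 + p)) *m block_mx (1%:M : 'M[R]_1) 0 0 D =
    cons_row x (v *m D).
  by rewrite cons_row_mul mulr1 mulmx0 mxE addr0 scaler0 add0r.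
transitivity (`|\det D| * Int1 (fun x => Int (fun v =>
    f ((cons_row x v : 'rV[R]_(1 + p)) *m block_mx (1%:M : 'M[R]_1) 0 0 D)))).
  apply: (congr1 (fun z => `|\det D| * z)); apply: Int1_ext => x.
  pose h v := f (cons_row x (v *m D)).
  have Ch : Cc h by exact: (Cc_mulmx uD (Cc_cons_row x Cf)).
  transitivity (Int h); last by apply: Int_ext => v; rewrite Z'.
  rewrite -(Int_shift (x *: (b *m invmx D)) Ch); apply: Int_ext => v.
  by rewrite /h Z mulmxDl -scalemxAl mulmxKV// addrC.
rewrite -[LHS](RintegralZl `|\det D| measurableT K1); apply: Int1_ext => x.
rewrite -(dD _ (Cc_cons_row x Cf)); apply: (congr1 (fun z => `|\det D| * z)).
by apply: Int_ext => v; rewrite Z'.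
Qed.

(** For each value of the other coordinates, the first one undergoes an affine
    map. *)
Lemma det_change_lower {p} (a : R) (c : 'cV[R]_p) : a != 0 ->
  det_change (block_mx (a%:M : 'M[R]_1) 0 c (1%:M : 'M[R]_p)).
Proof.
move=> a0 f Cf.
have dT : \det (block_mx (a%:M : 'M[R]_1) 0 c (1%:M : 'M[R]_p)) = a.
  by rewrite det_lblock det1 mulr1 det_scalar1.
have uT : block_mx (a%:M : 'M[R]_1) 0 c (1%:M : 'M[R]_p) \in unitmx.
  by rewrite unitmxE dT unitfE.
rewrite dT.
have [_ I2 _ K2] := Int_cons_prod (Cc_mulmx uT Cf).
have [_ J2 _ _] := Int_cons_prod Cf.
rewrite I2 J2.
have E (v : 'rV[R]_p) : `|a| * Int1 (fun x => f ((cons_row x v : 'rV[R]_(1 + p)) *m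
   block_mx (a%:M : 'M[R]_1) 0 c (1%:M : 'M[R]_p))) = Int1 (fun x => f (cons_row x v)).
  rewrite -(Cc_int1_affine ((v *m c) 0 0) (Cc_cons_row1 v Cf) a0).
  apply: (congr1 (fun z => `|a| * z)).
  by apply: Int1_ext => x; rewrite cons_row_mul scaler0 add0r mulmx1.
rewrite -[LHS](RintegralZl `|a| measurableT K2).
transitivity (Int (fun v : 'rV[R]_p => `|a| * Int1 (fun x =>
    f ((cons_row x v : 'rV[R]_(1 + p)) *m block_mx (a%:M : 'M[R]_1) 0 c (1%:M : 'M[R]_p))))).
  reflexivity.
by apply: Int_ext => v; exact: E.
Qed.

Lemma row'_block_tail {p} (a a' : 'M[R]_1) (b b' : 'rV[R]_p) (c : 'cV[R]_p)
    (D : 'M[R]_p) :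
  row' (lshift p ord0) (block_mx a b c D) = row' (lshift p ord0) (block_mx a' b' c D).
Proof.
apply/matrixP => i j; rewrite !mxE; case: splitP => k Hk.
  by move: Hk; rewrite (ord1 k) /= /bump.
by rewrite !mxE.
Qed.

(** Induction on the dimension.  When the lower right block [D] is invertible, the
    matrix is the product of two block triangular ones, each of which changes only
    one group of variables.  When it is singular, adding multiples of the first row
    to the others, a shear, makes the block invertible. *)
Lemma det_change_unit {p} (A : 'M[R]_p) : A \in unitmx -> det_change A.
Proof.
elim: p A => [|p ih] A uA.
  move=> f Cf; rewrite det_mx00 normr1 mul1r; apply: Int_ext => t.
  by congr f; apply/rowP => -[].
have uL (a : R) (c : 'cV[R]_p) : a != 0 ->
    block_mx (a%:M : 'M[R]_1) 0 c (1%:M : 'M[R]_p) \in unitmx.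
  by move=> a0; rewrite unitmxE det_lblock det1 mulr1 det_scalar1 unitfE.
have uU (b : 'rV[R]_p) (D : 'M[R]_p) : D \in unitmx ->
    block_mx (1%:M : 'M[R]_1) b 0 D \in unitmx.
  by move=> uD; rewrite unitmxE det_ublock det1 mul1r -unitmxE.
have main (a : R) (b : 'rV[R]_p) (c : 'cV[R]_p) (D : 'M[R]_p) : D \in unitmx ->
    block_mx (a%:M : 'M[R]_1) b c D \in unitmx ->
    det_change (block_mx (a%:M : 'M[R]_1) b c D).
  move=> uD uT.
  (* The Schur complement of [D]. *)
  pose s := (a%:M - b *m invmx D *m c : 'M[R]_1) 0 0.
  have E : block_mx (a%:M : 'M[R]_1) b c D =
      block_mx (1%:M : 'M[R]_1) b 0 D *m
      block_mx (s%:M : 'M[R]_1) 0 (invmx D *m c) (1%:M : 'M[R]_p).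
    rewrite mulmx_block !mul1mx !mul0mx !mulmx1 !add0r mulKVmx//.
    by rewrite -mx11_scalar mulmxA subrK.
  have s0 : s != 0.
    apply/eqP => s0; move: uT; rewrite E unitmxE det_mulmx.
    by rewrite det_lblock s0 det_scalar1 mul0r mulr0 unitr0.
  rewrite E; apply: det_change_mul; [exact: uU|exact: uL| |exact: det_change_lower].
  by apply: det_change_upper => //; exact: ih.
move: A uA; rewrite -[p.+1]/(1 + p)%N => A uA.
rewrite -(submxK A) in uA *.
move: (ulsubmx A) (ursubmx A) (dlsubmx A) (drsubmx A) uA => a0 b c D.
rewrite (mx11_scalar a0); move: (a0 0 0) => {a0} a uA.
have [uD|nD] := boolP (D \in unitmx); first exact: main.
have dD : \det D = 0 by move: nD; rewrite unitmxE unitfE negbK => /eqP.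
have uS := uL 1 c (oner_neq0 R).
apply: (det_change_cancel uS uA (det_change_lower c (oner_neq0 R))).
have uST : block_mx (1%:M : 'M[R]_1) 0 c (1%:M : 'M[R]_p) *m
    block_mx (a%:M : 'M[R]_1) b c D \in unitmx by rewrite unitmx_mul uS.
move: uST; rewrite mulmx_block !mul1mx !mul0mx !addr0 => uST.
apply: main => //.
(* The row [(1, - b)] is [- (a, b)] plus [1 + a] times [(1, 0)]; since [\det D = 0],
   the new block has minus the determinant of the whole matrix. *)
have E1 : block_mx (1%:M : 'M[R]_1) (- b) c D =
    block_mx (1%:M : 'M[R]_1) 0 c (1%:M : 'M[R]_p) *m
    block_mx (1%:M : 'M[R]_1) (- b) 0 (c *m b + D).
  by rewrite mulmx_block !mul1mx !mul0mx !mulmx1 ?mulmx0 !addr0 mulmxN addKr.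
have E2 : \det (block_mx (1%:M : 'M[R]_1) (- b) c D) =
    - 1 * \det (block_mx (a%:M : 'M[R]_1) b c D) +
    (1 + a) * \det (block_mx (1%:M : 'M[R]_1) 0 c D).
  apply: (@determinant_multilinear _ _ _ _ _ (lshift p ord0)).
  - apply/rowP => j; rewrite !mxE; case: splitP => // k0 _.
    rewrite !mxE; case: splitP => k _; rewrite !mxE ?ord1 /=.
      by rewrite !mulr1n mulN1r mulr1 addrC addrK.
    by rewrite mulr0 addr0 mulN1r.
  - by apply: row'_block_tail.
  - by apply: row'_block_tail.
have E3 : \det (c *m b + D) = - \det (block_mx (a%:M : 'M[R]_1) b c D).
  move: E2; rewrite E1 det_mulmx det_lblock det_ublock !det1 !mul1r.
  by rewrite det_lblock dD mulr0 mulr0 addr0 mulN1r.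
by move: uA; rewrite !unitmxE E3 !unitfE oppr_eq0.
Qed.

End linear_change.

(** * Jacobians, extension by zero and mollifiers *)

Section jacobian_calculus.
Context {R : realType} {p : nat}.
Implicit Types (Om : set 'rV[R]_p) (Xi Th : 'rV[R]_p -> 'rV[R]_p).

(** Rows are indexed by the variables, so that [jac Xi x] acts on row vectors. *)
Definition jac (Xi : 'rV[R]_p -> 'rV[R]_p) (x : 'rV[R]_p) : 'M[R]_p :=
  \matrix_(i, j) 'D_(delta_mx 0 i) (fun y => Xi y 0 j) x.

Definition absdet_jac (Xi : 'rV[R]_p -> 'rV[R]_p) (x : 'rV[R]_p) : R :=
  `|\det (jac Xi x)|.

Lemma derive_partials Om (f : 'rV[R]_p -> R) x v : open Om -> smooth_on Om f ->
  Om x -> 'D_v f x = \sum_i v 0 i * 'D_(delta_mx 0 i) f x.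
Proof.
move=> oO sf Ox.
have [_ ->] := chain_rule (Xi := id) oO sf Ox (@derivable_id _ _ x v).
by rewrite derive_id.
Qed.

Lemma derive_jac Om Xi x v : open Om -> smooth_on Om Xi -> Om x ->
  'D_v Xi x = v *m jac Xi x.
Proof.
move=> oO sX Ox; rewrite derive_mx; last exact: (smooth_derivable sX Ox v).
apply/rowP => j; rewrite !mxE.
rewrite (derive_partials v oO (smooth_coord 0 j oO sX) Ox).
by apply: eq_bigr => i _; rewrite !mxE.
Qed.

(** The chain rule for [Th \o Xi], which is the identity near [x]. *)
Lemma jac_inverse Om Om' Xi Th x : open Om -> open Om' ->
  smooth_on Om Xi -> smooth_on Om' Th -> (forall x, Om x -> Om' (Xi x)) ->
  (forall x, Om x -> Th (Xi x) = x) -> Om x -> jac Xi x *m jac Th (Xi x) = 1%:M.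
Proof.
move=> oO oO' sX sT XO TX Ox; apply/matrixP => i j.
have dX := smooth_derivable sX Ox (delta_mx 0 i).
have sTj := smooth_coord 0 j oO' sT.
have [_ E] := chain_rule oO' sTj (XO _ Ox) dX.
rewrite (@derive_eq_on _ _ _ Om _ (fun y => y 0 j)) // in E; last first.
  by move=> y /TX /= ->.
have did : derivable (@id 'rV[R]_p) x (delta_mx 0 i) by exact: derivable_id.
have E2 := derive_mx did; rewrite derive_id in E2.
have E3 : 'D_(delta_mx 0 i) (fun y : 'rV[R]_p => y 0 j) x = (i == j)%:R.
  have := congr1 (fun M : 'rV[R]_p => M 0 j) E2.
  by rewrite !mxE eqxx/= => <-; rewrite eq_sym.
rewrite E3 in E; rewrite mxE [RHS]mxE E; apply: eq_bigr => k _.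
by rewrite (derive_mx dX) !mxE.
Qed.

Lemma jac_unit Om Om' Xi Th x : open Om -> open Om' ->
  smooth_on Om Xi -> smooth_on Om' Th -> (forall x, Om x -> Om' (Xi x)) ->
  (forall x, Om x -> Th (Xi x) = x) -> Om x -> jac Xi x \in unitmx.
Proof.
move=> oO oO' sX sT XO TX Ox.
by have [] := mulmx1_unit (jac_inverse oO oO' sX sT XO TX Ox).
Qed.

Lemma smooth_absdet_jac Om Xi : open Om -> smooth_on Om Xi ->
  (forall x, Om x -> jac Xi x \in unitmx) -> smooth_on Om (absdet_jac Xi).
Proof.
move=> oO sX uX; apply: smooth_normr => //.
  by move=> x /uX; rewrite unitmxE unitfE.
apply: smooth_det => // i j.
rewrite (_ : (fun x => _) = 'D_(delta_mx 0 i) (fun y => Xi y 0 j)).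
  by apply: smooth_derive; exact: smooth_coord.
by apply/funext => x; rewrite mxE.
Qed.

End jacobian_calculus.

Section extension_by_zero.
Context {R : realType}.

(** The extension is continuous on the open sets [A] and [~` K], which cover. *)
Lemma continuous_ext0 {T : topologicalType} (A K : set T) (h : T -> R) :
  open A -> closed K -> K `<=` A -> (forall x, A x -> {for x, continuous h}) ->
  (forall x, A x -> ~ K x -> h x = 0) -> continuous (h \_ A).
Proof.
move=> oA cK KA ch h0 x.
have [Ax|nAx] := pselect (A x).
  have E : \forall y \near x, h y = (h \_ A) y.
    apply: filterS (open_nbhs_nbhs (conj oA Ax)) => y Ay.
    by rewrite patchE mem_set.
  have := ch x Ax; rewrite /prop_for /continuous_at (nbhs_singleton E).
  by move=> H; apply: cvg_trans H; exact: near_eq_cvg.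
have E : \forall y \near x, 0 = (h \_ A) y.
  apply: filterS (open_nbhs_nbhs (conj (closed_openC cK) (contra_not (KA x) nAx))).
  move=> y nKy; rewrite patchE; case: ifPn => //.
  by rewrite inE => /h0 ->.
rewrite /continuous_at -(nbhs_singleton E).
have H : (fun=> 0 : R) @ x --> (0 : R) by exact: cvg_cst.
by apply: cvg_trans H; exact: near_eq_cvg.
Qed.

Lemma Cc_ext0 {p} (A K : set 'rV[R]_p) (h : 'rV[R]_p -> R) :
  open A -> compact K -> K `<=` A -> (forall x, A x -> {for x, continuous h}) ->
  (forall x, A x -> ~ K x -> h x = 0) -> Cc (h \_ A).
Proof.
move=> oA cK KA ch h0; split.
  by apply: continuous_ext0 ch h0 => //; apply: compact_closed.
have [M [_ HM]] := compact_bounded cK.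
exists (`|M| + 1) => x xM; rewrite patchE; case: ifPn => //; rewrite inE => Ax.
apply: h0 => // Kx.
have : `|x| <= `|M| + 1.
  by apply: (HM (`|M| + 1)) => //; rewrite ltr_pwDr ?ler_norm.
by rewrite leNgt xM.
Qed.

(** Compactness makes the radius of the balls contained in [A] uniform on [K];
    the thickening is the sum of [K] and a closed ball. *)
Lemma compact_thicken {p} (K A : set 'rV[R]_p) : open A -> compact K -> K `<=` A ->
  exists e K', [/\ 0 < e, compact K', K' `<=` A &
    forall k y, K k -> `|y - k| <= e -> K' y].
Proof.
move=> oA cK KA.
have : \forall e \near 0^'+, K `<=` [set k | forall y : 'rV[R]_p, `|y - k| <= e -> A y].
  apply: (iffLR (compact_near_coveringP K) cK R (at_right 0)
    (fun e k => forall y : 'rV[R]_p, `|y - k| <= e -> A y)) => k Kk.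
  have /nbhs_ballP[r /= r0 rA] : nbhs k A by apply: open_nbhs_nbhs; split=> //; exact: KA.
  have r2 : 0 < r / 2 by rewrite divr_gt0.
  exists (ball k (r / 2), [set e | e < r / 2]).
    by split; [exact: nbhsx_ballx|exact: nbhs_right_lt].
  move=> [k' e] [/= kk' er] y yk'; apply: rA; rewrite -ball_normE/=.
  rewrite -ball_normE/= in kk'.
  rewrite -(subrKA k') (le_lt_trans (ler_normD _ _))// (splitr r) ltr_leD//.
  by rewrite distrC (le_trans yk')// ltW.
move=> H.
have [e [e0 He]] : exists e, 0 < e /\ K `<=` [set k | forall y : 'rV[R]_p, `|y - k| <= e -> A y].
  by near (0 : R)^'+ => e; exists e; split; [|near: e].
exists e, ((fun z : 'rV[R]_p * 'rV[R]_p => z.1 + z.2) @` (K `*` [set v | `|v| <= e])).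
split => //.
- apply: continuous_compact; last by apply: compact_setX => //; exact: compact_normr_le.
  by apply: continuous_subspaceT; exact: add_continuous.
- by move=> _ [[k v] [/= Kk ve] <-]; apply: (He k Kk); rewrite addrC addKr.
- by move=> k y Kk ye; exists (k, y - k) => //=; rewrite addrC subrK.
Unshelve. all: by end_near. Qed.

End extension_by_zero.

Section mollifier.
Context {R : realType}.

(** The profile of the mollifier. *)
Definition tent {p} (t : 'rV[R]_p) : R := Num.max 0 (1 - `|t|).

Lemma tent_ge0 {p} (t : 'rV[R]_p) : 0 <= tent t.
Proof. by rewrite le_max lexx. Qed.

Lemma tent_le1 {p} (t : 'rV[R]_p) : tent t <= 1.
Proof. by rewrite ge_max ler01 lerBlDr lerDl normr_ge0. Qed.

Lemma tent_eq0 {p} (t : 'rV[R]_p) : 1 <= `|t| -> tent t = 0.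
Proof. by move=> t1; rewrite /tent max_l// subr_le0. Qed.

Lemma tentN {p} (t : 'rV[R]_p) : tent (- t) = tent t.
Proof. by rewrite /tent normrN. Qed.

Lemma continuous_max0 {T : topologicalType} (a : T -> R) :
  continuous a -> continuous (fun s => Num.max 0 (a s)).
Proof.
move=> ca t.
have H : (a s + `|a s|) / 2 @[s --> t] --> (a t + `|a t|) / 2.
  apply: cvgM; last exact: cvg_cst.
  by apply: cvgD; [exact: ca|apply: cvg_norm; exact: ca].
have E (x : R) : (x + `|x|) / 2 = Num.max 0 x.
  have [h|h] := leP 0 x; first by rewrite ger0_norm//; lra.
  by rewrite ltr0_norm// subrr mul0r.
rewrite /continuous_at -E; apply: cvg_trans H; apply: near_eq_cvg.
by apply: nearW => s; rewrite E.
Qed.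

Lemma continuous_tent {p} : continuous (@tent p).
Proof.
apply: continuous_max0 => t.
by apply: (@cvgB R R^o _ (nbhs t)); [exact: cvg_cst|exact: norm_continuous].
Qed.

Lemma Cc_tent {p} : Cc (@tent p).
Proof.
split; first exact: continuous_tent.
by exists 1 => t /ltW; exact: tent_eq0.
Qed.

Lemma Int_tent_gt0 {p} : 0 < Int (@tent p).
Proof.
have h0 : 0 <= (2^-1 : R) by rewrite invr_ge0.
have E := @bsupp_Rintegral_dom _ _ _ (@lebesgue_tuple R p) _ (measurable_box 2^-1) (box_lty h0) 2^-1.
have I1 := @bsupp_dom_integrable _ _ _ (@lebesgue_tuple R p) _ (measurable_box 2^-1) (box_lty h0) 2^-1.
apply: (@lt_le_trans _ _ (2^-1 * fine (lebesgue_tuple (@box R p 2^-1)))).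
  by rewrite lebesgue_tuple_box//= mulr_gt0 ?invr_gt0// exprn_gt0//.
rewrite -E; apply: le_Rintegral => //; first exact: (Int_integrable Cc_tent).
move=> t _; rewrite indicE; case: (boolP (t \in box 2^-1)) => [|_]; last first.
  by rewrite mulr0 tent_ge0.
rewrite inE mulr1 => /(boxE t h0) th.
by rewrite le_max; apply/orP; right; lra.
Qed.

End mollifier.

Section rescaling.
Context {R : realType} {p : nat}.
Implicit Types (Om : set 'rV[R]_p) (Xi Th : 'rV[R]_p -> 'rV[R]_p).

Lemma Int_center (G : 'rV[R]_p -> R) (b : 'rV[R]_p) (e : R) : Cc G -> e != 0 ->
  `|e ^+ p| * Int (fun t => G (e *: t + b)) = Int G.
Proof.
move=> CG e0; have u : (e%:M : 'M[R]_p) \in unitmx.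
  by rewrite unitmxE det_scalar unitfE expf_neq0.
rewrite -(Int_shift b CG) -(det_change_unit u (Cc_shift b CG)) det_scalar.
apply: (congr1 (fun z => `|e ^+ p| * z)); apply: Int_ext => t.
by rewrite mul_mx_scalar.
Qed.

Lemma jac_bound Om Xi (K : set 'rV[R]_p) : open Om -> smooth_on Om Xi ->
  compact K -> K `<=` Om -> exists2 L, 0 <= L &
    forall x v, K x -> `|'D_v Xi x| <= L * `|v|.
Proof.
move=> oO sX cK KO.
pose S x := \sum_i \sum_j `|jac Xi x i j|.
have [L L0 LP] : exists2 L, 0 <= L & forall x, K x -> `|S x| <= L.
  apply: (compact_bound cK); apply: continuous_in_subspaceT => x /set_mem /KO Ox.
  apply: (@cvg_fsum R _ (nbhs x)) => i; apply: (@cvg_fsum R _ (nbhs x)) => j.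
  have H : 'D_(delta_mx 0 i) (fun y => Xi y 0 j) y @[y --> x] -->
      'D_(delta_mx 0 i) (fun y => Xi y 0 j) x.
    exact: (smooth_cont (smooth_derive _ (smooth_coord 0 j oO sX)) Ox).
  rewrite (_ : (fun y => `|jac Xi y i j|) =
      (fun y => `|'D_(delta_mx 0 i) (fun y => Xi y 0 j) y|)); last first.
    by apply/funext => y; rewrite mxE.
  by rewrite mxE; exact: cvg_norm H.
exists L => // x v Kx; rewrite (derive_jac v oO sX (KO _ Kx)).
apply: normr_row_le => [|j]; first exact: mulr_ge0.
apply: (@le_trans _ _ (S x * `|v|)); last first.
  by rewrite ler_wpM2r// (le_trans (ler_norm _))// LP.
rewrite mxE (le_trans (ler_norm_sum _ _ _))// mulr_suml ler_sum// => i _.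
rewrite normrM mulrC ler_pM// ?normr_coord//.
by rewrite (bigD1 j)//= lerDl sumr_ge0.
Qed.

(** Coordinatewise, as the mean value theorem concerns scalar functions. *)
Lemma lipschitz_segment Om Xi x h L : smooth_on Om Xi -> open Om ->
  (forall c : R, `|c| <= 1 -> Om (x + c *: h) /\ `|'D_h Xi (x + c *: h)| <= L) ->
  0 <= L -> `|Xi (x + h) - Xi x| <= L.
Proof.
move=> sX oO H L0; apply: normr_row_le => // j; rewrite !mxE.
have sXj := smooth_coord 0 j oO sX.
have [|c] := @mean_value_line R _ (fun y => Xi y 0 j) x h 1.
  by move=> c; rewrite normr1 => /H[Oc _]; exact: (smooth_derivable sXj Oc h).
rewrite normr1 scale1r mul1r => /H[Oc Lc] ->.
apply: le_trans Lc; have := normr_coord ('D_h Xi (x + c *: h)) j.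
by rewrite (derive_mx (smooth_derivable sX Oc h)) mxE.
Qed.

End rescaling.

(** * Change of variables under diffeomorphisms *)

Lemma continuous_scaleB_at {R : realType} {V W : normedModType R} (a b : V -> W)
    (c : R) x : {for x, continuous a} -> {for x, continuous b} ->
  {for x, continuous (fun y => c *: (a y - b y))}.
Proof.
move=> ca cb.
have H : c *: (a y - b y) @[y --> x] --> c *: (a x - b x).
  by apply: cvgZ; [exact: cvg_cst|exact: (cvgB ca cb)].
exact: H.
Qed.

Lemma continuous_scaler {R : realType} {V : normedModType R} (c : R) (a : V -> R) :
  continuous a -> continuous (fun y => c * a y).
Proof. by move=> ca y; apply: continuousM_fun; [exact: cst_continuous|exact: ca]. Qed.

Lemma Int0 {R : realType} {p} : Int (fun _ : 'rV[R]_p => 0) = 0.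
Proof. by rewrite /Int /Rintegral integral0. Qed.

Arguments continuous_scaleB_at {R V W a b} c {x}.

Section change_of_variables.
Context {R : realType} {p : nat}.
Variables (Om Om' : set 'rV[R]_p) (Xi Th : 'rV[R]_p -> 'rV[R]_p).
Hypotheses (oO : open Om) (oO' : open Om')
  (sX : smooth_on Om Xi) (sT : smooth_on Om' Th)
  (XO : forall x, Om x -> Om' (Xi x)) (TO : forall y, Om' y -> Om (Th y))
  (TX : forall x, Om x -> Th (Xi x) = x) (XT : forall y, Om' y -> Xi (Th y) = y).
Variables (f : 'rV[R]_p -> R) (K : set 'rV[R]_p).
Hypotheses (Cf : Cc f) (cK : compact K) (KO : K `<=` Om')
  (f0 : forall y, ~ K y -> f y = 0).

Let J := absdet_jac Xi.
Let uX x (Ox : Om x) := jac_unit oO oO' sX sT XO TX Ox.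
Let sJ : smooth_on Om J := smooth_absdet_jac oO sX uX.
Let h := (fun x => f (Xi x) * J x) \_ Om.

Let cTon A : A `<=` Om' -> {within A, continuous Th}.
Proof.
move=> AO; apply: continuous_in_subspaceT => y /set_mem /AO Oy.
exact: (smooth_cont sT Oy).
Qed.

Let cXi x : Om x -> {for x, continuous Xi}.
Proof. by move=> Ox; exact: (smooth_cont sX Ox). Qed.

Let cJ x : Om x -> {for x, continuous J}.
Proof. by move=> Ox; exact: (smooth_cont sJ Ox). Qed.

Let image_compact A : compact A -> A `<=` Om' -> compact (Th @` A).
Proof. by move=> cA AO; apply: continuous_compact => //; exact: cTon. Qed.

Let image_sub A : A `<=` Om' -> Th @` A `<=` Om.
Proof. by move=> AO _ [y Ay <-]; apply: TO; exact: AO. Qed.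

Lemma change_of_variables_Cc : Cc h.
Proof.
apply: (Cc_ext0 (K := Th @` K)) => //.
- exact: image_compact.
- exact: image_sub.
- move=> x Ox; apply: (@continuousM_fun R 'rV[R]_p (fun x => f (Xi x)) J); last exact: cJ.
  apply: (@continuous_comp _ _ _ Xi f); first exact: cXi.
  by have [cf _] := Cf; exact: cf.
- move=> x Ox nK; rewrite f0 ?mul0r// => KX; apply: nK.
  by exists (Xi x) => //; exact: TX.
Qed.

(** Integrate [f y * tent ((Xi x - y) / eps) * J x] over both variables and let
    [eps] tend to 0.  If [y] is integrated first, rescaling around [Xi x] gives a
    multiple of [h] in the limit.  If [x] is integrated first, rescaling around
    [Th y] replaces [Xi] by its linearization at [Th y], and the linear change of
    variables by [jac Xi (Th y)] absorbs the factor [J (Th y)].  Both limits carry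
    the same factor [Int tent], which is positive. *)
Lemma change_of_variables : Int h = Int f.
Proof.
have [cf _] := Cf.
have [Mf [rf [Mf0 rf0 fM _]]] := Cc_bound Cf.
have [e0 [K' [e0_gt0 cK' KO' KK']]] := compact_thicken oO' cK KO.
have KK'' k : K k -> K' k.
  by move=> Kk; apply: (KK' k) => //; rewrite subrr normr0 ltW.
pose K2 := Th @` K'.
have cK2 : compact K2 by exact: image_compact.
have K2O : K2 `<=` Om by exact: image_sub.
have [MJ MJ0 JM] : exists2 M, 0 <= M & forall x, K2 x -> `|J x| <= M.
  apply: (compact_bound cK2); apply: continuous_in_subspaceT => x /set_mem /K2O.
  exact: cJ.
have [L L0 LT] := jac_bound oO' sT cK' KO'.
have lipT y v : K y -> `|v| <= e0 -> `|Th (y + v) - Th y| <= L * `|v|.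
  move=> Ky ve; apply: (lipschitz_segment sT oO'); last exact: mulr_ge0.
  move=> c c1.
  have Kc : K' (y + c *: v).
    apply: (KK' y) => //; rewrite addrC addKr normrZ (le_trans _ ve)//.
    by rewrite ler_piMl.
  by split; [exact: KO'|exact: LT].
(* Below [e0], the kernel around a point of [K] does not leave [K']. *)
pose eps (n : nat) := e0 / n.+1%:R.
have eps_gt0 n : 0 < eps n by rewrite divr_gt0.
have eps_le n : eps n <= e0.
  by rewrite ler_pdivrMr// ler_pMr// ler1n.
have eps0 : eps n @[n --> \oo] --> 0.
  have : e0 * n.+1%:R^-1 @[n --> \oo] --> e0 * 0.
    by apply: cvgM; [exact: cvg_cst|exact: cvg_harmonic].
  by rewrite mulr0.
pose Q n (z : 'rV[R]_p * 'rV[R]_p) : R :=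
  f z.2 * tent ((eps n)^-1 *: (Xi z.1 - z.2)) * J z.1.
pose F n x y := (Q n \_ (Om `*` setT)) (x, y).
have FE n x y : Om x -> F n x y = Q n (x, y).
  by move=> Ox; rewrite /F patchE mem_set.
have F0 n x y : ~ Om x -> F n x y = 0.
  by move=> Ox; rewrite /F patchE memNset// => -[].
have Qsupp n x y : Om x -> Q n (x, y) != 0 -> K y /\ `|Xi x - y| < eps n.
  move=> Ox; rewrite /Q/= => Q0; split.
    by apply: contrapT => /f0 fy; rewrite fy !mul0r eqxx in Q0.
  rewrite ltNge; apply/negP => H; move: Q0; rewrite tent_eq0 ?mulr0 ?mul0r ?eqxx//.
  by rewrite normrZ gtr0_norm ?invr_gt0// mulrC ler_pdivlMr ?mul1r.
have Fsupp n x y : F n x y != 0 -> [/\ K2 x, K y, Om x & `|Xi x - y| < eps n].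
  have [Ox|/F0 ->] := pselect (Om x); last by rewrite eqxx.
  rewrite FE// => /Qsupp[]// Ky xy; split => //.
  exists (Xi x); last exact: TX.
  by apply: (KK' y) => //; rewrite (le_trans (ltW xy)).
have FM n x y : `|F n x y| <= Mf * MJ.
  have [->|Fn0] := eqVneq (F n x y) 0; first by rewrite normr0 mulr_ge0.
  have [K2x Ky Ox _] := Fsupp _ _ _ Fn0.
  rewrite FE// /Q/= !normrM; apply: ler_pM => //; last exact: JM.
  rewrite -[leRHS]mulr1; apply: ler_pM => //.
  by rewrite ger0_norm ?tent_ge0// tent_le1.
have CF n : Cc2 (F n).
  split.
    have cQ : continuous (Q n \_ (Om `*` setT)).
      apply: (@continuous_ext0 _ _ _ (K2 `*` K)).
      - rewrite openE => -[x y] [/= Ox _].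
        exists (Om, setT) => /=; last by move=> [a b].
        by split; [exact: open_nbhs_nbhs|exact: filterT].
      - by apply: compact_closed; [exact: norm_hausdorff|exact: compact_setX].
      - by move=> [x y] [/= /K2O Ox _].
      - move=> [x y] [/= Ox _].
        have c1 : {for (x, y), continuous (fun z : 'rV[R]_p * 'rV[R]_p => z.1)} by exact: cvg_fst.
        have c2 : {for (x, y), continuous (fun z : 'rV[R]_p * 'rV[R]_p => z.2)} by exact: cvg_snd.
        apply: (@continuousM_fun R ('rV[R]_p * 'rV[R]_p)%type (fun z => f z.2 * tent ((eps n)^-1 *: (Xi z.1 - z.2)))
          (fun z => J z.1)); last first.
          exact: (@continuous_comp _ _ _ (fun z : 'rV[R]_p * 'rV[R]_p => z.1) J _ c1 (cJ Ox)).
        apply: (@continuousM_fun R ('rV[R]_p * 'rV[R]_p)%type (fun z => f z.2)).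
          exact: (@continuous_comp _ _ _ (fun z : 'rV[R]_p * 'rV[R]_p => z.2) f _ c2 (cf y)).
        have cX := @continuous_comp _ _ _ (fun z : 'rV[R]_p * 'rV[R]_p => z.1) Xi (x, y) c1 (cXi Ox).
        have cB := continuous_scaleB_at (eps n)^-1 cX c2.
        exact: (@continuous_comp _ _ _ (fun z : 'rV[R]_p * 'rV[R]_p =>
          (eps n)^-1 *: (Xi z.1 - z.2)) tent (x, y) cB (@continuous_tent _ _ _)).
      - move=> [x y] [/= Ox _] nK; apply/eqP; apply: contraPT nK => /=.
        rewrite -FE// => /Fsupp[K2x Ky _ _]; exact.
    by move=> [x y]; exact: cQ.
  have [r1 [_ H1]] := compact_bounded cK2; have [r2 [_ H2]] := compact_bounded cK.
  exists (`|r1| + `|r2| + 1) => x y; apply: contraTeq => /Fsupp[K2x Ky _ _].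
  rewrite negb_or -!leNgt; apply/andP; split.
    by apply: (H1 (`|r1| + `|r2| + 1)) => //; rewrite ltr_pwDr// (le_trans (ler_norm _))// lerDl.
  by apply: (H2 (`|r1| + `|r2| + 1)) => //; rewrite ltr_pwDr// (le_trans (ler_norm _))// lerDr.
have en0 n : eps n != 0 by rewrite gt_eqF.
have epu n : ((eps n)%:M : 'M[R]_p) \in unitmx.
  by rewrite unitmxE det_scalar unitfE expf_neq0.
pose ep n := `|eps n ^+ p|^-1.
have epI n (G : 'rV[R]_p -> R) b : Cc G ->
    ep n * Int G = Int (fun t => G (eps n *: t + b)).
  move=> CG; rewrite -(Int_center b CG (en0 n)) mulKf// normr_eq0.
  by rewrite expf_neq0.
(* The inner integrals in [y] and in [x], divided by the volume scale of the kernel. *)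
pose A n x := ep n * Int (F n x).
pose B n y := ep n * Int (F n ^~ y).
have CA n : Cc (fun x => Int (F n x)) by exact: Cc_Int.
have CF' n : Cc2 (fun y x => F n x y).
  have [cFn [r Fr]] := CF n; split; last by exists r => y x; rewrite orbC; exact: Fr.
  move=> [y x].
  have cs : {for (y, x), continuous (fun z : 'rV[R]_p * 'rV[R]_p => (z.2, z.1))}.
    by apply: continuous_pair_at; [exact: cvg_snd|exact: cvg_fst].
  exact: (@continuous_comp _ _ _ (fun z : 'rV[R]_p * 'rV[R]_p => (z.2, z.1))
    (fun z : 'rV[R]_p * 'rV[R]_p => F n z.1 z.2) (y, x) cs (cFn _)).
have CB n : Cc (fun y => Int (F n ^~ y)) by exact: (Cc_Int (CF' n)).
have AB n : Int (A n) = Int (B n).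
  have E1 := IntZ (ep n) (CA n); have E2 := IntZ (ep n) (CB n).
  rewrite [LHS]E1 [RHS]E2; apply: (congr1 (fun z => ep n * z)).
  exact: (Int_swap (CF n)).
have [rK [rK0 HK]] : exists r, 0 <= r /\ forall x y, K2 x -> K y -> `|x| <= r /\ `|y| <= r.
  have [r1 [_ H1]] := compact_bounded cK2; have [r2 [_ H2]] := compact_bounded cK.
  exists (`|r1| + `|r2| + 1); split; first by rewrite !addr_ge0.
  move=> x y K2x Ky; split.
    by apply: (H1 (`|r1| + `|r2| + 1)) => //; rewrite ltr_pwDr// (le_trans (ler_norm _))// lerDl.
  by apply: (H2 (`|r1| + `|r2| + 1)) => //; rewrite ltr_pwDr// (le_trans (ler_norm _))// lerDr.
have AE n x : A n x = Int (fun t => F n x (eps n *: t + Xi x)).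
  by rewrite /A (epI n _ (Xi x) (Cc2_section x (CF n))).
have BE n y : B n y = Int (fun t => F n (eps n *: t + Th y) y).
  by rewrite /B (epI n _ (Th y) (Cc2_section_l y (CF n))).
have cA' n x : continuous (fun t : 'rV[R]_p => F n x (eps n *: t + Xi x)).
  have [H _] := Cc_affine (Xi x) (epu n) (Cc2_section x (CF n)).
  by under eq_fun do rewrite -mul_mx_scalar.
have cB' n y : continuous (fun t : 'rV[R]_p => F n (eps n *: t + Th y) y).
  have [H _] := Cc_affine (Th y) (epu n) (Cc2_section_l y (CF n)).
  by under eq_fun do rewrite -mul_mx_scalar.
have A0 n x t : 1 < `|t| -> F n x (eps n *: t + Xi x) = 0.
  apply: contraTeq => /Fsupp[_ _ _]; rewrite opprD addrCA subrr addr0 normrN normrZ.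
  by rewrite gtr0_norm// gtr_pMr// -leNgt => /ltW.
(* By the Lipschitz bound on [Th], the rescaled kernel has support in a fixed ball. *)
have B0 n y t : L < `|t| -> F n (eps n *: t + Th y) y = 0.
  apply: contraTeq => /Fsupp[_ Ky]; set x := _ + _ => Ox xy.
  have := lipT y (Xi x - y) Ky; rewrite [y + _]addrC subrK TX// => H.
  have {}H := H (le_trans (ltW xy) (eps_le n)).
  have E : x - Th y = eps n *: t by rewrite /x addrK.
  rewrite -leNgt -(ler_pM2l (eps_gt0 n)) -[X in X * `|t|](gtr0_norm (eps_gt0 n)) -normrZ -E.
  by rewrite (le_trans H)// mulrC ler_wpM2r// ltW.
have epsx (t b : 'rV[R]_p) : eps n *: t + b @[n --> \oo] --> b.
  have : eps n *: t + b @[n --> \oo] --> (0 : R) *: t + b.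
    apply: cvgD; last exact: cvg_cst.
    by apply: cvgZ; [exact: eps0|exact: cvg_cst].
  by rewrite scale0r add0r.
have Az n x : (forall y, F n x y = 0) -> A n x = 0.
  move=> Fz; have E : Int (F n x) = 0 by rewrite -[RHS](@Int0 R p); exact: Int_ext.
  by rewrite /A E mulr0.
have limA x : A n x @[n --> \oo] --> Int (@tent R p) * h x.
  have [Ox|nOx] := pselect (Om x); last first.
    rewrite /h patchE memNset// mulr0.
    rewrite (_ : (fun n => A n x) = (fun=> 0)); first exact: cvg_cst.
    by apply/funext => n; apply: Az => y; rewrite F0.
  have -> : Int (@tent R p) * h x = Int (fun t : 'rV[R]_p => (f (Xi x) * J x) * tent t).
    by rewrite (IntZ _ Cc_tent) /h patchE mem_set// mulrC.
  rewrite (_ : (fun n => A n x) = (fun n => Int (fun t => F n x (eps n *: t + Xi x)))).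
    apply: (@Int_dct R p (fun n t => F n x (eps n *: t + Xi x)) _ (Mf * MJ) 1
      ler01 (fun n => @cA' n x) (fun n t => FM n _ _) (fun n => A0 n x)) => t.
    rewrite (_ : (fun n => _) = (fun n => f (eps n *: t + Xi x) * tent t * J x)); last first.
      apply/funext => n; rewrite FE// /Q/= opprD addrCA subrr addr0 scalerN scalerA.
      by rewrite mulVf// scale1r tentN.
    rewrite -mulrA [J x * _]mulrC mulrA; apply: cvgM; last exact: cvg_cst.
    apply: cvgM; last exact: cvg_cst.
    exact: (@cvg_comp _ _ _ (fun n => eps n *: t + Xi x) f _ _ _ (epsx t (Xi x)) (cf _)).
  by apply/funext => n; rewrite AE.
have Bz n y : (forall x, F n x y = 0) -> B n y = 0.
  move=> Fz; have E : Int (F n ^~ y) = 0 by rewrite -[RHS](@Int0 R p); exact: Int_ext.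
  by rewrite /B E mulr0.
have eps0' : eps n @[n --> \oo] --> (0 : R)^'.
  move=> P P0.
  have H : \forall n \near \oo, eps n != 0 -> P (eps n) by exact: (eps0 _ P0).
  have H' : \forall n \near \oo, P (eps n) by apply: filterS H => n; apply; exact: en0.
  exact: H'.
have limB y : B n y @[n --> \oo] --> Int (@tent R p) * f y.
  have [Ky|nKy] := pselect (K y); last first.
    rewrite (f0 nKy) mulr0.
    have Bc : (fun n => B n y) = (fun=> 0 : R) by apply/funext => n; apply: Bz => x; apply/eqP;
      apply: contraPT nKy => /Fsupp[_ Ky _ _]; exact.
    by rewrite Bc; exact: cvg_cst.
  have Oy : Om (Th y) by exact/TO/KO.
  have XTy : Xi (Th y) = y by exact/XT/KO.
  pose g t := f y * J (Th y) * tent (t *m jac Xi (Th y)).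
  have Ctent : Cc (fun t => tent (t *m jac Xi (Th y))).
    by apply: Cc_mulmx; [exact: uX|exact: Cc_tent].
  have -> : Int (@tent R p) * f y = Int g.
    rewrite /g (IntZ _ Ctent) -(det_change_unit (uX Oy) (@Cc_tent R p)).
    by rewrite /J /absdet_jac mulrC mulrA.
  rewrite (_ : (fun n => B n y) = (fun n => Int (fun t => F n (eps n *: t + Th y) y))); last first.
    by apply/funext => n; rewrite BE.
  apply: (@Int_dct R p (fun n t => F n (eps n *: t + Th y) y) _ (Mf * MJ) L
    L0 (fun n => @cB' n y) (fun n t => FM n _ _) (fun n => B0 n y)) => t.
  have nearO : \forall n \near \oo, Om (eps n *: t + Th y).
    by apply: (epsx t (Th y)); exact: open_nbhs_nbhs.
  have D : (eps n)^-1 *: (Xi (eps n *: t + Th y) - y) @[n --> \oo] --> t *m jac Xi (Th y).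
    have d0 : h^-1 *: (Xi (h *: t + Th y) - Xi (Th y)) @[h --> 0^'] --> t *m jac Xi (Th y).
      by rewrite -(derive_jac t oO sX Oy); exact: (smooth_derivable sX Oy t).
    have := @cvg_comp _ _ _ eps (fun h => h^-1 *: (Xi (h *: t + Th y) - Xi (Th y))) _ _ _ eps0' d0.
    by rewrite XTy.
  have D2 := @cvg_comp _ _ _ (fun n => (eps n)^-1 *: (Xi (eps n *: t + Th y) - y)) tent _ _ _ D (@continuous_tent _ _ _).
  have D3 := @cvg_comp _ _ _ (fun n => eps n *: t + Th y) J _ _ _ (epsx t (Th y)) (cJ Oy).
  have main : f y * tent ((eps n)^-1 *: (Xi (eps n *: t + Th y) - y)) *
      J (eps n *: t + Th y) @[n --> \oo] --> f y * tent (t *m jac Xi (Th y)) * J (Th y).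
    by apply: cvgM; [apply: cvgM; [exact: cvg_cst|exact: D2]|exact: D3].
  rewrite /g -mulrA [J _ * _]mulrC mulrA; apply: cvg_trans main; apply: near_eq_cvg.
  by apply: filterS nearO => n On; rewrite FE.
have Abound n x : `|A n x| <= Mf * MJ * (1 *+ 2) ^+ p.
  by rewrite AE; apply: Int_le => //; [exact: mulr_ge0|exact: A0].
have Bbound n y : `|B n y| <= Mf * MJ * (L *+ 2) ^+ p.
  by rewrite BE; apply: Int_le => //; [exact: mulr_ge0|exact: B0].
have Asupp n x : rK < `|x| -> A n x = 0.
  move=> xr; apply: Az => y; apply/eqP; apply: contraTT xr => /Fsupp[K2x Ky _ _].
  by rewrite -leNgt; have [] := HK _ _ K2x Ky.
have Bsupp n y : rK < `|y| -> B n y = 0.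
  move=> yr; apply: Bz => x; apply/eqP; apply: contraTT yr => /Fsupp[K2x Ky _ _].
  by rewrite -leNgt; have [] := HK _ _ K2x Ky.
have IA : Int (A n) @[n --> \oo] --> Int (@tent R p) * Int h.
  rewrite -(IntZ _ change_of_variables_Cc).
  apply: (@Int_dct R p A _ _ rK rK0 _ Abound Asupp limA) => n.
  have [c _] := CA n; exact: continuous_scaler.
have IB : Int (B n) @[n --> \oo] --> Int (@tent R p) * Int f.
  rewrite -(IntZ _ Cf).
  apply: (@Int_dct R p B _ _ rK rK0 _ Bbound Bsupp limB) => n.
  have [c _] := CB n; exact: continuous_scaler.
have : Int (@tent R p) * Int h = Int (@tent R p) * Int f.
  have ABf : (fun n => Int (A n)) = (fun n => Int (B n)) by apply/funext.
  rewrite ABf in IA; exact: (cvg_unique _ IA IB).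
by apply: mulfI; rewrite gt_eqF// Int_tent_gt0.
Qed.

End change_of_variables.

(** * Prolongation to jets *)

Section prolongation.
Context {R : realType} {p q n : nat}.
Notation X := 'rV[R]_p.
Notation U := 'rV[R]_q.
Notation N := (jet_dim p q n).

Lemma jet_x_prolong (f : X -> U) x : jet_x (prolong (n := n) f x) = x.
Proof. by rewrite /jet_x /prolong row_mxKl. Qed.

Lemma jet_un_prolong (f : X -> U) x (k : 'I_N) :
  jet_un (prolong f x) 0 k = partials (jet_mi k) (fun y => f y 0 (jet_dep k)) x.
Proof. by rewrite /jet_un /prolong row_mxKr mxE. Qed.

Lemma partials_mi0 (al : 'I_p -> nat) (f : X -> R) : (forall i, al i = 0%N) ->
  partials al f = f.
Proof.
move=> al0; rewrite partials_word (_ : mi_word al = [::])//.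
by rewrite /mi_word; elim: (enum _) => [//|i r ih] /=; rewrite al0 ih.
Qed.

Lemma jet_u_prolong (f : X -> U) x : jet_u (prolong (n := n) f x) = f x.
Proof.
apply/rowP => a; rewrite mxE jet_un_prolong partials_mi0.
  by rewrite /jet_dep enum_rankK.
by move=> i; rewrite /jet_mi enum_rankK/= ffunE.
Qed.

Lemma jet_coordinate (b : 'I_q) (al : 'I_p -> nat) : (order_mi al <= n)%N ->
  exists k : 'I_N, jet_dep k = b /\ jet_mi k = al.
Proof.
move=> aln.
have ali i : (al i < n.+1)%N.
  by rewrite ltnS (leq_trans _ aln)// /order_mi (bigD1 i)//= leq_addr.
pose J : {ffun 'I_p -> 'I_n.+1} := [ffun i => Ordinal (ali i)].
have HJ : (\sum_(i < p) (b, J).2 i <= n)%N.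
  by rewrite /=; under eq_bigr do rewrite ffunE.
exists (enum_rank (exist _ (b, J) HJ : jet_index p q n)); split.
  by rewrite /jet_dep enum_rankK.
by apply/funext => i; rewrite /jet_mi enum_rankK/= ffunE.
Qed.

Lemma smooth_sum_Forallp {T} A (L : seq T) (F : T -> X -> R) : open A ->
  Forallp (fun l => smooth_on A (F l)) L -> smooth_on A (fun y => \sum_(l <- L) F l y).
Proof.
move=> oA; elim: L => [_|l L ih [sl /ih sL]].
  by under eq_fun do rewrite big_nil; exact: smooth_cst.
under eq_fun do rewrite big_cons.
exact: smooth_add.
Qed.

(** By [pullback_partials], since the transformed function is a sum of weighted
    pullbacks.  The coefficients serve all functions at once, so the transforms of
    two functions can be compared. *)
Lemma prolong_affine (A : set X) (Th : X -> X) (Ph : X -> 'M[R]_q) (Ps : X -> U) :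
  open A -> smooth_on A Th -> (forall a b, smooth_on A (fun y => Ph y a b)) ->
  (forall a, smooth_on A (fun y => Ps y 0 a)) ->
  exists (Lm : 'I_N -> 'I_N -> X -> R) (Cm : 'I_N -> X -> R),
    (forall k k', smooth_on A (Lm k k')) /\
    forall (B : set X) (f : X -> U), open B ->
      (forall b, smooth_on B (fun x => f x 0 b)) ->
      forall y, A y -> B (Th y) -> forall k,
      jet_un (prolong (fun y => f (Th y) *m (Ph y)^T + Ps y) y) 0 k =
      \sum_k' Lm k k' y * jet_un (prolong f (Th y)) 0 k' + Cm k y.
Proof.
move=> oA sT sPh sPs.
(* A dependent variable and a multi-index read as a jet coordinate. *)
have [idx idxP] : exists idx : 'I_q * ('I_p -> nat) -> 'I_N,
    forall b al, (order_mi al <= n)%N ->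
    jet_dep (idx (b, al)) = b /\ jet_mi (idx (b, al)) = al.
  have : forall z : 'I_q * ('I_p -> nat), exists k : 'I_N, (order_mi z.2 <= n)%N ->
      jet_dep k = z.1 /\ jet_mi k = z.2.
    move=> [b al] /=; have [aln|_] := leqP (order_mi al) n.
      by have [k Hk] := jet_coordinate b aln; exists k.
    by exists (enum_rank (@jet_index0 p q n b)).
  move=> /choice[idx H]; exists idx => b al; exact: (H (b, al)).
have H (z : 'I_N * 'I_q) : exists L : seq ((X -> R) * ('I_p -> nat)),
    Forallp (fun l => smooth_on A l.1 /\ (order_mi l.2 <= n)%N) L /\
    forall B (v : X -> R), open B -> smooth_on B v -> forall y, A y -> B (Th y) ->
      partials (jet_mi z.1) (fun y => Ph y (jet_dep z.1) z.2 * v (Th y)) y =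
      \sum_(l <- L) l.1 y * partials l.2 v (Th y).
  have [L LA LE] := pullback_partials (jet_mi z.1) oA sT (sPh (jet_dep z.1) z.2).
  exists L; split; last exact: LE.
  apply: Forallp_sub LA => l [sl ll]; split; first exact: sl.
  by rewrite (leq_trans ll)// /order_mi; exact: (valP (enum_val z.1)).
have [L LP] := choice H.
pose Lm (k k' : 'I_N) y :=
  \sum_(b < q) \sum_(l <- L (k, b)) (idx (b, l.2) == k')%:R * l.1 y.
pose Cm (k : 'I_N) y := partials (jet_mi k) (fun y => Ps y 0 (jet_dep k)) y.
exists Lm, Cm; split.
  move=> k k'; apply: smooth_sum; first exact: oA.
  move=> b; apply: smooth_sum_Forallp; first exact: oA.
  apply: Forallp_sub (LP (k, b)).1 => l [sl _].
  by apply: smooth_mul; [exact: oA|exact: smooth_cst|exact: sl].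
move=> B f oB sf y Ay By k.
have oAB := open_preimage_on oA oB sT.
have sAB : smooth_on (A `&` Th @^-1` B) Th by apply: smooth_onS sT => z [].
have sfT b : smooth_on (A `&` Th @^-1` B) (fun y => f (Th y) 0 b).
  apply: (smooth_comp (f := fun x => f x 0 b) oAB oB _ sAB (sf b)).
  by move=> z [].
have sPf b : smooth_on (A `&` Th @^-1` B) (fun y => Ph y (jet_dep k) b * f (Th y) 0 b).
  apply: smooth_mul; [exact: oAB| |exact: sfT].
  by apply: smooth_onS (sPh (jet_dep k) b) => z [].
have sPs' : smooth_on (A `&` Th @^-1` B) (fun y => Ps y 0 (jet_dep k)).
  by apply: smooth_onS (sPs (jet_dep k)) => z [].
rewrite jet_un_prolong.
rewrite (_ : (fun y => _) = (fun y => \sum_(b < q) Ph y (jet_dep k) b * f (Th y) 0 b +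
  Ps y 0 (jet_dep k))); last first.
  apply/funext => z; rewrite !mxE; congr (_ + _).
  by apply: eq_bigr => b _; rewrite mxE mulrC.
have sS : smooth_on (A `&` Th @^-1` B)
    (fun y => \sum_(b < q) Ph y (jet_dep k) b * f (Th y) 0 b).
  by apply: smooth_sum; [exact: oAB|exact: sPf].
rewrite (partials_add (jet_mi k) oAB sS sPs' (conj Ay By)); congr (_ + _).
rewrite (partials_sum (jet_mi k) _ oAB sPf (conj Ay By)).
transitivity (\sum_(b < q) \sum_(l <- L (k, b))
    l.1 y * jet_un (prolong f (Th y)) 0 (idx (b, l.2))).
  apply: eq_bigr => b _.
  rewrite ((LP (k, b)).2 B (fun x => f x 0 b) oB (sf b) y Ay By).
  elim: (L (k, b)) (LP (k, b)).1 => [|l s ih] /=; first by rewrite !big_nil.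
  move=> [[_ ll] /ih E]; rewrite !big_cons E; congr (_ * _ + _).
  by rewrite jet_un_prolong; have [-> ->] := idxP b l.2 ll.
rewrite /Lm; under [RHS]eq_bigr do rewrite mulr_suml.
rewrite exchange_big/=; apply: eq_bigr => b _.
under [RHS]eq_bigr do rewrite mulr_suml.
rewrite exchange_big/=; apply: eq_bigr => l _.
rewrite (bigD1 (idx (b, l.2)))//= eqxx mul1r big1 ?addr0// => k' /negbTE.
by rewrite eq_sym => ->; rewrite !mul0r.
Qed.

End prolongation.

(** * Groups acting linearly in the dependent variables *)

Section group_element.
Context {R : realType} {p q : nat}.
Notation X := 'rV[R]_p.
Notation U := 'rV[R]_q.
Variables (M : set (X * U)) (W : set (R * (X * U))) (g : R -> X * U -> X * U)
  (Xi : R -> X -> X) (Phi : R -> X -> 'M[R]_q) (Psi : R -> X -> U).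
Hypotheses (hloc : local_transformation_group M W g)
  (hlin : acts_linearly W g Xi Phi Psi).

Let oW : open W. Proof. by have [[]] := hloc. Qed.

Let WM eta z : W (eta, z) -> M z /\ M (g eta z).
Proof. by have [[_ H _] _ _ _] := hloc; exact: H. Qed.

Let sg : smooth_on W (fun ez => g ez.1 ez.2).
Proof. by have [[]] := hloc. Qed.

Let ginv eta z : W (eta, z) -> W (- eta, g eta z) /\ g (- eta) (g eta z) = z.
Proof. by have [_ _ _ H] := hloc; exact: H. Qed.

Let slice (eta : R) (u : U) (x : X) : R * (X * U) := (eta, (x, u)).

Let continuous_slice eta u : continuous (slice eta u).
Proof.
move=> x; apply: (@continuous_pair_at _ _ _ (fun=> eta) (fun x => (x, u))).
  exact: cst_continuous.
by apply: (@continuous_pair_at _ _ _ id (fun=> u)); [exact: cvg_id|exact: cst_continuous].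
Qed.

Let smooth_slice (B : set X) eta u : open B -> (forall x, B x -> W (eta, (x, u))) ->
  smooth_on B (fun x => g eta (x, u)).
Proof.
move=> oB BW.
apply: (@smooth_affine R (R * (X * U))%type X (X * U)%type W B (slice eta u)
  (fun w => (0, (w, 0))) (fun ez => g ez.1 ez.2)).
- exact: oB.
- exact: BW.
- exact: continuous_slice.
- move=> x w h; rewrite /slice.
  rewrite -[RHS]/((h *: 0 + eta, (h *: w + x, h *: 0 + u))).
  by rewrite !scaler0 !add0r.
- exact: sg.
Qed.

Let fst_smooth (B : set X) (f : X -> X * U) : open B -> smooth_on B f ->
  smooth_on B (fun x => (f x).1).
Proof.
move=> oB; apply: (@smooth_linear_post R X (X * U)%type X B fst f oB) => //.
by move=> z; exact: cvg_fst.
Qed.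

Let snd_smooth (B : set X) (f : X -> X * U) : open B -> smooth_on B f ->
  smooth_on B (fun x => (f x).2).
Proof.
move=> oB; apply: (@smooth_linear_post R X (X * U)%type U B snd f oB) => //.
by move=> z; exact: cvg_snd.
Qed.

Lemma base_map_smooth (B : set X) eta u : open B ->
  (forall x, B x -> W (eta, (x, u))) -> smooth_on B (Xi eta).
Proof.
move=> oB BW; apply: (@smooth_on_eq _ _ _ B (fun x => (g eta (x, u)).1)) => //.
  by move=> x Bx; rewrite hlin//; exact: BW.
by apply: fst_smooth => //; exact: smooth_slice.
Qed.

Section fixed_parameter.
Variables (eta : R) (Om : set X).
Hypotheses (oO : open Om) (OW : forall x u, Om x -> W (eta, (x, u))).

Lemma action_smooth_Psi a : smooth_on Om (fun x => Psi eta x 0 a).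
Proof.
apply: (@smooth_on_eq _ _ _ Om (fun x => (g eta (x, 0)).2 0 a)) => //.
  by move=> x Ox; rewrite hlin ?mul0mx ?add0r//; exact: OW.
apply: smooth_coord => //; apply: snd_smooth => //.
by apply: smooth_slice => // x Ox; exact: OW.
Qed.

(** The entries of [Phi] are differences of two values of the action on each
    fibre. *)
Lemma action_smooth_Phi a b : smooth_on Om (fun x => Phi eta x a b).
Proof.
apply: (@smooth_on_eq _ _ _ Om (fun x =>
  (g eta (x, delta_mx 0 b)).2 0 a + - (g eta (x, 0)).2 0 a)) => //.
  move=> x Ox; rewrite !hlin; [|exact: OW|exact: OW].
  by rewrite mul0mx add0r -rowE/= !mxE addrK.
apply: smooth_add => //; last apply: smooth_opp => //;
  apply: smooth_coord => //; apply: snd_smooth => //;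
  by apply: smooth_slice => // x Ox; exact: OW.
Qed.

Lemma base_map_inverse x : Om x -> Xi (- eta) (Xi eta x) = x.
Proof.
move=> Ox; have [W' E] := ginv (OW 0 Ox).
rewrite hlin in W' E; last exact: OW.
by rewrite hlin in E => //; case: E.
Qed.

(** The action of [- eta] undoes that of [eta] on the whole fibre over [x], so the
    linear parts of the two fibre maps are inverse to each other. *)
Lemma fibre_map_unit x : Om x -> Phi eta x \in unitmx.
Proof.
move=> Ox.
pose P' := (Phi (- eta) (Xi eta x))^T; pose s' := Psi (- eta) (Xi eta x).
have E u : (u *m (Phi eta x)^T + Psi eta x) *m P' + s' = u.
  have [W' E] := ginv (OW u Ox).
  rewrite hlin in W' E; last exact: OW.
  by rewrite hlin in E => //; case: E.
have E2 (u : U) : u *m ((Phi eta x)^T *m P') = u.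
  have E0 := E 0; have Eu := E u.
  rewrite mul0mx add0r in E0.
  rewrite mulmxDl -addrA E0 addr0 in Eu.
  by rewrite mulmxA.
have E3 : (Phi eta x)^T *m P' = 1%:M.
  apply/row_matrixP => i; have := E2 (delta_mx 0 i).
  by rewrite -rowE => ->; rewrite rowE mulmx1.
by have [] := mulmx1_unit E3; rewrite unitmx_tr.
Qed.

(** As [Phi] is invertible, [g eta] maps the fibre over [x] onto the one over
    [Xi eta x]. *)
Lemma image_domain y w : (Xi eta @` Om) y -> W (- eta, (y, w)).
Proof.
move=> [x Ox <-].
have [W' _] := ginv (OW ((w - Psi eta x) *m invmx (Phi eta x)^T) Ox).
move: W'; rewrite hlin; last exact: OW.
by rewrite mulmxKV ?unitmx_tr ?fibre_map_unit// subrK.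
Qed.

Lemma image_subset : (Xi eta @` Om) `*` setT `<=` M.
Proof. by move=> [y w] [/= Oy _]; have [] := WM (image_domain w Oy). Qed.

(** Near a point of the image, [Xi (- eta)] is defined and continuous, and
    [Xi eta] undoes it. *)
Lemma image_open : open (Xi eta @` Om).
Proof.
rewrite openE => y0 [x0 Ox0 E0].
pose V := slice (- eta) 0 @^-1` W.
have oV : open V by apply: open_comp => // y _; exact: continuous_slice.
have Vy0 : V y0 by apply: image_domain; exists x0.
have sT : smooth_on V (Xi (- eta)) by apply: (base_map_smooth (u := 0)).
have c := smooth_cont sT Vy0.
have Ty0 : Om (Xi (- eta) y0) by rewrite -E0 base_map_inverse.
have : \forall y \near y0, V y /\ Om (Xi (- eta) y).
  apply: filterI; first exact: open_nbhs_nbhs.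
  by apply: c; exact: open_nbhs_nbhs.
apply: filterS => y [Vy Oy]; exists (Xi (- eta) y) => //.
have [W' E] := ginv Vy.
rewrite opprK hlin// in W' E.
have WT := OW (0 *m (Phi (- eta) y)^T + Psi (- eta) y) Oy.
by rewrite hlin// in E; case: E.
Qed.

Lemma image_inverse y : (Xi eta @` Om) y -> Xi eta (Xi (- eta) y) = y.
Proof. by move=> [x Ox <-]; rewrite base_map_inverse. Qed.

Lemma image_inverse_in y : (Xi eta @` Om) y -> Om (Xi (- eta) y).
Proof. by move=> [x Ox <-]; rewrite base_map_inverse. Qed.

Lemma inverse_smooth : smooth_on (Xi eta @` Om) (Xi (- eta)).
Proof.
apply: (base_map_smooth (u := 0)); first exact: image_open.
by move=> y Oy; exact: image_domain.
Qed.

(** Replaces the set-theoretic inverse of [Xi eta] by a smooth map. *)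
Lemma act_funE (u : X -> U) y : (Xi eta @` Om) y ->
  act_fun (Xi eta) (Phi eta) (Psi eta) Om u y =
  u (Xi (- eta) y) *m (Phi eta (Xi (- eta) y))^T + Psi eta (Xi (- eta) y).
Proof.
move=> [x Ox <-]; rewrite /act_fun /=.
have -> : 'pinv_(fun=> 0) Om (Xi eta) (Xi eta x) = x.
  apply: pinvKV; last by rewrite inE.
  move=> a b; rewrite !inE => Oa Ob E.
  by rewrite -(base_map_inverse Oa) E base_map_inverse.
by rewrite base_map_inverse.
Qed.

End fixed_parameter.
End group_element.

(** * Factorization of the transformed equations *)

Section jet_points.
Context {R : realType} {p q n : nat}.

Definition jet_of (x : 'rV[R]_p) (w : 'rV[R]_(jet_dim p q n)) :
  'rV[R]_(p + jet_dim p q n) := row_mx x w.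

Lemma jet_xE x w : jet_x (jet_of x w) = x.
Proof. by rewrite /jet_x /jet_of row_mxKl. Qed.

Lemma jet_unE x w : jet_un (jet_of x w) = w.
Proof. by rewrite /jet_un /jet_of row_mxKr. Qed.

Lemma prolong_jet_of (f : 'rV[R]_p -> 'rV[R]_q) x :
  prolong f x = jet_of x (jet_un (prolong f x)).
Proof. by rewrite -[LHS]hsubmxK -/(jet_x _) jet_x_prolong. Qed.

Lemma prolong_eq_on (A : set 'rV[R]_p) (f h : 'rV[R]_p -> 'rV[R]_q) : open A ->
  (forall x, A x -> f x = h x) -> forall x, A x -> prolong (n := n) f x = prolong h x.
Proof.
move=> oA fh x Ax; rewrite /prolong; congr row_mx; apply/rowP => k; rewrite !mxE.
by apply: (partials_eq_on _ oA _ Ax) => y Ay; rewrite fh.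
Qed.

End jet_points.

Section factorization.
Context {R : realType} {p q n s : nat}.
Notation X := 'rV[R]_p.
Notation U := 'rV[R]_q.
Notation N := (jet_dim p q n).
Notation jet := 'rV[R]_(p + N).
Variables (M : set (X * U)) (Delta : 'I_s -> jet -> R) (kk : 'I_s -> 'I_N).

(** The common form of linear and semilinear systems.  The zeroth order term may
    depend on [u] only if the chosen columns of the Jacobian belong to highest order
    derivatives; in both cases it does not feel a shift of the chosen jet
    coordinates. *)
Definition shiftable_form (a : 'I_s -> 'I_N -> X -> R) (a0 : 'I_s -> X * U -> R) :=
  [/\ forall i k, smooth_on (fst @` M) (a i k),
      forall i z, M z -> {for z, continuous (a0 i)},
      forall i z, jet_space M z ->
        Delta i z = \sum_k a i k (jet_x z) * jet_un z 0 k + a0 i (jet_x z, jet_u z) &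
      (forall i x u u', a0 i (x, u) = a0 i (x, u')) \/
      (forall j, highest_order (kk j))].

Lemma linear_shiftable : linear_system M Delta -> exists a a0, shiftable_form a a0.
Proof.
move=> [a [a0 [sa sa0 E]]]; exists a, (fun i z => a0 i z.1); split => //.
- move=> i z Mz.
  apply: (@continuous_comp _ _ _ fst (a0 i)); first exact: cvg_fst.
  by apply: (smooth_cont (sa0 i)); exists z.
- by left.
Qed.

Lemma semilinear_shiftable : semilinear_system M Delta ->
  (forall j, highest_order (kk j)) -> exists a a0, shiftable_form a a0.
Proof.
move=> [a [a0 [sa sa0 E]]] hk; exists a, a0; split => //.
- by move=> i z Mz; exact: (smooth_cont (sa0 i) Mz).
- by right.
Qed.

Variables (a : 'I_s -> 'I_N -> X -> R) (a0 : 'I_s -> X * U -> R).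
Hypothesis form : shiftable_form a a0.

Lemma highest_order_jet_u (z z' : jet) : (forall j, highest_order (kk j)) ->
  (forall k, (forall j, k != kk j) -> jet_un z 0 k = jet_un z' 0 k) ->
  jet_u z = jet_u z'.
Proof.
move=> hk H; apply/rowP => b; rewrite mxE [RHS]mxE; apply: H => j.
apply/eqP => E; have [n0 on] := hk j; rewrite -E in on.
move: n0; rewrite -on /order_mi big1// => i _.
by rewrite /jet_mi enum_rankK/= ffunE.
Qed.

Lemma shift_a0 i (x : X) (w w' : 'rV[R]_N) :
  (forall k, (forall j, k != kk j) -> w 0 k = w' 0 k) ->
  a0 i (x, jet_u (jet_of x w)) = a0 i (x, jet_u (jet_of x w')).
Proof.
move=> ww; have [_ _ _ [H|hk]] := form; first exact: H.
by rewrite (@highest_order_jet_u (jet_of x w) (jet_of x w'))// !jet_unE.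
Qed.

(** The given minor of the Jacobian of [Delta], by [minor_jacobian]. *)
Definition minor (x : X) : 'M[R]_s := \matrix_(i, j) a i (kk j) x.

Lemma derive_affine_line {V : normedModType R} (f : V -> R) x v c :
  (forall h, f (h *: v + x) - f x = h * c) -> 'D_v f x = c.
Proof.
move=> H.
Transparent derive.
rewrite /derive; apply: cvg_lim => //.
have E : cst c @ (0 : R)^' --> c by exact: cvg_cst.
apply: cvg_trans E; apply: near_eq_cvg.
near=> h.
have h0 : h != 0 by near: h; exact: nbhs_dnbhs_neq.
by rewrite /= H /GRing.scale/= mulKf.
Unshelve. all: by end_near. Qed.
Local Opaque derive.

Variables (Om : set X).
Hypothesis OM : Om `*` setT `<=` M.

Let jetM x (w : 'rV[R]_N) : Om x -> jet_space M (jet_of x w).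
Proof. by move=> Ox; apply: OM; split => //=; rewrite jet_xE. Qed.

Lemma Delta_form i x (w : 'rV[R]_N) : Om x ->
  Delta i (jet_of x w) = \sum_k a i k x * w 0 k + a0 i (x, jet_u (jet_of x w)).
Proof.
move=> Ox; have [_ _ E _] := form.
by rewrite (E i _ (jetM w Ox)) jet_xE jet_unE.
Qed.

Lemma minor_jacobian x (w : 'rV[R]_N) : Om x -> jacobian_minor Delta kk (jet_of x w) = minor x.
Proof.
move=> Ox; apply/matrixP => i j; rewrite !mxE /partial.
apply: derive_affine_line => h.
have -> : h *: delta_mx 0 (rshift p (kk j)) + jet_of x w =
    jet_of x (h *: delta_mx 0 (kk j) + w).
  rewrite /jet_of; apply/rowP => c; rewrite [LHS]mxE [X in X + _]mxE.
  case: (split_ordP c) => d ->; rewrite ?row_mxEl ?row_mxEr !mxE.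
    by rewrite eq_lrshift andbF mulr0 add0r.
  by rewrite eq_rshift.
rewrite !Delta_form//.
rewrite (@shift_a0 i x _ w)//; last first.
  by move=> k kj; rewrite !mxE (negbTE (kj j)) andbF mulr0 add0r.
rewrite opprD addrACA subrr addr0 -sumrB (bigD1 (kk j))//= big1 => [|k kj].
  by rewrite !mxE !eqxx mulr1 mulrDr addrK addr0 mulrC.
by rewrite !mxE (negbTE kj) andbF mulr0 add0r subrr.
Qed.

(** In the chosen jet coordinates the system is affine with matrix [minor x], so it
    can be solved for them. *)
Lemma shift_to_variety x (w : 'rV[R]_N) : Om x -> minor x \in unitmx ->
  let v := invmx (minor x) *m \col_j Delta j (jet_of x w) in
  forall i, Delta i (jet_of x (w - \sum_l v l 0 *: delta_mx 0 (kk l))) = 0.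
Proof.
move=> Ox uB v i; rewrite Delta_form//.
rewrite (@shift_a0 i x _ w)//; last first.
  move=> k kj; rewrite !mxE summxE big1 ?subr0// => l _.
  by rewrite !mxE (negbTE (kj l)) andbF mulr0.
have := Delta_form i w Ox => E.
have Bv : (minor x *m v) i 0 = Delta i (jet_of x w) by rewrite mulKVmx// mxE.
rewrite -[RHS](subrr (Delta i (jet_of x w))) -[X in _ = _ - X]Bv {1}E addrAC; congr (_ + _).
transitivity (\sum_k (a i k x * w 0 k - \sum_l v l 0 * (a i k x * (k == kk l)%:R))).
  apply: eq_bigr => k _; rewrite mxE mulrDr; congr (_ + _).
  rewrite mxE mulrN summxE mulr_sumr; congr (- _); apply: eq_bigr => l _.
  by rewrite !mxE eqxx/= mulrCA.
rewrite big_split/= sumrN; apply: (congr1 (fun z => _ - z)); rewrite mxE exchange_big/=.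
apply: eq_bigr => l _.
rewrite (bigD1 (kk l))//= big1 => [|k /negbTE kl]; last by rewrite kl !mulr0.
by rewrite eqxx mulr1 addr0 [minor _ _ _]mxE mulrC.
Qed.

End factorization.

Section factor.
Context {R : realType} {p q n s : nat}.
Notation X := 'rV[R]_p.
Notation U := 'rV[R]_q.
Notation N := (jet_dim p q n).
Notation jet := 'rV[R]_(p + N).
Variables (M : set (X * U)) (Delta : 'I_s -> jet -> R) (kk : 'I_s -> 'I_N).
Variables (W : set (R * (X * U))) (g : R -> X * U -> X * U)
  (Xi : R -> X -> X) (Phi : R -> X -> 'M[R]_q) (Psi : R -> X -> U).
Hypotheses (hsol : locally_solvable M Delta) (hsym : symmetry_group M Delta W g)
  (hlin : acts_linearly W g Xi Phi Psi) (hns : globally_nonsingular M Delta kk).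
Variables (a : 'I_s -> 'I_N -> X -> R) (a0 : 'I_s -> X * U -> R).
Hypothesis form : shiftable_form M Delta kk a a0.
Variables (eta : R) (Om : set X).
Hypotheses (oO : open Om) (OM : Om `*` setT `<=` M)
  (OW : forall x u, Om x -> W (eta, (x, u))).

Let hloc : local_transformation_group M W g. Proof. by have [] := hsym. Qed.
Let Om' := Xi eta @` Om.
Let Th := Xi (- eta).
Let Ph (y : X) := Phi eta (Th y).
Let Ps (y : X) := Psi eta (Th y).
Let oO' : open Om' := image_open hloc hlin oO OW.
Let sT : smooth_on Om' Th := inverse_smooth hloc hlin oO OW.
Let TO y : Om' y -> Om (Th y) := @image_inverse_in _ _ _ _ _ _ _ _ _ hloc hlin _ _ OW y.
Let TX x : Om x -> Th (Xi eta x) = x := @base_map_inverse _ _ _ _ _ _ _ _ _ hloc hlin _ _ OW x.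
Let OM' : Om' `*` setT `<=` M := image_subset hloc hlin OW.

Let sX : smooth_on Om (Xi eta).
Proof. by apply: (base_map_smooth hloc hlin (u := 0) oO) => x Ox; exact: OW. Qed.

Let XO x : Om x -> Om' (Xi eta x). Proof. by move=> Ox; exists x. Qed.

Lemma action_smooth_Phi_inverse c b : smooth_on Om' (fun y => Ph y c b).
Proof.
exact: (smooth_comp (f := fun x => Phi eta x c b) oO' oO TO sT
  (action_smooth_Phi hloc hlin oO OW c b)).
Qed.

Lemma action_smooth_Psi_inverse c : smooth_on Om' (fun y => Ps y 0 c).
Proof.
exact: (smooth_comp (f := fun x => Psi eta x 0 c) oO' oO TO sT
  (action_smooth_Psi hloc hlin oO OW c)).
Qed.

Let minor_unit x : Om x -> minor kk a x \in unitmx.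
Proof.
move=> Ox; rewrite -(minor_jacobian form OM 0 Ox); apply: hns.
by apply: OM; split => //=; rewrite jet_xE.
Qed.

Let smooth_a i k : smooth_on Om (a i k).
Proof.
have [sa _ _ _] := form; apply: smooth_onS (sa i k) => x Ox.
by exists (x, 0) => //; exact: OM.
Qed.

Let smooth_a' i k : smooth_on Om' (a i k).
Proof.
have [sa _ _ _] := form; apply: smooth_onS (sa i k) => x Ox.
by exists (x, 0) => //; exact: OM'.
Qed.

(** The transform of [f] has as its graph the image of the graph of [f], so that
    the definition of a symmetry group applies once [f] is restricted to [Om]. *)
Lemma transformed_solution (Om1 : set X) (f : X -> U) x :
  smooth_solution M Delta Om1 f -> Om x -> Om1 x ->
  forall i, Delta i (prolong (fun y => f (Th y) *m (Ph y)^T + Ps y) (Xi eta x)) = 0.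
Proof.
move=> [oO1 sf f1] Ox O1x.
pose B := Om `&` Om1.
have oB : open B by exact: openI.
have fB : smooth_solution M Delta B f.
  split; [exact: oB| |by move=> y [_ /f1]].
  by apply: smooth_onS sf => y [].
have oB' := open_preimage_on oO' oB sT.
have sTB : smooth_on (Om' `&` Th @^-1` B) Th by apply: smooth_onS sT => y [].
have [_ H] := hsym.
suff : smooth_solution M Delta (Om' `&` Th @^-1` B)
    (fun y => f (Th y) *m (Ph y)^T + Ps y).
  move=> [_ _ /(_ (Xi eta x))[]//].
  by split; [exact: XO|rewrite /= TX].
apply: (H eta B _ f _ fB).
- by move=> y [Oy _]; exact: OW.
- exact: oB'.
- apply: smooth_row; first exact: oB'.
  move=> c; apply: (@smooth_on_eq _ _ _ (Om' `&` Th @^-1` B)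
    (fun y => \sum_b f (Th y) 0 b * Ph y c b + Ps y 0 c)); first exact: oB'.
    by move=> y _; rewrite !mxE; congr (_ + _); apply: eq_bigr => b _; rewrite mxE.
  apply: smooth_add; [exact: oB'| |]; last first.
    by apply: smooth_onS (action_smooth_Psi_inverse c) => y [].
  apply: smooth_sum; first exact: oB'.
  move=> b; apply: smooth_mul; [exact: oB'| |].
    apply: (smooth_comp (f := fun x => f x 0 b) oB' oB _ sTB); first by move=> y [].
    by apply: smooth_coord; [exact: oB|apply: smooth_onS sf => y []].
  by apply: smooth_onS (action_smooth_Phi_inverse c b) => y [].
- apply/seteqP; split.
    move=> _ [_ [y [Oy O1y] <-] <-].
    exists (Xi eta y); first by split; [exact: XO|rewrite /= TX].
    by rewrite hlin; [rewrite /Ph /Ps TX|exact: OW].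
  move=> _ [y [yO yB] <-]; exists (Th y, f (Th y)); first by exists (Th y).
  rewrite hlin; last by apply: OW; exact: TO.
  by rewrite (image_inverse hloc hlin OW yO).
Qed.

(** Correct the jet of [u] at [x] to a point of the solution variety and let [f] be
    a local solution with this jet.  The equations vanish on the transform of [f],
    and by [prolong_affine] their values on the transforms of [u] and [f] differ by
    a linear expression in the correction, which is itself linear in the values of
    the equations at the jet of [u].  The coefficients do not involve that jet,
    because the zeroth order terms agree for [u] and [f]. *)
Lemma symmetry_factorization : exists Qm : 'I_s -> 'I_s -> X -> R,
  (forall i j, smooth_on Om (Qm i j)) /\
  forall u : X -> U, (forall b, smooth_on Om (fun x => u x 0 b)) ->
  forall x, Om x -> forall i,
    Delta i (prolong (act_fun (Xi eta) (Phi eta) (Psi eta) Om u) (Xi eta x)) =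
    \sum_j Qm i j x * Delta j (prolong u x).
Proof.
have [Lm [Cm [sL LE]]] := prolong_affine (n := n) oO' sT action_smooth_Phi_inverse
  action_smooth_Psi_inverse.
(* The derivative of the [i]-th transformed equation in the [l]-th chosen coordinate. *)
pose Pm i l x := \sum_k a i k (Xi eta x) * Lm k (kk l) (Xi eta x).
exists (fun i j x => \sum_l Pm i l x * invmx (minor kk a x) l j); split.
  move=> i j; apply: smooth_sum; first exact: oO.
  move=> l; apply: smooth_mul; first exact: oO.
    apply: smooth_sum; first exact: oO.
    move=> k; apply: smooth_mul; first exact: oO.
      exact: (smooth_comp oO oO' XO sX (smooth_a' i k)).
    exact: (smooth_comp oO oO' XO sX (sL k (kk l))).
  apply: (smooth_invmx oO _ minor_unit) => c d.
  apply: (@smooth_on_eq _ _ _ Om (a c (kk d))); [exact: oO| |exact: smooth_a].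
  by move=> y _; rewrite mxE.
move=> u su x Ox i.
pose w := jet_un (prolong (n := n) u x).
pose v := invmx (minor kk a x) *m \col_j Delta j (jet_of x w).
pose w' := w - \sum_l v l 0 *: delta_mx 0 (kk l).
have D0 : forall i, Delta i (jet_of x w') = 0.
  exact: (shift_to_variety form OM w Ox (minor_unit Ox)).
have var : solution_variety M Delta (jet_of x w').
  by split; [apply: OM; split => //=; rewrite jet_xE|exact: D0].
have [Om1 [f [sf]]] := hsol var.
rewrite jet_xE => O1x fw.
have fJ : forall b, smooth_on Om1 (fun x => f x 0 b).
  by have [oO1 s1 _] := sf => b; apply: smooth_coord.
have oO1 : open Om1 by have [] := sf.
pose tr (h : X -> U) y := h (Th y) *m (Ph y)^T + Ps y.
have O'x := XO Ox.
have Df : Delta i (prolong (tr f) (Xi eta x)) = 0.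
  exact: (transformed_solution sf Ox O1x i).
have -> : prolong (act_fun (Xi eta) (Phi eta) (Psi eta) Om u) (Xi eta x) =
    prolong (n := n) (tr u) (Xi eta x).
  apply: (prolong_eq_on oO' _ O'x) => y O'y.
  by rewrite (act_funE hloc hlin OW).
have trE h : Om1 x -> prolong (tr h) (Xi eta x) =
    jet_of (Xi eta x) (jet_un (prolong (n := n) (tr h) (Xi eta x))).
  by move=> _; exact: prolong_jet_of.
have Lu k : jet_un (prolong (tr u) (Xi eta x)) 0 k =
    \sum_k' Lm k k' (Xi eta x) * w 0 k' + Cm k (Xi eta x).
  by rewrite (LE Om u oO su _ O'x) ?TX.
have Lf k : jet_un (prolong (tr f) (Xi eta x)) 0 k =
    \sum_k' Lm k k' (Xi eta x) * w' 0 k' + Cm k (Xi eta x).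
  by rewrite (LE Om1 f oO1 fJ _ O'x) ?TX// fw jet_unE.
have ww' k : w 0 k - w' 0 k = \sum_l v l 0 * (k == kk l)%:R.
  rewrite [w' 0 k]mxE opprD addrA subrr add0r [X in - X]mxE opprK summxE.
  by apply: eq_bigr => l _; rewrite !mxE eqxx.
have a0E : a0 i (Xi eta x, jet_u (prolong (n := n) (tr u) (Xi eta x))) =
    a0 i (Xi eta x, jet_u (prolong (n := n) (tr f) (Xi eta x))).
  have [_ _ _ [H|hk]] := form; first exact: H.
  rewrite !jet_u_prolong /tr TX//; congr (a0 i (_, _ *m _ + _)).
  rewrite -(jet_u_prolong (n := n) u) -(jet_u_prolong (n := n) f) fw.
  rewrite (prolong_jet_of u) -/w; apply: (highest_order_jet_u hk) => k kj.
  rewrite !jet_unE; apply/eqP; rewrite -subr_eq0 ww' big1// => l _.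
  by rewrite (negbTE (kj l)) mulr0.
rewrite -[LHS]subr0 -{1}Df.
rewrite (prolong_jet_of (tr u)) (prolong_jet_of (tr f)).
rewrite !(Delta_form form OM')// -!prolong_jet_of a0E.
rewrite opprD addrACA subrr addr0 -sumrB.
transitivity (\sum_l Pm i l x * v l 0); last first.
  rewrite (prolong_jet_of u) -/w.
  under eq_bigr do rewrite mxE mulr_sumr.
  rewrite exchange_big/=; apply: eq_bigr => j _.
  by rewrite mulr_suml; apply: eq_bigr => l _; rewrite [in LHS]mxE mulrA.
rewrite /Pm; under [RHS]eq_bigr do rewrite mulr_suml.
rewrite exchange_big/=; apply: eq_bigr => k _.
rewrite -mulrBr Lu Lf opprD addrACA subrr addr0 -sumrB.
transitivity (a i k (Xi eta x) * \sum_k' \sum_l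
    Lm k k' (Xi eta x) * (v l 0 * (k' == kk l)%:R)).
  by congr (_ * _); apply: eq_bigr => k' _; rewrite -mulrBr ww' mulr_sumr.
rewrite exchange_big/= mulr_sumr; apply: eq_bigr => l _.
rewrite (bigD1 (kk l))//= big1 => [|k' /negbTE kl]; last by rewrite kl !mulr0.
by rewrite eqxx mulr1 addr0 mulrA.
Qed.

End factor.

(** * Moderate and negligible nets *)

Section nets.
Context {R : realType}.

Lemma within_continuous (T : topologicalType) (U : topologicalType) (K : set T) (f : T -> U) :
  (forall x, K x -> {for x, continuous f}) -> {within K, continuous f}.
Proof. by move=> H; apply: continuous_in_subspaceT => x; rewrite inE; exact: H. Qed.

Lemma near_index : \forall e \near (0 : R)^'+, 0 < e <= 1.
Proof.
have [gt0 le1] := (nbhs_right_gt (0 : R), nbhs_right_le (@ltr01 R)).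
by apply: filterS2 gt0 le1 => e -> ->.
Qed.

Lemma inv_power_mono (k k' : nat) : (k <= k')%N ->
  forall e : R, 0 < e <= 1 -> 0 <= e ^- k <= e ^- k'.
Proof.
move=> kk e /andP[e0 e1]; rewrite invr_ge0 (exprn_ge0 _ (ltW e0))/=.
by rewrite lef_pV2 ?posrE ?exprn_gt0// ler_wiXn2l// ltW.
Qed.

Section growth.
Context {p : nat}.
Notation X := 'rV[R]_p.

(** The estimate common to moderate and negligible nets, where [rho e] is a power
    of [e]. *)
Definition net_bound (K : set X) (al : 'I_p -> nat) (rho : R -> R)
    (u : R -> X -> R) : Prop :=
  exists C : R, \forall e \near 0^'+, forall x, K x -> `|partials al (u e) x| <= C * rho e.

Lemma net_bound_add (A K : set X) al rho u v : open A -> K `<=` A ->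
  (forall e, 0 < e <= 1 -> smooth_on A (u e)) ->
  (forall e, 0 < e <= 1 -> smooth_on A (v e)) ->
  net_bound K al rho u -> net_bound K al rho v ->
  net_bound K al rho (fun e x => u e x + v e x).
Proof.
move=> oA KA su sv [C HC] [D HD]; exists (C + D).
apply: filterS3 near_index HC HD => e e01 Hu Hv x Kx.
rewrite (partials_add al oA (su _ e01) (sv _ e01) (KA _ Kx)) mulrDl.
by rewrite (le_trans (ler_normD _ _))// lerD//; [exact: Hu|exact: Hv].
Qed.

Lemma net_bound_mono (K : set X) al rho rho' u :
  (forall e, 0 < e <= 1 -> 0 <= rho e <= rho' e) ->
  net_bound K al rho u -> net_bound K al rho' u.
Proof.
move=> H [C HC]; exists `|C|; apply: filterS2 near_index HC => e e01 HC x Kx.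
have /andP[r0 rr] := H _ e01.
apply: (le_trans (HC _ Kx)); apply: (@le_trans _ _ (`|C| * rho e)).
  by rewrite ler_wpM2r// ler_norm.
by rewrite ler_wpM2l.
Qed.

Lemma net_bound_eq_on (A K : set X) al rho u v : open A -> K `<=` A ->
  (forall e, 0 < e <= 1 -> forall x, A x -> u e x = v e x) ->
  net_bound K al rho u -> net_bound K al rho v.
Proof.
move=> oA KA uv [C HC]; exists C; apply: filterS2 near_index HC => e e01 H x Kx.
by rewrite -(partials_eq_on al oA (uv _ e01) (KA _ Kx)); exact: H.
Qed.

End growth.

Section pullback.
Context {p r : nat}.
Variables (A : set 'rV[R]_p) (B : set 'rV[R]_r) (Th : 'rV[R]_p -> 'rV[R]_r)
  (c0 : 'rV[R]_p -> R).
Hypotheses (oA : open A) (oB : open B) (sT : smooth_on A Th)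
  (TB : forall y, A y -> B (Th y)) (sc : smooth_on A c0).

(** Only finitely many derivatives of the net enter, whence a single exponent of
    growth can be found for all of them. *)
Lemma net_bound_pullback (K : set 'rV[R]_p) al : compact K -> K `<=` A ->
  exists L : seq ('I_r -> nat), forall rho (v : R -> 'rV[R]_r -> R),
    (forall e, 0 < e <= 1 -> 0 <= rho e) ->
    (forall e, 0 < e <= 1 -> smooth_on B (v e)) ->
    Forallp (fun bt => net_bound (Th @` K) bt rho v) L ->
    net_bound K al rho (fun e y => c0 y * v e (Th y)).
Proof.
move=> cK KA; have [L sL HL] := pullback_partials al oA sT sc.
exists (map snd L) => rho v rho0 sv bv.
suff [C HC] : exists C : R, \forall e \near 0^'+, forall y, K y ->
    `|\sum_(l <- L) l.1 y * partials l.2 (v e) (Th y)| <= C * rho e.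
  exists C; apply: filterS2 near_index HC => e e01 H y Ky.
  rewrite (HL B _ oB (sv _ e01) y (KA _ Ky) (TB (KA _ Ky))); exact: H.
elim: L sL bv {HL} => [_ _|l L ih [[sl _] /ih{}ih] [[D HD] /ih{ih} [C HC]]].
  exists 0; apply: filterS near_index => e e01 y Ky.
  by rewrite big_nil normr0 mul0r.
have wl : {within K, continuous l.1}.
  by apply: within_continuous => y Ky; exact: (smooth_cont sl (KA _ Ky)).
have [N N0 HN] := compact_bound cK wl.
exists (N * D + C); apply: filterS3 near_index HC HD => e e01 H1 H2 y Ky.
rewrite big_cons (le_trans (ler_normD _ _))// mulrDl lerD//; last exact: H1.
rewrite normrM -mulrA ler_pM//; first exact: HN.
by apply: H2; exists y.
Qed.

Lemma smooth_net_pullback (v : R -> 'rV[R]_r -> R) :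
  (forall e, 0 < e <= 1 -> smooth_on B (v e)) ->
  forall e, 0 < e <= 1 -> smooth_on A (fun y => c0 y * v e (Th y)).
Proof.
move=> sv e e01; apply: smooth_mul; [exact: oA|exact: sc|].
exact: (smooth_comp oA oB TB sT (sv e e01)).
Qed.

Lemma compact_image_on (K : set 'rV[R]_p) : compact K -> K `<=` A ->
  compact (Th @` K).
Proof.
move=> cK KA; apply: continuous_compact; last exact: cK.
by apply: within_continuous => y Ky; exact: (smooth_cont sT (KA _ Ky)).
Qed.

Let image_in (K : set 'rV[R]_p) : K `<=` A -> Th @` K `<=` B.
Proof. by move=> KA _ [y Ky <-]; apply: TB; exact: KA. Qed.

Lemma moderate_pullback v : moderate B v -> moderate A (fun e y => c0 y * v e (Th y)).
Proof.
move=> [sv mv]; split; first exact: smooth_net_pullback.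
move=> K cK KA al; have [L HL] := net_bound_pullback al cK KA.
have [m Hm] : exists m : nat,
    Forallp (fun bt => net_bound (Th @` K) bt (fun e => e ^- m) v) L.
  elim: L {HL} => [|bt L [m Hm]]; first by exists 0%N.
  have [m' H'] := mv _ (compact_image_on cK KA) (image_in KA) bt.
  exists (maxn m m'); split.
    by apply: net_bound_mono H'; apply: inv_power_mono; rewrite leq_maxr.
  apply: Forallp_sub Hm => bt' H; apply: net_bound_mono H.
  by apply: inv_power_mono; rewrite leq_maxl.
exists m; apply: HL => [e /andP[e0 _]| |]; [|exact: sv|exact: Hm].
by rewrite invr_ge0 exprn_ge0// ltW.
Qed.

Lemma negligible_pullback v : negligible_net B v ->
  negligible_net A (fun e y => c0 y * v e (Th y)).
Proof.
move=> [[sv mv] nv]; split; first exact: moderate_pullback.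
move=> K cK KA al m; have [L HL] := net_bound_pullback al cK KA.
apply: (HL (fun e => e ^+ m)) => [e /andP[e0 _]| |].
- by rewrite exprn_ge0// ltW.
- exact: sv.
- elim: L {HL} => [//|bt L ih]; split; last exact: ih.
  exact: nv (compact_image_on cK KA) (image_in KA) bt m.
Qed.

End pullback.

Section operations.
Context {p : nat}.
Notation X := 'rV[R]_p.
Variable (A : set X).
Hypothesis oA : open A.

Lemma moderate_add u v : moderate A u -> moderate A v ->
  moderate A (fun e x => u e x + v e x).
Proof.
move=> [su mu] [sv mv]; split.
  by move=> e e01; apply: smooth_add; [exact: oA|exact: su|exact: sv].
move=> K cK KA al; have [m Hm] := mu K cK KA al; have [m' Hm'] := mv K cK KA al.
exists (maxn m m'); apply: (net_bound_add oA KA su sv).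
  by apply: net_bound_mono Hm; apply: inv_power_mono; rewrite leq_maxl.
by apply: net_bound_mono Hm'; apply: inv_power_mono; rewrite leq_maxr.
Qed.

Lemma negligible_add u v : negligible_net A u -> negligible_net A v ->
  negligible_net A (fun e x => u e x + v e x).
Proof.
move=> [mu nu] [mv nv]; split; first exact: moderate_add.
move=> K cK KA al m.
exact: (net_bound_add oA KA mu.1 mv.1 (nu K cK KA al m) (nv K cK KA al m)).
Qed.

Lemma moderate_const f : smooth_on A f -> moderate A (fun=> f).
Proof.
move=> sf; split; first by move=> e _; exact: sf.
move=> K cK KA al.
have w : {within K, continuous (partials al f)}.
  apply: within_continuous => y Ky.
  exact: (smooth_cont (smooth_partials al sf) (KA _ Ky)).
have [N N0 HN] := compact_bound cK w.
exists 0%N, N; apply: filterS near_index => e _ x Kx.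
by rewrite expr0 invr1 mulr1; exact: HN.
Qed.

Lemma negligible_zero : negligible_net A (fun _ _ => 0).
Proof.
split; first by apply: moderate_const; exact: smooth_cst.
move=> K cK KA al m; exists 0; apply: filterS near_index => e _ x Kx.
by rewrite (partials_cst0 al oA (KA _ Kx)) normr0 mul0r.
Qed.

Lemma moderate_sum q (u : 'I_q -> R -> X -> R) : (forall i, moderate A (u i)) ->
  moderate A (fun e x => \sum_i u i e x).
Proof.
move=> mu; elim: (index_enum _) => [|i r ih].
  rewrite (_ : (fun e x => _) = (fun _ _ => 0)); first exact: negligible_zero.1.
  by apply/funext => e; apply/funext => x; rewrite big_nil.
rewrite (_ : (fun e x => _) = (fun e x => u i e x + \sum_(i <- r) u i e x)).
  by apply: moderate_add; [exact: mu|exact: ih].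
by apply/funext => e; apply/funext => x; rewrite big_cons.
Qed.

Lemma negligible_sum q (u : 'I_q -> R -> X -> R) : (forall i, negligible_net A (u i)) ->
  negligible_net A (fun e x => \sum_i u i e x).
Proof.
move=> mu; elim: (index_enum _) => [|i r ih].
  rewrite (_ : (fun e x => _) = (fun _ _ => 0)); first exact: negligible_zero.
  by apply/funext => e; apply/funext => x; rewrite big_nil.
rewrite (_ : (fun e x => _) = (fun e x => u i e x + \sum_(i <- r) u i e x)).
  by apply: negligible_add; [exact: mu|exact: ih].
by apply/funext => e; apply/funext => x; rewrite big_cons.
Qed.

Lemma partials_opp al (f : X -> R) x : smooth_on A f -> A x ->
  partials al (fun y => - f y) x = - partials al f x.
Proof.
move=> sf Ax; apply/eqP; rewrite -addr_eq0; apply/eqP.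
rewrite -(partials_add al oA (smooth_opp oA sf) sf Ax).
rewrite (_ : (fun y => _) = (fun=> 0)); first exact: (partials_cst0 al oA Ax).
by apply/funext => y; rewrite addNr.
Qed.

Lemma negligible_opp u : negligible_net A u -> negligible_net A (fun e x => - u e x).
Proof.
move=> [[su mu] nu].
have nb (K : set X) al rho : K `<=` A -> net_bound K al rho u ->
    net_bound K al rho (fun e x => - u e x).
  move=> KA [C HC]; exists C; apply: filterS2 near_index HC => e e01 H x Kx.
  by rewrite (partials_opp al (su _ e01) (KA _ Kx)) normrN; exact: H.
split; first split.
- by move=> e e01; apply: smooth_opp; [exact: oA|exact: su].
- by move=> K cK KA al; have [m Hm] := mu K cK KA al; exists m; exact: nb.
- by move=> K cK KA al m; apply: (nb _ _ _ KA); exact: nu.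
Qed.

Lemma moderate_eq_on u v : (forall e, 0 < e <= 1 -> forall x, A x -> u e x = v e x) ->
  moderate A u -> moderate A v.
Proof.
move=> uv [su mu]; split.
  by move=> e e01; apply: (smooth_on_eq oA (uv e e01)); exact: su.
move=> K cK KA al; have [m Hm] := mu K cK KA al.
by exists m; exact: (net_bound_eq_on oA KA uv Hm).
Qed.

Lemma negligible_eq_on u v : (forall e, 0 < e <= 1 -> forall x, A x -> u e x = v e x) ->
  negligible_net A u -> negligible_net A v.
Proof.
move=> uv [mu nu]; split; first exact: (moderate_eq_on uv).
move=> K cK KA al m; exact: (net_bound_eq_on oA KA uv (nu K cK KA al m)).
Qed.

End operations.

End nets.

(** * Transport of test functions *)

Section integral_sum.
Context {R : realType} {p : nat}.

Lemma Cc_add (f h : 'rV[R]_p -> R) : Cc f -> Cc h -> Cc (fun x => f x + h x).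
Proof.
move=> [cf [r fr]] [ch [r' hr]]; split.
  by move=> x; exact: (continuousD (cf x) (ch x)).
exists (Num.max r r') => x; rewrite gt_max => /andP[rx rx'].
by rewrite fr// hr// addr0.
Qed.

Lemma Int_sum I (r : seq I) (F : I -> 'rV[R]_p -> R) : (forall i, Cc (F i)) ->
  Cc (fun x => \sum_(i <- r) F i x) /\
  Int (fun x => \sum_(i <- r) F i x) = \sum_(i <- r) Int (F i).
Proof.
move=> CF; elim: r => [|i r [Cr Er]].
  rewrite (_ : (fun x => _) = fun=> 0); last by apply/funext => x; rewrite big_nil.
  rewrite big_nil Int0; split=> //; split; first exact: cst_continuous.
  by exists 0.
rewrite (_ : (fun x => _) = fun x => F i x + \sum_(i <- r) F i x); last first.
  by apply/funext => x; rewrite big_cons.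
by rewrite big_cons (IntD (CF i) Cr) Er; split=> //; exact: Cc_add.
Qed.

End integral_sum.

Section transport.
Context {R : realType} {p : nat}.
Notation X := 'rV[R]_p.
Variables (Om Om' : set X) (Xi Th : X -> X).
Hypotheses (oO : open Om) (oO' : open Om') (sX : smooth_on Om Xi)
  (sT : smooth_on Om' Th) (XO : forall x, Om x -> Om' (Xi x))
  (TO : forall y, Om' y -> Om (Th y)) (TX : forall x, Om x -> Th (Xi x) = x).

(** Extended by zero, to be a test function on the whole space. *)
Definition transport (c phi : X -> R) : X -> R := (fun x => c x * phi (Xi x)) \_ Om.

Lemma transportE c phi x : Om x -> transport c phi x = c x * phi (Xi x).
Proof. by move=> Ox; rewrite /transport patchE mem_set. Qed.

Lemma transport_supp (K : set X) c phi x : (forall y, ~ K y -> phi y = 0) ->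
  ~ (Th @` K) x -> transport c phi x = 0.
Proof.
move=> phi0 Kx; rewrite /transport patchE; case: ifPn => // /set_mem Ox.
rewrite phi0 ?mulr0// => KX; apply: Kx.
by exists (Xi x); [exact: KX|exact: TX].
Qed.

Lemma compact_image_Th (K : set X) : compact K -> K `<=` Om' ->
  compact (Th @` K) /\ Th @` K `<=` Om.
Proof.
move=> cK KO; split; first exact: (compact_image_on sT).
by move=> _ [y Ky <-]; apply: TO; exact: KO.
Qed.

Section weight.
Variable c : X -> R.
Hypothesis sc : smooth_on Om c.

Lemma transport_smooth (K : set X) phi : compact K -> K `<=` Om' ->
  smooth_on Om' phi -> (forall y, ~ K y -> phi y = 0) ->
  smooth_on setT (transport c phi).
Proof.
move=> cK KO sphi phi0; have [cTK TKO] := compact_image_Th cK KO.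
have oTK : open (~` (Th @` K)).
  by apply: closed_openC; exact: compact_closed.
apply: smooth_on_local => x _; case: (pselect (Om x)) => [Ox|Ox].
  exists Om, (fun x => c x * phi (Xi x)); split; [exact: oO|exact: Ox| |].
    apply: smooth_mul; [exact: oO|exact: sc|exact: (smooth_comp oO oO' XO sX sphi)].
  by move=> y Oy; rewrite transportE.
exists (~` (Th @` K)), (fun=> 0); split; [exact: oTK|by move/TKO| |].
  exact: smooth_cst.
by move=> y Ky; rewrite (transport_supp c phi0 Ky).
Qed.

Lemma test_function_transport phi : test_function Om' phi ->
  test_function Om (transport c phi).
Proof.
move=> [sphi [K [cK KO phi0]]]; have [cTK TKO] := compact_image_Th cK KO; split.
  apply: (transport_smooth cK KO _ phi0).
  by apply: smooth_onS sphi.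
by exists (Th @` K); split => // x Kx; exact: (transport_supp c phi0 Kx).
Qed.

(** Pullbacks do not raise the order of derivatives, so bounds up to order [k] are
    inherited for each [k] separately. *)
Lemma bounded_test_set_transport k B : bounded_test_set Om' k B ->
  bounded_test_set Om k [set transport c phi | phi in B].
Proof.
move=> [BT [K [cK KO B0]] Bk]; have [cTK TKO] := compact_image_Th cK KO.
have oTK : open (~` (Th @` K)).
  by apply: closed_openC; exact: compact_closed.
split.
- by move=> _ [phi Bphi <-]; apply: test_function_transport; exact: BT.
- exists (Th @` K); split => // _ [phi Bphi <-] x Kx.
  exact: (transport_supp c (B0 _ Bphi) Kx).
- move=> al alk; have [L sL HL] := pullback_partials al oO sX sc.
  suff [C C0 HC] : exists2 C : R, 0 <= C & forall phi, B phi -> forall x, (Th @` K) x ->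
      `|\sum_(l <- L) l.1 x * partials l.2 phi (Xi x)| <= C.
    exists C => _ [phi Bphi <-] x; have [Kx|Kx] := pselect ((Th @` K) x).
      have Ox := TKO _ Kx.
      rewrite (_ : partials al (transport c phi) x =
        partials al (fun x => c x * phi (Xi x)) x); last first.
        by apply: (partials_eq_on al oO _ Ox) => y Oy; rewrite transportE.
      have sphi : smooth_on Om' phi by apply: smooth_onS (BT _ Bphi).1.
      by rewrite (HL Om' phi oO' sphi x Ox (XO Ox)); exact: HC.
    rewrite (_ : partials al (transport c phi) x = partials al (fun=> 0) x).
      by rewrite (partials_cst0 al oTK Kx) normr0.
    apply: (partials_eq_on al oTK _ Kx) => y Ky.
    exact: (transport_supp c (B0 _ Bphi) Ky).
  elim: L sL {HL} => [_|l L ih [[sl ll] /ih[C C0 HC]]].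
    by exists 0 => // phi _ x _; rewrite big_nil normr0.
  have wl : {within Th @` K, continuous l.1}.
    by apply: within_continuous => y Ky; exact: (smooth_cont sl (TKO _ Ky)).
  have [N N0 HN] := compact_bound cTK wl.
  have [D HD] := Bk l.2 (leq_trans ll alk).
  exists (N * `|D| + C); first by rewrite addr_ge0// mulr_ge0.
  move=> phi Bphi x Kx; rewrite big_cons (le_trans (ler_normD _ _))// lerD//; last exact: HC.
  rewrite normrM ler_pM//; first exact: HN.
  by rewrite (le_trans _ (ler_norm D))//; exact: HD.
Qed.

End weight.
End transport.

(** * Test integrals of transformed nets *)

Section limits.
Context {R : realType}.

Lemma cvge0_abs (f : R -> \bar R) : f e @[e --> 0^'+] --> 0%E <->
  forall d : R, 0 < d -> \forall e \near 0^'+, ((- d)%:E <= f e <= d%:E)%E.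
Proof.
split.
  move=> /fine_cvgP[fin cf] d d0.
  have /cvgrPdist_le/(_ _ d0) cf' := cf.
  apply: filterS2 fin cf' => e fe; rewrite sub0r normrN /= => H.
  by rewrite -(fineK fe) !lee_fin -ler_norml.
move=> H; apply/fine_cvgP; split.
  apply: filterS (H 1 ltr01) => e /andP[H1 H2].
  rewrite fin_numE; apply/andP; split; apply/eqP => E.
    by rewrite E in H1.
  by rewrite E in H2.
apply/cvgrPdist_le => d d0; apply: filterS (H d d0) => e /andP[H1 H2].
have fe : f e \is a fin_num.
  rewrite fin_numE; apply/andP; split; apply/eqP => E.
    by rewrite E in H1.
  by rewrite E in H2.
by move: H1 H2; rewrite sub0r normrN /= -(fineK fe) !lee_fin ler_norml => -> ->.
Qed.

End limits.

Section action_on_classes.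
Context {R : realType} {p q n s : nat}.
Notation X := 'rV[R]_p.
Notation U := 'rV[R]_q.
Notation N := (jet_dim p q n).
Notation jet := 'rV[R]_(p + N).
Variables (M : set (X * U)) (Delta : 'I_s -> jet -> R) (kk : 'I_s -> 'I_N).
Variables (W : set (R * (X * U))) (g : R -> X * U -> X * U)
  (Xi : R -> X -> X) (Phi : R -> X -> 'M[R]_q) (Psi : R -> X -> U).
Hypotheses (hsol : locally_solvable M Delta) (hsym : symmetry_group M Delta W g)
  (hlin : acts_linearly W g Xi Phi Psi) (hns : globally_nonsingular M Delta kk).
Variables (a : 'I_s -> 'I_N -> X -> R) (a0 : 'I_s -> X * U -> R).
Hypothesis form : shiftable_form M Delta kk a a0.

Let hloc : local_transformation_group M W g. Proof. by have [] := hsym. Qed.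

(** The integrand of an associated solution is continuous, as the equations are
    affine in the jet with continuous coefficients. *)
Lemma continuous_Delta_prolong (A : set X) (u : X -> U) i x : open A ->
  A `*` setT `<=` M -> (forall b, smooth_on A (fun x => u x 0 b)) -> A x ->
  {for x, continuous (fun x => Delta i (prolong u x))}.
Proof.
move=> oA AM su Ax; have [sa ca E _] := form.
have Mx y : A y -> M (y, u y) by move=> Ay; apply: AM.
have su' : smooth_on A u by apply: smooth_row.
apply: (@continuous_eq_on _ _ _ A (fun x =>
  \sum_k a i k x * partials (jet_mi k) (fun y => u y 0 (jet_dep k)) x + a0 i (x, u x)) _ _ oA Ax).
  move=> y Ay; rewrite E; last by rewrite /jet_space /= jet_x_prolong jet_u_prolong; exact: Mx.
  rewrite jet_x_prolong jet_u_prolong; congr (_ + _).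
  by apply: eq_bigr => k _; rewrite jet_un_prolong.
apply: (@cvgD _ _ _ (nbhs x)).
  apply: cvg_fsum => k; apply: continuousM_fun.
    by apply: (smooth_cont (sa i k)); exists (x, u x) => //; exact: Mx.
  exact: (smooth_cont (smooth_partials _ (su (jet_dep k))) Ax).
apply: (@continuous_comp _ _ _ (fun x => (x, u x)) (a0 i)); last exact: ca (Mx _ Ax).
by apply: continuous_pair_at; [exact: cvg_id|exact: (smooth_cont su' Ax)].
Qed.

Lemma test_integral_Int (A : set X) (u : X -> U) i psi : open A ->
  A `*` setT `<=` M -> (forall b, smooth_on A (fun x => u x 0 b)) ->
  test_function A psi ->
  Cc ((fun x => Delta i (prolong u x) * psi x) \_ A) /\
  test_integral Delta A u i psi = (Int ((fun x => Delta i (prolong u x) * psi x) \_ A))%:E.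
Proof.
move=> oA AM su [spsi [K [cK KA psi0]]].
have C : Cc ((fun x => Delta i (prolong u x) * psi x) \_ A).
  apply: (Cc_ext0 oA cK KA) => [x Ax|x Ax Kx]; last by rewrite psi0// mulr0.
  apply: continuousM_fun; first exact: (continuous_Delta_prolong oA AM su Ax).
  exact: (smooth_cont spsi I).
split; first exact: C.
apply: (integral_rV_Int C) => x Ax; first by rewrite patchE mem_set.
by rewrite patchE memNset.
Qed.

Variables (eta : R) (Om : set X).
Hypotheses (oO : open Om) (OM : Om `*` setT `<=` M)
  (OW : forall x u, Om x -> W (eta, (x, u))).

Notation Om' := (Xi eta @` Om).
Let Th := Xi (- eta).
Let oO' : open Om' := image_open hloc hlin oO OW.
Let sT : smooth_on Om' Th := inverse_smooth hloc hlin oO OW.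
Let TO y : Om' y -> Om (Th y) := @image_inverse_in _ _ _ _ _ _ _ _ _ hloc hlin _ _ OW y.
Let TX x : Om x -> Th (Xi eta x) = x := @base_map_inverse _ _ _ _ _ _ _ _ _ hloc hlin _ _ OW x.
Let XT y : Om' y -> Xi eta (Th y) = y := @image_inverse _ _ _ _ _ _ _ _ _ hloc hlin _ _ OW y.
Let OM' : Om' `*` setT `<=` M := image_subset hloc hlin OW.
Let sX : smooth_on Om (Xi eta).
Proof. by apply: (base_map_smooth hloc hlin (u := 0) oO) => x Ox; exact: OW. Qed.
Let XO x : Om x -> Om' (Xi eta x). Proof. by move=> Ox; exists x. Qed.

Notation act := (act_fun (Xi eta) (Phi eta) (Psi eta) Om).

Lemma act_coord u y b : Om' y -> act u y 0 b =
  \sum_c Phi eta (Th y) b c * u (Th y) 0 c + Psi eta (Th y) 0 b.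
Proof.
move=> yO; rewrite (act_funE hloc hlin OW u yO) mxE [in LHS]mxE; congr (_ + _).
by apply: eq_bigr => c _; rewrite mxE mulrC.
Qed.

Lemma act_moderate u : moderate_vec Om u -> moderate_vec Om' (fun e => act (u e)).
Proof.
move=> mu b.
apply: (@moderate_eq_on _ _ Om' oO' (fun e y =>
  \sum_c Phi eta (Th y) b c * u e (Th y) 0 c + Psi eta (Th y) 0 b)).
  by move=> e _ y yO; rewrite act_coord.
apply: (@moderate_add _ _ Om' oO' (fun e y => \sum_c Phi eta (Th y) b c * u e (Th y) 0 c)
  (fun e y => Psi eta (Th y) 0 b)); last first.
  exact: (moderate_const (action_smooth_Psi_inverse hsym hlin oO OW b)).
apply: (moderate_sum oO') => c.
apply: (@moderate_pullback _ _ _ Om' Om Th (fun y => Phi eta (Th y) b c) oO' oO sT TO _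
  (fun e x => u e x 0 c)); last exact: mu.
exact: (action_smooth_Phi_inverse hsym hlin oO OW b c).
Qed.

(** The action is affine in [u]: differences are transformed by its linear part. *)
Lemma act_negligible u v : negligible_vec Om (fun e x => v e x - u e x) ->
  negligible_vec Om' (fun e y => act (v e) y - act (u e) y).
Proof.
move=> nuv b.
apply: (@negligible_eq_on _ _ Om' oO' (fun e y =>
  \sum_c Phi eta (Th y) b c * (v e (Th y) - u e (Th y)) 0 c)).
  have subE (w w' : U) : (w - w') 0 b = w 0 b - w' 0 b by rewrite !mxE.
  move=> e _ y yO; rewrite subE !act_coord//.
  rewrite opprD addrACA subrr addr0 -sumrB; apply: eq_bigr => c _.
  by rewrite -mulrBr !mxE.
apply: (negligible_sum oO') => c.
apply: (@negligible_pullback _ _ _ Om' Om Th (fun y => Phi eta (Th y) b c) oO' oO sT TO _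
  (fun e x => (v e x - u e x) 0 c)); last exact: nuv.
exact: (action_smooth_Phi_inverse hsym hlin oO OW b c).
Qed.

Lemma act_gen_class u0 u v : gen_class Om u0 u -> gen_class Om u0 v ->
  gen_class Om' (fun e => act (u e)) (fun e => act (v e)).
Proof.
move=> [mu nu] [mv nv]; split; first exact: act_moderate.
apply: act_negligible => b.
apply: (@negligible_eq_on _ _ Om oO (fun e x =>
  (v e x - u0 e x) 0 b + - (u e x - u0 e x) 0 b)).
  by move=> e _ x _; rewrite !mxE opprB addrA subrK.
by apply: (negligible_add oO); [exact: nv|apply: (negligible_opp oO); exact: nu].
Qed.

(** The factorization, integrated against a test function and pulled back by the
    base map.  The Jacobian determinant is absorbed into the weights. *)
Lemma test_integral_transfer : exists Qm : 'I_s -> 'I_s -> X -> R,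
  (forall i j, smooth_on Om (Qm i j)) /\
  forall u : X -> U, (forall b, smooth_on Om (fun x => u x 0 b)) ->
  forall phi, test_function Om' phi -> forall i,
    test_integral Delta Om' (act u) i phi =
    (\sum_j Int ((fun x => Delta j (prolong u x) *
       transport Om (Xi eta) (Qm i j) phi x) \_ Om))%:E.
Proof.
have [Qm [sQ QE]] := symmetry_factorization hsol hsym hlin hns form oO OM OW.
have sJ : smooth_on Om (absdet_jac (Xi eta)).
  apply: (smooth_absdet_jac oO sX) => x Ox.
  exact: (jac_unit oO oO' sX sT XO TX Ox).
pose c i j x := Qm i j x * absdet_jac (Xi eta) x.
have sc i j : smooth_on Om (c i j).
  by apply: smooth_mul; [exact: oO|exact: sQ|exact: sJ].
exists c; split; first exact: sc.
move=> u su phi tphi i.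
have su' b : smooth_on Om' (fun y => act u y 0 b).
  have mu : moderate_vec Om (fun=> u).
    by move=> b'; exact: (moderate_const (su b')).
  have [H _] := act_moderate mu b; by apply: (H 1); rewrite ltr01 lexx.
have [CF ->] := test_integral_Int i oO' OM' su' tphi.
have tT j := test_function_transport oO oO' sX sT XO TO TX (sc i j) tphi.
have CG j := (test_integral_Int j oO OM su (tT j)).1.
have [_ <-] := Int_sum (index_enum _) CG.
have [_ [K [cK KO phi0]]] := tphi.
have F0 y : ~ K y -> ((fun x => Delta i (prolong (act u) x) * phi x) \_ Om') y = 0.
  by move=> Ky; rewrite patchE; case: ifP => // _; rewrite phi0// mulr0.
rewrite -(change_of_variables oO oO' sX sT XO TO TX XT CF cK KO F0).
congr (_%:E); apply: Int_ext => x; rewrite patchE; case: ifPn => [/set_mem Ox|/negP Ox].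
  rewrite patchE mem_set; last exact: XO.
  rewrite (QE u su x Ox) !mulr_suml; apply: eq_bigr => j _.
  rewrite patchE mem_set// transportE// /c.
  have ringE (A B C D : R) : A * B * C * D = B * (A * D * C) by ring.
  exact: ringE.
by rewrite big1// => j _; rewrite patchE; case: ifP.
Qed.

(** One-sided bounds on the test integrals of [u], as given by a supremum, suffice:
    the weights [c] and [- c] give opposite integrals. *)
Lemma test_integral_small (u : R -> X -> U) (B : set (X -> R)) :
  moderate_vec Om u -> B `<=` test_function Om' ->
  (forall c j, smooth_on Om c -> forall d : R, 0 < d -> \forall e \near 0^'+,
     forall phi, B phi ->
       (test_integral Delta Om (u e) j (transport Om (Xi eta) c phi) <= d%:E)%E) ->
  forall i (d : R), 0 < d -> \forall e \near 0^'+, forall phi, B phi ->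
    ((- d)%:E <= test_integral Delta Om' (act (u e)) i phi <= d%:E)%E.
Proof.
move=> mu BT H i d d0.
have [Qm [sQ QE]] := test_integral_transfer.
(* One share of [d] for each of the [s] equations; the successor avoids dividing by 0. *)
pose d' := d / s.+1%:R.
have d'0 : 0 < d' by rewrite divr_gt0.
have H1 : \forall e \near 0^'+, forall j phi, B phi ->
    (test_integral Delta Om (u e) j (transport Om (Xi eta) (Qm i j) phi) <= d'%:E)%E.
  by apply: filter_forall => j; exact: H.
have H2 : \forall e \near 0^'+, forall j phi, B phi ->
    (test_integral Delta Om (u e) j
       (transport Om (Xi eta) (fun x => (- Qm i j x)%R) phi) <= d'%:E)%E.
  by apply: filter_forall => j; apply: H => //; apply: smooth_opp.
apply: filterS3 near_index H1 H2 => e e01 H1 H2 phi Bphi.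
have su b : smooth_on Om (fun x => u e x 0 b) by apply: (mu b).1.
rewrite (QE (u e) su phi (BT _ Bphi)) !lee_fin -ler_norml.
apply: (le_trans (ler_norm_sum _ _ _)).
apply: (@le_trans _ _ (\sum_(j < s) d')); last first.
  rewrite sumr_const card_ord -[leLHS]mulr_natr /d' -mulrA ger_pMr//.
  by rewrite mulrC ler_pdivrMr// mul1r ler_nat.
apply: ler_sum => j _.
have tT c (sc : smooth_on Om c) :=
  test_function_transport oO oO' sX sT XO TO TX sc (BT _ Bphi).
have [C1 E1] := test_integral_Int j oO OM su (tT _ (sQ i j)).
have [C2 E2] := test_integral_Int j oO OM su (tT _ (smooth_opp oO (sQ i j))).
have := H1 j phi Bphi; rewrite E1 lee_fin => B1.
have := H2 j phi Bphi; rewrite E2 lee_fin => B2.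
rewrite ler_norml B1 andbT lerNl -mulN1r -IntZ//.
rewrite (_ : (fun x => _) = (fun x => Delta j (prolong (u e) x) *
  transport Om (Xi eta) (fun x => - Qm i j x) phi x) \_ Om)//.
apply/funext => x; rewrite !patchE; case: ifPn => [/set_mem Ox|_]; last by rewrite mulr0.
by rewrite !transportE// mulN1r -mulrN mulNr.
Qed.

End action_on_classes.

(** * Symmetries of associated solutions *)

Theorem corollary3p10 (R : realType) (p q n s : nat)
  (M : set ('rV[R]_p * 'rV[R]_q))
  (Delta : 'I_s -> 'rV[R]_(p + jet_dim p q n) -> R)
  (W : set (R * ('rV[R]_p * 'rV[R]_q)))
  (g : R -> 'rV[R]_p * 'rV[R]_q -> 'rV[R]_p * 'rV[R]_q)
  (Xi : R -> 'rV[R]_p -> 'rV[R]_p)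
  (Phi : R -> 'rV[R]_p -> 'M[R]_q)
  (Psi : R -> 'rV[R]_p -> 'rV[R]_q)
  (hM : open M)
  (hnondeg : nondegenerate_system M Delta)
  (hslow : slowly_increasing M Delta)
  (hsym : symmetry_group M Delta W g)
  (hlin : acts_linearly W g Xi Phi Psi)
  (hcase : exists k : 'I_s -> 'I_(jet_dim p q n),
     [/\ {homo k : i j / (i < j)%N},
         globally_nonsingular M Delta k &
         linear_system M Delta \/
         (semilinear_system M Delta /\ forall j, highest_order (k j))]) :
  forall k : nat, (0 < k)%N -> AS_symmetry_group M Delta k W g Xi Phi Psi.
Proof.
move=> k _; have [hsol _] := hnondeg; have [hloc _] := hsym.
have [kk [_ hns hform]] := hcase.
have {hform} [a [a0 form]] : exists a a0, shiftable_form M Delta kk a a0.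
  case: hform => [lin|[semi hk]]; first exact: linear_shiftable.
  exact: semilinear_shiftable.
split=> [//|eta Om V [[oO OM cV [u1 Vu1 asso]] [u2 Vu2 strong]] OW u Vu].
have oO' := image_open hloc hlin oO OW.
have OM' := image_subset hloc hlin OW.
have sX : smooth_on Om (Xi eta).
  by apply: (base_map_smooth hloc hlin (u := 0) oO) => x Ox; exact: OW.
have XO x : Om x -> (Xi eta @` Om) (Xi eta x) by move=> Ox; exists x.
have sT := inverse_smooth hloc hlin oO OW.
have TO y := @image_inverse_in _ _ _ _ _ _ _ _ _ hloc hlin _ _ OW y.
have TX x := @base_map_inverse _ _ _ _ _ _ _ _ _ hloc hlin _ _ OW x.
have [u0 mu0 V0] := cV.
have mV v : V v -> moderate_vec Om v by rewrite -V0 => -[].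
have gV v w : V v -> V w -> gen_class (Xi eta @` Om)
    (fun e => act_fun (Xi eta) (Phi eta) (Psi eta) Om (v e))
    (fun e => act_fun (Xi eta) (Phi eta) (Psi eta) Om (w e)).
  by rewrite -V0; exact: (act_gen_class hsym hlin oO OW).
have small := test_integral_small hsol hsym hlin hns form oO OM OW.
split; first split.
- exact: oO'.
- exact: OM'.
- exists (fun e => act_fun (Xi eta) (Phi eta) (Psi eta) Om (u e)) => //.
  exact: (act_moderate hsym hlin oO OW (mV _ Vu)).
- exists (fun e => act_fun (Xi eta) (Phi eta) (Psi eta) Om (u1 e)); first exact: gV.
  move=> phi tphi i; apply/cvge0_abs => d d0.
  have phiT : [set phi] `<=` test_function (Xi eta @` Om) by move=> _ ->.
  have H := small u1 [set phi] (mV _ Vu1) phiT _ i d d0.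
  apply: (filterS _ (H _)) => [e /(_ phi erefl)//|].
  move=> c j sc d' d'0.
  have tT := test_function_transport oO oO' sX sT XO TO TX sc tphi.
  have /cvge0_abs/(_ _ d'0) := asso _ tT j.
  by apply: filterS => e /andP[_ H'] _ ->.
- exists (fun e => act_fun (Xi eta) (Phi eta) (Psi eta) Om (u2 e)); first exact: gV.
  move=> B [phi0 Bphi0] Bb i; apply/cvge0_abs => d d0.
  have [BT _ _] := Bb.
  have H := small u2 B (mV _ Vu2) BT _ i d d0.
  apply: (filterS _ (H _)) => [e He|c j sc d' d'0].
    apply/andP; split.
      have /andP[/le_trans + _] := He _ Bphi0; apply.
      by apply: ereal_sup_ubound; exists phi0.
    apply: ge_ereal_sup => _ [phi Bphi <-].
    by have /andP[] := He _ Bphi.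
  have BTb := bounded_test_set_transport oO oO' sX sT XO TO TX sc Bb.
  have BT0 : [set transport Om (Xi eta) c phi | phi in B] !=set0.
    by exists (transport Om (Xi eta) c phi0); exists phi0.
  have /cvge0_abs/(_ _ d'0) := strong _ BT0 BTb j.
  apply: filterS => e /andP[_ H'] phi Bphi; apply: le_trans H'.
  by apply: ereal_sup_ubound; exists (transport Om (Xi eta) c phi) => //; exists phi.
Qed.
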